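(* Let $B\subset\mathbb{R}^4$ be a bounded connected domain with smooth boundary, and let $A$ be a smooth ASD connection on a Hermitian bundle $E$ over $\overline{B}$, with local Nahm transform $(\hat E,\hat A)$ over $\hat{\mathbb{R}}^4$. Let $H^2_D=\{s\in L^2(B,E\otimes S_-):D_A^-s=0\}$ and let $\hat x_\mu=P_0\circ x_\mu$ ($\mu=1,2,3,4$) be the bounded Hermitian operators on $H^2_D$ given by multiplication by the coordinate function $x_\mu$ followed by the orthogonal projection $P_0$ of $L^2(B,E\otimes S_-)$ onto $H^2_D$. Then the ASD condition on $\hat A$ is equivalent to $$[\hat x_1,\hat x_2]+[\hat x_3,\hat x_4]=0,\qquad [\hat x_1,\hat x_3]+[\hat x_4,\hat x_2]=0,\qquad [\hat x_1,\hat x_4]+[\hat x_2,\hat x_3]=0.$$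
   Context: ASD means the curvature satisfies $*F=-F$. $S_\pm$ are the spinor bundles of $\mathbb{R}^4$ with anti-self-adjoint Clifford multiplications $c_\mu$, $c_\mu c_\nu+c_\nu c_\mu=-2\delta_{\mu\nu}$, ASD 2-forms acting trivially on $S_+$; $D_A^\pm=\sum_\mu c_\mu\nabla_{A,\mu}$ on $E\otimes S_\pm$. Local Nahm transform: with dual coordinates $z_\mu$ on $\hat{\mathbb{R}}^4$, put $A_z=A+2\pi i\sum_\mu z_\mu dx_\mu$, $\hat E_z=\ker\big(D^-_{A_z}\text{ on }L^2(B,E\otimes S_-)\big)$, and let $P_z$ be the $L^2$-orthogonal projection onto $\hat E_z$. The connection $\hat A$ on the Hilbert bundle $\hat E$ has covariant derivative $P_z\circ\hat d$, where $\hat d$ is the trivial connection on $\hat{\mathbb{R}}^4\times L^2(B,E\otimes S_-)$. *)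

(* Defs.v *)
From HB Require Import structures.
From mathcomp Require Import all_boot all_order all_algebra.
From mathcomp Require Import all_classical all_reals all_analysis.
From mathcomp Require Import complex.
Set Implicit Arguments.
Unset Strict Implicit.
Unset Printing Implicit Defensive.
Import Order.TTheory GRing.Theory Num.Theory.
Import numFieldNormedType.Exports.

Local Open Scope classical_set_scope.
Local Open Scope complex_scope.
Local Open Scope ring_scope.

(* An iterated product rather than 'rV[R]_4: it carries at once the product
   norm and the product Borel structure.  The coordinates x_1, ..., x_4 have
   the indices i1, ..., i4. *)
Notation R4 R := (R * R * R * R)%type (only parsing).

Definition i1 : 'I_4 := @Ordinal 4 0 isT.
Definition i2 : 'I_4 := @Ordinal 4 1 isT.
Definition i3 : 'I_4 := @Ordinal 4 2 isT.
Definition i4 : 'I_4 := @Ordinal 4 3 isT.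

Section calculus.
Context (R : realType).

Definition coord (mu : 'I_4) (x : R4 R) : R :=
  tnth [tuple x.1.1.1; x.1.1.2; x.1.2; x.2] mu.

Definition basis4 (mu : 'I_4) : R4 R :=
  ((mu == i1)%:R, (mu == i2)%:R, (mu == i3)%:R, (mu == i4)%:R).

Definition leb4 : {measure set (R4 (measurableTypeR R)) -> \bar R} :=
  (@lebesgue_measure R \x @lebesgue_measure R \x @lebesgue_measure R
    \x @lebesgue_measure R)%E.

Fixpoint Ck_on (k : nat) (W : set (R4 R)) (f : R4 R -> R) : Prop :=
  (forall x, W x -> {for x, continuous f}) /\
  if k is k'.+1 then
    forall mu, (forall x, W x -> derivable f x (basis4 mu)) /\
               Ck_on k' W ('D_(basis4 mu) f)
  else True.

(* Smoothness on an arbitrary subset of R^4: local extendability to a smooth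
   function on an open set.  On open subsets it is ordinary smoothness. *)
Definition smooth_on (S : set (R4 R)) (f : R4 R -> R) : Prop :=
  forall x, S x -> exists W : set (R4 R), exists F : R4 R -> R,
    [/\ open W, W x, (forall k, Ck_on k W F) &
        forall y, W y -> S y -> F y = f y].

Definition smooth_mx_on m p (S : set (R4 R)) (f : R4 R -> 'M[R[i]]_(m, p)) :=
  forall a b, smooth_on S (fun x => complex.Re (f x a b)) /\
              smooth_on S (fun x => complex.Im (f x a b)).

Definition pd_mx m p (mu : 'I_4) (f : R4 R -> 'M[R[i]]_(m, p)) (x : R4 R) :
    'M[R[i]]_(m, p) :=
  \matrix_(a, b) ('D_(basis4 mu) (fun y => complex.Re (f y a b)) x
                  +i* 'D_(basis4 mu) (fun y => complex.Im (f y a b)) x).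

(* rho is a local defining function of B: near p the boundary is its regular
   zero set and B lies on one side of it. *)
Definition smooth_boundary (B : set (R4 R)) : Prop :=
  forall p, (closure B `\` B) p ->
  exists W : set (R4 R), exists rho : R4 R -> R,
    [/\ open W, W p, (forall k, Ck_on k W rho),
        (exists mu, 'D_(basis4 mu) rho p != 0) &
        forall x, W x -> (B x <-> rho x < 0)].

Definition smooth_bounded_domain (B : set (R4 R)) : Prop :=
  [/\ open B, B !=set0, connected B, bounded_set B & smooth_boundary B].

End calculus.

Definition levi_civita (mu nu rho sigma : 'I_4) : int :=
  let a := tnth [tuple mu; nu; rho; sigma] in
  \prod_(i < 4) \prod_(j < 4 | (i < j)%N) Num.sg ((a j)%:Z - (a i)%:Z).

Definition hodge (V : zmodType) (F : 'I_4 -> 'I_4 -> V) (mu nu : 'I_4) : V :=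
  \sum_(rho < 4) \sum_(sigma < 4 | (rho < sigma)%N)
    F rho sigma *~ levi_civita mu nu rho sigma.

Definition asd (V : zmodType) (F : 'I_4 -> 'I_4 -> V) : Prop :=
  forall mu nu, hodge F mu nu = - F mu nu.

Definition adjmx (R : realType) m p (M : 'M[R[i]]_(m, p)) : 'M[R[i]]_(p, m) :=
  (map_mx (@conjc R) M)^T.

(* S_+ = S_- = C^2 as trivial bundles; [clp mu] and [clm mu] are the two
   off-diagonal blocks S_+ -> S_- and S_- -> S_+ of c_mu. *)
Record spinors (R : realType) := Spinors {
  clp : 'I_4 -> 'M[R[i]]_2;
  clm : 'I_4 -> 'M[R[i]]_2;
  cl_adj : forall mu, adjmx (clp mu) = - clm mu;
  cl_plus : forall mu nu,
    clm mu *m clp nu + clm nu *m clp mu = (- (mu == nu)%:R *+ 2)%:M;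
  cl_minus : forall mu nu,
    clp mu *m clm nu + clp nu *m clm mu = (- (mu == nu)%:R *+ 2)%:M;
  cl_asd : forall w : 'I_4 -> 'I_4 -> R,
    (forall mu nu, w nu mu = - w mu nu) -> asd w ->
    \sum_(mu < 4) \sum_(nu < 4 | (mu < nu)%N)
      (w mu nu)%:C *: (clm mu *m clp nu) = 0
}.

(* A bundle is given by unitary transition functions for a finite open cover
   of the closure of B (which is compact when B is bounded). *)
Record hermitian_bundle (R : realType) (B : set (R4 R)) (n : nat) :=
  HermitianBundle {
  chart : finType;
  dom : chart -> set (R4 R);
  trans : chart -> chart -> R4 R -> 'M[R[i]]_n;
  dom_open : forall i, open (dom i);
  dom_cover : forall x, closure B x -> exists i, dom i x;
  trans_smooth : forall i j,
    smooth_mx_on (closure B `&` dom i `&` dom j) (trans i j);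
  trans_unitary : forall i j x, closure B x -> dom i x -> dom j x ->
    trans i j x *m adjmx (trans i j x) = 1%:M;
  trans_cocycle : forall i j k x,
    closure B x -> dom i x -> dom j x -> dom k x ->
    trans i j x *m trans j k x = trans i k x
}.

Section bundles.
Context (R : realType) (B : set (R4 R)) (n : nat) (E : hermitian_bundle B n).

(* Sections of E (x) S_+ or E (x) S_-: in each chart, a function with values in
   C^n (x) C^2 = n x 2 matrices.  Elements of
   L^2 are such families identified modulo [aeq]. *)
Definition sec : Type := chart E -> R4 R -> 'M[R[i]]_(n, 2).

Definition compatible (s : sec) : Prop :=
  forall i j x, B x -> dom i x -> dom j x -> s i x = trans i j x *m s j x.

Definition potential : Type := chart E -> 'I_4 -> R4 R -> 'M[R[i]]_n.

(* The last clause is A_i = g A_j g^-1 - dg g^-1 with g = [trans i j]. *)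
Definition is_connection (A : potential) : Prop :=
  [/\ forall i mu, smooth_mx_on (closure B `&` dom i) (A i mu),
      forall i mu x, closure B x -> dom i x -> adjmx (A i mu x) = - A i mu x &
      forall i j mu x, B x -> dom i x -> dom j x ->
        A i mu x *m trans i j x =
        trans i j x *m A j mu x - pd_mx mu (trans i j) x].

Definition curvature (A : potential) (i : chart E) (mu nu : 'I_4) (x : R4 R) :
    'M[R[i]]_n :=
  pd_mx mu (A i nu) x - pd_mx nu (A i mu) x
  + A i mu x *m A i nu x - A i nu x *m A i mu x.

Definition asd_connection (A : potential) : Prop :=
  forall i x, B x -> dom i x -> asd (fun mu nu => curvature A i mu nu x).

Definition covd (A : potential) (mu : 'I_4) (s : sec) : sec :=
  fun i x => pd_mx mu (s i) x + A i mu x *m s i x.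

Definition dirac (c : 'I_4 -> 'M[R[i]]_2) (A : potential) (s : sec) : sec :=
  fun i x => \sum_(mu < 4) covd A mu s i x *m (c mu)^T.

Definition twist (A : potential) (z : R4 R) : potential :=
  fun i mu x => A i mu x + (0 +i* (2 * pi * coord mu z))%:M.

(* The fibrewise Hermitian product at x, computed in any chart around x. *)
Definition hprod (s t : sec) (x : R4 R) : R[i] :=
  if [pick i | `[< dom (h := E) i x >]] is Some i then
    \sum_(a < n) \sum_(b < 2) s i x a b * (t i x a b)^*
  else 0.

Definition L2normsq (s : sec) : \bar R :=
  (\int[@leb4 R]_(x in B) (complex.Re (hprod s s x))%:E)%E.

Definition L2 (s : sec) : Prop :=
  [/\ compatible s,
      forall i a b,
        measurable_fun (B `&` dom i : set (R4 (measurableTypeR R)))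
          (fun x => complex.Re (s i x a b)) /\
        measurable_fun (B `&` dom i : set (R4 (measurableTypeR R)))
          (fun x => complex.Im (s i x a b)) &
      (L2normsq s < +oo)%E].

Definition L2prod (s t : sec) : R[i] :=
  (\int[@leb4 R]_(x in B) (complex.Re (hprod s t x)))%R
  +i* (\int[@leb4 R]_(x in B) (complex.Im (hprod s t x)))%R.

Definition aeq (s t : sec) : Prop :=
  forall i, {ae @leb4 R, forall x, B x -> dom i x -> s i x = t i x}.

Definition test_section (phi : sec) : Prop :=
  [/\ compatible phi,
      forall i, smooth_mx_on (B `&` dom i) (phi i) &
      exists K : set (R4 R), [/\ compact K, K `<=` B &
        forall i x, B x -> dom i x -> ~ K x -> phi i x = 0]].

(* Square-integrable solutions of D_A^- s = 0 in the sense of distributions: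
   c_mu and nabla_mu are anti-self-adjoint, so the formal adjoint of
   D_A^- : E (x) S_- -> E (x) S_+ is D_A^+. *)
Definition ker_dirac (S : spinors R) (A : potential) : set sec :=
  [set s | L2 s /\
    forall phi, test_section phi -> L2prod s (dirac (clp S) A phi) = 0].

(* When H is closed in L^2 the set below is a nonempty class modulo [aeq], so
   the choice of a representative is immaterial. *)
Definition proj (H : set sec) (s : sec) : sec :=
  xget 0 [set p | H p /\ forall h, H h -> L2prod (s - p) h = 0].

Definition mulx (mu : 'I_4) (s : sec) : sec :=
  fun i x => (coord mu x)%:C *: s i x.

Definition xhat (S : spinors R) (A : potential) (mu : 'I_4) (s : sec) : sec :=
  proj (ker_dirac S A) (mulx mu s).

(* The limit is taken in the norm of L^2; [L2normsq] is the squared norm, kept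
   extended-real valued so that an infinite norm is never read as 0. *)
Definition is_L2pd (mu : 'I_4) (f : R4 R -> sec) (z : R4 R) (g : sec) : Prop :=
  L2 g /\
  (fun t : R => L2normsq
     (fun i x => (t^-1)%:C *: (f (z + t *: basis4 R mu) i x - f z i x) - g i x))
    @ 0^' --> 0%E.

Definition L2pd (mu : 'I_4) (f : R4 R -> sec) (z : R4 R) : sec :=
  xget 0 [set g | is_L2pd mu f z g].

Fixpoint L2Ck (k : nat) (f : R4 R -> sec) : Prop :=
  [/\ forall z, L2 (f z),
      forall z, (fun w => L2normsq (f w - f z)) @ z --> 0%E &
      if k is k'.+1 then
        forall mu, exists g : R4 R -> sec,
          (forall z, is_L2pd mu f z (g z)) /\ L2Ck k' g
      else True].

Definition nahm_fibre (S : spinors R) (A : potential) (z : R4 R) : set sec :=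
  ker_dirac S (twist A z).

Definition nahm_section (S : spinors R) (A : potential) (f : R4 R -> sec) :=
  (forall z, nahm_fibre S A z (f z)) /\ (forall k, L2Ck k f).

Definition nahm_covd (S : spinors R) (A : potential) (mu : 'I_4)
    (f : R4 R -> sec) : R4 R -> sec :=
  fun z => proj (nahm_fibre S A z) (L2pd mu f z).

(* The coordinate fields commute, so the curvature acts on sections by
   [nabla_mu, nabla_nu]. *)
Definition nahm_curvature (S : spinors R) (A : potential) (f : R4 R -> sec)
    (z : R4 R) (mu nu : 'I_4) : sec :=
  nahm_covd S A mu (nahm_covd S A nu f) z
  - nahm_covd S A nu (nahm_covd S A mu f) z.

Definition nahm_asd (S : spinors R) (A : potential) : Prop :=
  forall f, nahm_section S A f -> forall z mu nu,
    aeq (hodge (nahm_curvature S A f z) mu nu) (- nahm_curvature S A f z mu nu).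

End bundles.

Definition opcomm (V : zmodType) (P Q : V -> V) (s : V) : V := P (Q s) - Q (P s).

(* Main.v *)
Require Import Defs.
From HB Require Import structures.
From mathcomp Require Import all_boot all_order all_algebra.
From mathcomp Require Import all_classical all_reals all_analysis.
From mathcomp Require Import complex.
From mathcomp Require Import measurable_realfun.
From mathcomp Require Import ring lra.
Set Implicit Arguments.
Unset Strict Implicit.
Unset Printing Implicit Defensive.
Import Order.TTheory GRing.Theory Num.Theory.
Import numFieldNormedType.Exports.
Local Open Scope classical_set_scope.
Local Open Scope complex_scope.
Local Open Scope ring_scope.

(* Multiplication by [phase z x = exp (-2 pi i z . x)] is unitary on L^2 and intertwines
   the Dirac operators of [A] and [twist A z], hence maps H = ker D_A^- onto the fibre
   of the Nahm bundle at z and conjugates P_0 into P_z.  In this trivialization by the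
   constant Hilbert space H the connection is d + sum_nu c xhat_nu dz_nu with
   c = -2 pi i, because differentiating the phase along z_nu brings down the factor
   c x_nu; its curvature is therefore c^2 [xhat_mu, xhat_nu], and anti-self-duality is
   read off on the six pairs mu < nu.  Conversely every s in H is the value at 0 of the
   smooth section z |-> phase z . s.  The projections exist because L^2 is complete
   (Riesz-Fischer) and H, being cut out by pairings with L^2 sections, is closed. *)

(** * Semi-Hilbert spaces *)

(** Sections are honest families of functions, not classes modulo null sets, and both [proj] and
    [L2pd] choose arbitrary representatives. The compressed operators are therefore linear only up
    to null sections, so the proof works with a seminorm and with the relation [eqv] (distance zero
    between L^2 sections) in place of equality. Curvature is given as a commutator of covariant
    derivatives on smooth sections, not as a form with known coefficients. To reach the commutator
    of connection forms, the mixed second derivatives of a section must cancel, which calls for a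
    Schwarz theorem for L^2-valued maps; it is reduced by pairing to the scalar theorem. Boundedness
    of the domain turns the coordinates into bounded multipliers. It makes the phase differentiable
    in operator norm and so keeps constant vectors of the trivialization smooth. Only the real part
    of the Hermitian product is carried along: stability under multiplication by [i] restores the
    complex statements. *)

Section semi_hilbert.
Context (R : realType) (V : lmodType R[i]).

(** Models the real part of a Hermitian product on a complex module, hence linearity over the reals
    only. The laws are confined to [L] because an integral that diverges takes a default value, and
    definiteness is absent because null sections are not identified with 0. *)
Record semi_inner (L : set V) (r : V -> V -> R) : Prop := SemiInner {
  si_mem0 : L 0;
  si_memP : forall a u v, L u -> L v -> L (a *: u + v);
  si_sym : forall u v, L u -> L v -> r u v = r v u;
  si_lin : forall (a : R) u v w, L u -> L v -> L w ->
    r (a%:C *: u + v) w = a * r u w + r v w;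
  si_ge0 : forall u, L u -> 0 <= r u u
}.

Definition snorm (r : V -> V -> R) (u : V) : R := Num.sqrt (r u u).

Definition submodule (H : set V) : Prop :=
  H 0 /\ forall a u v, H u -> H v -> H (a *: u + v).

Lemma submoduleZ H a u : submodule H -> H u -> H (a *: u).
Proof. by move=> [H0 HP] Hu; rewrite -[_ *: _]addr0; apply: HP. Qed.

Lemma submoduleD H u v : submodule H -> H u -> H v -> H (u + v).
Proof. by move=> [H0 HP] Hu Hv; rewrite -[u]scale1r; apply: HP. Qed.

Lemma submoduleN H u : submodule H -> H u -> H (- u).
Proof. by move=> sH Hu; rewrite -scaleN1r; exact: submoduleZ. Qed.

Lemma submoduleB H u v : submodule H -> H u -> H v -> H (u - v).
Proof. by move=> sH Hu Hv; apply: submoduleD => //; exact: submoduleN. Qed.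

Section theory.
Context (L : set V) (r : V -> V -> R) (SI : semi_inner L r).
Local Notation N := (snorm r).

Lemma si_submodule : submodule L.
Proof. by split; [exact: si_mem0 SI|exact: si_memP SI]. Qed.
Let LZ a u : L u -> L (a *: u) := submoduleZ a si_submodule.
Let LD u v : L u -> L v -> L (u + v) := submoduleD si_submodule.
Let LB u v : L u -> L v -> L (u - v) := submoduleB si_submodule.
Let LN u : L u -> L (- u) := submoduleN si_submodule.
Let L0 : L 0 := si_mem0 SI.

Lemma si_Dl u v w : L u -> L v -> L w -> r (u + v) w = r u w + r v w.
Proof.
by move=> Lu Lv Lw; have := si_lin SI 1 Lu Lv Lw; rewrite scale1r mul1r.
Qed.

Lemma si_0l w : L w -> r 0 w = 0.
Proof.
move=> Lw; have := si_Dl L0 L0 Lw; rewrite addr0 => e.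
by apply: (addrI (r 0 w)); rewrite -e addr0.
Qed.

Lemma si_Zl a u w : L u -> L w -> r (a%:C *: u) w = a * r u w.
Proof.
move=> Lu Lw; have := si_lin SI a Lu L0 Lw.
by rewrite addr0 si_0l // addr0.
Qed.

Lemma si_Nl u w : L u -> L w -> r (- u) w = - r u w.
Proof.
move=> Lu Lw; have := si_Zl (-1) Lu Lw.
by rewrite rmorphN1 scaleN1r mulN1r.
Qed.

Lemma si_Bl u v w : L u -> L v -> L w -> r (u - v) w = r u w - r v w.
Proof. by move=> Lu Lv Lw; rewrite si_Dl ?si_Nl//; exact: LN. Qed.

Lemma si_Dr u v w : L u -> L v -> L w -> r w (u + v) = r w u + r w v.
Proof.
move=> Lu Lv Lw; rewrite (si_sym SI Lw (LD Lu Lv)) si_Dl//.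
by rewrite (si_sym SI Lu Lw) (si_sym SI Lv Lw).
Qed.

Lemma si_Zr a u w : L u -> L w -> r w (a%:C *: u) = a * r w u.
Proof.
by move=> Lu Lw; rewrite (si_sym SI Lw (LZ _ Lu)) si_Zl// (si_sym SI Lu Lw).
Qed.

Lemma si_Nr u w : L u -> L w -> r w (- u) = - r w u.
Proof. by move=> Lu Lw; rewrite (si_sym SI Lw (LN Lu)) si_Nl// (si_sym SI Lu Lw). Qed.

Lemma si_Br u v w : L u -> L v -> L w -> r w (u - v) = r w u - r w v.
Proof. by move=> Lu Lv Lw; rewrite si_Dr ?si_Nr//; exact: LN. Qed.

Lemma snorm_ge0 u : 0 <= N u. Proof. exact: sqrtr_ge0. Qed.

Lemma snorm_sq u : L u -> N u ^+ 2 = r u u.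
Proof. by move=> Lu; rewrite sqr_sqrtr// (si_ge0 SI). Qed.

Lemma snorm0 : N 0 = 0.
Proof. by rewrite /snorm si_0l// sqrtr0. Qed.

Lemma si_sqZD t u v : L u -> L v ->
  r (t%:C *: u + v) (t%:C *: u + v) = t ^+ 2 * r u u + t * r u v *+ 2 + r v v.
Proof.
move=> Lu Lv; rewrite si_Dl ?si_Dr ?si_Zl ?si_Zr//; try by do ?[exact: LZ|apply: LD].
by rewrite (si_sym SI Lv Lu); ring.
Qed.

Lemma si_CauchySchwarz u v : L u -> L v -> `|r u v| <= N u * N v.
Proof.
move=> Lu Lv.
(* The discriminant criterion for a quadratic in [t]. Since the form is only semidefinite, [a = 0]
   must be treated apart: if also [b] is nonzero, the chosen [t] gives the value -1. Otherwise
   [t = - b / a] is the minimizer. *)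
have K a b c : (forall t : R, 0 <= t ^+ 2 * a + t * b *+ 2 + c) -> 0 <= a ->
    0 <= c -> b ^+ 2 <= a * c.
  move=> H a0 c0; have [a00|an0] := eqVneq a 0.
    rewrite a00 mul0r; have [->|b0] := eqVneq b 0; first by rewrite expr0n.
    have := H (- (c + 1) / (b *+ 2)).
    have -> : (- (c + 1) / (b *+ 2)) ^+ 2 * a + - (c + 1) / (b *+ 2) * b *+ 2 + c = -1.
      by rewrite a00; field.
    by lra.
  have := H (- b / a).
  have -> : (- b / a) ^+ 2 * a + - b / a * b *+ 2 + c = (a * c - b ^+ 2) / a by field.
  by rewrite pmulr_lge0 ?invr_gt0 ?lt_neqAle ?a0 1?eq_sym ?an0// subr_ge0.
have := K (r u u) (r u v) (r v v) _ (si_ge0 SI Lu) (si_ge0 SI Lv).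
rewrite -sqrtr_sqr -sqrtrM ?(si_ge0 SI)// ler_sqrt; last first.
  by rewrite mulr_ge0 ?(si_ge0 SI).
apply=> t; rewrite -si_sqZD//; apply: (si_ge0 SI).
by apply: LD => //; exact: LZ.
Qed.

Lemma snormD u v : L u -> L v -> N (u + v) <= N u + N v.
Proof.
move=> Lu Lv; rewrite -(@ler_pXn2r _ 2)// ?nnegrE ?addr_ge0 ?snorm_ge0//.
rewrite snorm_sq; last exact: LD.
have := si_sqZD 1 Lu Lv; rewrite scale1r => ->.
rewrite sqrrD !snorm_sq//.
have := si_CauchySchwarz Lu Lv; have := ler_norm (r u v); lra.
Qed.

Lemma snormN u : L u -> N (- u) = N u.
Proof. by move=> Lu; rewrite /snorm si_Nl ?si_Nr ?opprK//; exact: LN. Qed.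

Lemma snormB u v : L u -> L v -> N (u - v) <= N u + N v.
Proof. by move=> Lu Lv; rewrite -(snormN Lv); apply: snormD => //; exact: LN. Qed.

Lemma snorm_distC u v : L u -> L v -> N (u - v) = N (v - u).
Proof. by move=> Lu Lv; rewrite -[RHS]snormN ?opprB//; exact: LB. Qed.

Lemma snorm_triangle v u w : L u -> L v -> L w ->
  N (u - w) <= N (u - v) + N (v - w).
Proof.
move=> Lu Lv Lw; have -> : u - w = (u - v) + (v - w) by rewrite addrA subrK.
by apply: snormD; exact: LB.
Qed.

Lemma parallelogram u v : L u -> L v ->
  r (u - v) (u - v) + r (u + v) (u + v) = (r u u + r v v) *+ 2.
Proof.
move=> Lu Lv; rewrite si_Bl ?si_Br ?si_Dl ?si_Dr//; try by [exact: LB|exact: LD].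
by rewrite (si_sym SI Lv Lu); ring.
Qed.

(** Geometric increments are asked for because a minimizing sequence can be chosen that fast, and
    because the Riesz-Fischer argument then needs no passage to a subsequence. *)
Definition rapidly_complete (H : set V) := forall u_ : nat -> V,
  (forall k, H (u_ k)) -> (forall k, N (u_ k.+1 - u_ k) <= 2^-1 ^+ k) ->
  exists p, H p /\ (fun k => N (u_ k - p)) @ \oo --> (0 : R).

Lemma projection_exists H s : H `<=` L -> submodule H -> rapidly_complete H ->
  L s -> exists p, H p /\ forall h, H h -> r (s - p) h = 0.
Proof.
move=> HL sH Hc Ls.
pose D := [set r (s - h) (s - h) | h in H].
have D0 : D !=set0 by exists (r (s - 0) (s - 0)); exists 0 => //; exact: sH.1.
have lD : lbound D 0.
  by move=> _ [h Hh <-]; apply: (si_ge0 SI); apply: LB => //; exact: HL.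
have hiD : has_inf D by split => //; exists 0.
have inf0 : 0 <= inf D by exact: lb_le_inf.
have infD h : H h -> inf D <= r (s - h) (s - h).
  by move=> Hh; apply: (ge_inf hiD.2); exists h.
(* [inf D] is the squared distance from [s] to [H]. With this slack the parallelogram law bounds the
   squared increment by [2 * (1/4 + 1/16) * 4^-k], which is below [(2^-k)^2]. *)
have /choice[u_ uP] : forall k : nat, exists u, H u /\
    r (s - u) (s - u) <= inf D + 4^-1 * 4^-1 ^+ k.
  move=> k; have e0 : 0 < 4^-1 * 4^-1 ^+ k :> R by rewrite mulr_gt0 ?exprn_gt0.
  have [_ [u Hu <-] lt] := inf_adherent e0 hiD.
  by exists u; split => //; exact: ltW.
have Hu k : H (u_ k) := (uP k).1.
have [k|p [Hp up]] := Hc u_ Hu.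
  have L1 : L (s - u_ k) by apply: LB => //; apply: HL.
  have L2 : L (s - u_ k.+1) by apply: LB => //; apply: HL.
  rewrite -(@ler_pXn2r _ 2)// ?nnegrE ?snorm_ge0 ?exprn_ge0//.
  rewrite snorm_sq; last by apply: LB; apply: HL.
  have := parallelogram L1 L2.
  have -> : s - u_ k - (s - u_ k.+1) = u_ k.+1 - u_ k.
    by rewrite opprB addrC addrA subrK.
  pose m := (2^-1 : R)%:C *: (u_ k + u_ k.+1).
  have Hm : H m by apply: (submoduleZ _ sH); exact: submoduleD.
  have -> : s - u_ k + (s - u_ k.+1) = (2 : R)%:C *: (s - m).
    rewrite scalerBr scalerA -rmorphM/= divff// scale1r opprD.
    by rewrite rmorphMn/= rmorph1 scaler_nat mulr2n addrACA.
  have Lsm : L (s - m) by apply: LB => //; exact: HL.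
  rewrite si_Zl ?si_Zr//; last exact: LZ.
  have := infD _ Hm; have := (uP k).2; have := (uP k.+1).2.
  rewrite -exprM mulnC exprM (_ : 2^-1 ^+ 2 = 4^-1 :> R); last by field.
  rewrite exprS; have : 0 <= (4^-1 : R) ^+ k by rewrite exprn_ge0.
  by set q := 4^-1 ^+ k; lra.
have Lp := HL _ Hp.
(* The distance is attained at [p], by passing to the limit in the triangle inequality through
   [u_ k]. *)
have mp : r (s - p) (s - p) <= inf D.
  rewrite -(snorm_sq (LB Ls Lp)).
  have b k : N (s - p) <= Num.sqrt (inf D + 4^-1 * 4^-1 ^+ k) + N (u_ k - p).
    apply: (le_trans (snorm_triangle Ls (HL _ (Hu k)) Lp)).
    rewrite lerD2r /snorm ler_sqrt; first exact: (uP k).2.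
    by rewrite addr_ge0 ?mulr_ge0 ?exprn_ge0.
  have cv : (fun k => Num.sqrt (inf D + 4^-1 * 4^-1 ^+ k) + N (u_ k - p)) @ \oo
      --> (Num.sqrt (inf D + 4^-1 * 0) + 0 : R).
    apply: cvgD => //; apply: (@continuous_cvg _ _ _ _ _ _ Num.sqrt).
      exact: sqrt_continuous.
    apply: cvgD; first exact: cvg_cst.
    apply: cvgMr; apply: cvg_expr.
    by rewrite gtr0_norm// invf_lt1// ltr1n.
  have : N (s - p) <= Num.sqrt (inf D + 4^-1 * 0) + 0.
    rewrite -(cvg_lim _ cv)//; apply: limr_ge; first by apply/cvg_ex; eexists; exact: cv.
    by near=> k; exact: b.
  rewrite mulr0 !addr0 -(@ler_pXn2r _ 2)// ?nnegrE ?snorm_ge0 ?sqrtr_ge0//.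
  by rewrite (sqr_sqrtr inf0).
exists p; split=> // h Hh.
have Lh := HL _ Hh; have Lsp := LB Ls Lp.
apply/eqP; apply: contraT => rn0.
have key t : 0 <= t ^+ 2 * r h h + t * r h (s - p) *+ 2.
  have := infD _ (submoduleB sH Hp (submoduleZ t%:C sH Hh)).
  have -> : s - (p - t%:C *: h) = t%:C *: h + (s - p) by rewrite opprB addrCA.
  by rewrite si_sqZD//; lra.
have := si_sym SI Lsp Lh => e; rewrite e in rn0 *.
have hh := si_ge0 SI Lh.
(* First variation at the minimizer. The usual optimal [t] divides by [r h h], which may vanish on a
   nonzero [h]; adding 1 to the denominator avoids this and still makes the quadratic strictly
   negative. *)
have := key (- r h (s - p) / (r h h + 1)).
have -> : (- r h (s - p) / (r h h + 1)) ^+ 2 * r h h +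
   - r h (s - p) / (r h h + 1) * r h (s - p) *+ 2 =
   - (r h (s - p) / (r h h + 1)) ^+ 2 * (r h h + 2).
  by field; lra.
rewrite mulNr oppr_ge0 => /(lt_le_trans _) q.
have : 0 < (r h (s - p) / (r h h + 1)) ^+ 2 * (r h h + 2).
  apply: mulr_gt0; last by lra.
  by rewrite exprn_even_gt0//= mulf_neq0// invr_eq0; lra.
by move=> /q; rewrite ltxx.
Unshelve. all: by end_near.
Qed.

End theory.
End semi_hilbert.

(** * Lebesgue measure on R^4 *)

Section measure_R4.
Context (R : realType).
Local Notation mR4 := (R4 (measurableTypeR R)).

Let box (i : rat * rat * rat * rat * nat) : set (R4 R) :=
  ball (ratr i.1.1.1.1 : R, ratr i.1.1.1.2 : R, ratr i.1.1.2 : R, ratr i.1.2 : R)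
    (i.2.+1%:R^-1 : R).

Lemma ball4E (x : R4 R) (e : R) : ball x e =
  ((ball x.1.1.1 e `*` ball x.1.1.2 e) `*` ball x.1.2 e) `*` ball x.2 e.
Proof. by []. Qed.

Lemma measurable_ball4 (x : R4 R) (e : R) : measurable (ball x e : set mR4).
Proof.
have mb (y r : R) : measurable (ball y r : set (measurableTypeR R)).
  exact: measurable_ball.
by rewrite ball4E; do 3!apply: measurableX => //.
Qed.

(** The measurable structure is the product one, so an open set has to be written as a countable
    union of products of intervals: the balls of the sup norm with rational centres and radii
    [1 / (k + 1)]. *)
Lemma open_measurable4 (A : set (R4 R)) : open A -> measurable (A : set mR4).
Proof.
move=> oA.
have -> : A = \bigcup_i (if `[< box i `<=` A >] then box i else set0).
  apply/seteqP; split => [x Ax|x [i _]]; last first.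
    by case: ifPn => // /asboolP; apply.
  have /nbhs_ballP[r /= r0 rA] := open_nbhs_nbhs (conj oA Ax).
  (* Two points of one box are within twice its radius, so a box of radius below [r / 2] that
     contains [x] stays inside [ball x r]. *)
  have [k] : exists k : nat, 0 + k.+1%:R^-1 < r / 2.
    by apply: ltr_add_invr; lra.
  rewrite add0r => kr; have k0 : 0 < k.+1%:R^-1 :> R by rewrite invr_gt0.
  have q' (y e : R) : 0 < e -> exists q : rat, ball (ratr q : R) e y.
    move=> e0; have lt : y - e < y + e by lra.
    have [q] := rat_in_itvoo lt.
    rewrite in_itv/= => /andP[q1 q2]; exists q.
    by rewrite /ball/= ltr_distl; apply/andP; split; lra.
  have q y := q' y _ k0.
  have [[q1 h1] [q2 h2]] := (q x.1.1.1, q x.1.1.2).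
  have [[q3 h3] [q4 h4]] := (q x.1.2, q x.2).
  have xb : box (q1, q2, q3, q4, k) x by rewrite /box ball4E.
  exists (q1, q2, q3, q4, k) => //; case: ifPn => // /asboolPn[] y yb.
  apply: rA; apply: (@le_ball _ _ _ (k.+1%:R^-1 + k.+1%:R^-1)); first by move: kr; set e := _^-1; lra.
  by apply: (ball_triangle (ball_sym xb)).
apply: countable_bigcupT_measurable; first exact: countableP.
by move=> i; case: ifP => // _; exact: measurable_ball4.
Qed.

Lemma leb4_bounded (A : set (R4 R)) : bounded_set A -> measurable (A : set mR4) ->
  (@leb4 R A < +oo)%E.
Proof.
move=> [M [_ bM]] mA.
(* [bounded_set] bounds the norm by any number above [M]; [|M| + 1] is used, and one more unit puts
   the set inside an open ball. *)
pose e := `|M| + 2.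
apply: (@le_lt_trans _ _ (@leb4 R (ball (0 : R4 R) e))).
  apply: le_measure; rewrite ?inE//; first exact: measurable_ball4.
  move=> x /(bM (`|M| + 1) _) xM.
  rewrite -ball_normE/ball_/= sub0r normrN (le_lt_trans (xM _))// ?/e; last by lra.
  by rewrite (le_lt_trans (ler_norm M))// ltrDl.
rewrite ball4E /leb4.
have mb (y r : R) : measurable (ball y r : set (measurableTypeR R)).
  exact: measurable_ball.
have e0 : 0 <= e by rewrite /e; have := normr_ge0 M; lra.
rewrite [ltLHS]product_measure1E//; last by do 2!apply: measurableX => //.
rewrite [X in (X * _)%E]product_measure1E//; last by apply: measurableX => //.
rewrite [X in (X * _ * _)%E]product_measure1E//.
rewrite [X in (X * _ * _ * _)%E](lebesgue_measure_ball _ e0).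
rewrite [X in (_ * X * _ * _)%E](lebesgue_measure_ball _ e0).
rewrite [X in (_ * X * _)%E](lebesgue_measure_ball _ e0).
rewrite [X in (_ * X)%E](lebesgue_measure_ball _ e0).
by rewrite -!EFinM ltry.
Qed.

Lemma continuous_measurable4 (A : set (R4 R)) (f : R4 R -> R) : open A ->
  (forall x, A x -> {for x, continuous f}) ->
  measurable_fun (A : set mR4) f.
Proof.
move=> oA cf; apply: (measurability _ (RGenOpens.measurableE R)).
move=> _ [_ [a [b ->] <-]]; apply: open_measurable4.
rewrite openE => x [Ax fx]; apply: filterI; first exact: open_nbhs_nbhs.
apply: (cf x Ax); apply: open_nbhs_nbhs; split => //.
Qed.

End measure_R4.

(** * Frobenius products and the trivialization by a choice of charts *)

Section frobenius.
Context (R : realType) (m p : nat).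
Implicit Types M N K : 'M[R[i]]_(m, p).

Definition frob M N : R[i] := \sum_(a < m) \sum_(b < p) M a b * (N a b)^*.

Definition fre M N : R := \sum_(a < m) \sum_(b < p)
  (complex.Re (M a b) * complex.Re (N a b) + complex.Im (M a b) * complex.Im (N a b)).

Lemma Re_frob M N : complex.Re (frob M N) = fre M N.
Proof.
rewrite /frob raddf_sum/=; apply: eq_bigr => a _; rewrite raddf_sum/=.
apply: eq_bigr => b _.
by case: (M a b) (N a b) => [x y] [u v] /=; rewrite mulrN opprK.
Qed.

(** The product is conjugate-linear on the right, so an [i] there comes out as [-i], and the real
    part of [-i w] is the imaginary part of [w]. Every Hermitian statement thus becomes a statement
    about [fre]. *)
Lemma Im_frob M N : complex.Im (frob M N) = fre M ((0 +i* 1) *: N).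
Proof.
rewrite /frob raddf_sum/=; apply: eq_bigr => a _; rewrite raddf_sum/=.
apply: eq_bigr => b _; rewrite mxE.
by case: (M a b) (N a b) => [x y] [u v] /=; ring.
Qed.

Definition normc2 (c : R[i]) : R := complex.Re c ^+ 2 + complex.Im c ^+ 2.

Lemma normc2_ge0 c : 0 <= normc2 c.
Proof. by rewrite addr_ge0 ?sqr_ge0. Qed.

Lemma freC M N : fre M N = fre N M.
Proof. by apply: eq_bigr => a _; apply: eq_bigr => b _; rewrite [in LHS]mulrC (mulrC (complex.Im (M a b))). Qed.

Lemma fre_lin (c : R) M N K : fre (c%:C *: M + N) K = c * fre M K + fre N K.
Proof.
rewrite /fre mulr_sumr -big_split/=; apply: eq_bigr => a _.
rewrite mulr_sumr -big_split/=; apply: eq_bigr => b _; rewrite !mxE.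
by case: (M a b) (N a b) (K a b) => [x y] [u v] [z w] /=; ring.
Qed.

Lemma fre_ge0 M : 0 <= fre M M.
Proof. by do 2!apply: sumr_ge0 => ? _; rewrite -!expr2 addr_ge0 ?sqr_ge0. Qed.

Lemma fre_eq0 M : fre M M = 0 -> M = 0.
Proof.
move=> /eqP; rewrite psumr_eq0 => [/allP h|? _]; last first.
  by apply: sumr_ge0 => ? _; rewrite -!expr2 addr_ge0 ?sqr_ge0.
apply/matrixP => a b; rewrite mxE.
have := h a (mem_index_enum _); rewrite psumr_eq0 => [/allP k|? _]; last first.
  by rewrite -!expr2 addr_ge0 ?sqr_ge0.
have := k b (mem_index_enum _); rewrite /= -!expr2 paddr_eq0 ?sqr_ge0//.
by rewrite !sqrf_eq0; case: (M a b) => x y /= /andP[/eqP -> /eqP ->].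
Qed.

Lemma fre_scale (c : R[i]) M N : fre (c *: M) N = fre M (c^* *: N).
Proof.
apply: eq_bigr => a _; apply: eq_bigr => b _; rewrite !mxE.
by case: c (M a b) (N a b) => [c d] [x y] [u v] /=; ring.
Qed.

Lemma fre_scale2 (c : R[i]) M : fre (c *: M) (c *: M) = normc2 c * fre M M.
Proof.
rewrite /fre mulr_sumr; apply: eq_bigr => a _; rewrite mulr_sumr.
apply: eq_bigr => b _; rewrite !mxE /normc2.
by case: c (M a b) => [c d] [x y] /=; ring.
Qed.

Lemma fre_sqD M N : fre (M + N) (M + N) = fre M M + fre N N + fre M N *+ 2.
Proof.
rewrite -[M in LHS]scale1r; have -> : 1 = (1 : R)%:C by [].
rewrite fre_lin (freC M) (freC N) !fre_lin (freC N M); ring.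
Qed.

Lemma fre0l N : fre 0 N = 0.
Proof.
rewrite /fre big1// => a _; rewrite big1// => b _.
by rewrite !mxE /= !mul0r addr0.
Qed.

Lemma freNl M N : fre (- M) N = - fre M N.
Proof.
have -> : - M = (-1 : R)%:C *: M + 0 by rewrite addr0 rmorphN1 scaleN1r.
by rewrite fre_lin fre0l addr0 mulN1r.
Qed.

Lemma fre_sqB M N : fre (M - N) (M - N) = fre M M + fre N N - fre M N *+ 2.
Proof.
by rewrite fre_sqD (freC M (- N)) !freNl (freC N (- N)) freNl opprK (freC N) mulNrn.
Qed.

Lemma fre_abs_le M N : `|fre M N| <= fre M M + fre N N.
Proof.
have := fre_ge0 (M + N); have := fre_ge0 (M - N); rewrite fre_sqB fre_sqD.
have := fre_ge0 M; have := fre_ge0 N.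
by rewrite ler_norml => *; apply/andP; split; lra.
Qed.

Lemma fre_sqD_le M N : fre (M + N) (M + N) <= 2 * (fre M M + fre N N).
Proof. by have := fre_ge0 (M - N); rewrite fre_sqB fre_sqD; lra. Qed.

Lemma frob_tr M N : frob M N = \tr (M *m adjmx N).
Proof.
rewrite /mxtrace; apply: eq_bigr => a _; rewrite mxE; apply: eq_bigr => b _.
by rewrite !mxE.
Qed.

End frobenius.

Lemma adjmxM (R : realType) m p q (M : 'M[R[i]]_(m, p)) (N : 'M[R[i]]_(p, q)) :
  adjmx (M *m N) = adjmx N *m adjmx M.
Proof. by rewrite /adjmx map_mxM trmx_mul. Qed.

Lemma frob_unitary (R : realType) m p (U : 'M[R[i]]_m) (M N : 'M[R[i]]_(m, p)) :
  U *m adjmx U = 1%:M -> frob (U *m M) (U *m N) = frob M N.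
Proof.
move=> /mulmx1C uU; rewrite !frob_tr adjmxM mxtrace_mulC mulmxA.
by rewrite -(mulmxA (adjmx N)) uU mulmx1 mxtrace_mulC.
Qed.

Section trivialization.
Context (R : realType) (B : set (R4 R)) (n : nat) (E : hermitian_bundle B n).
Local Notation mR4 := (R4 (measurableTypeR R)).

Definition pick_chart (x : R4 R) : option (chart E) :=
  [pick i | `[< dom (h := E) i x >]].

Lemma pick_chart_dom x i : pick_chart x = Some i -> dom i x.
Proof. by rewrite /pick_chart; case: pickP => // j /asboolP dj [<-]. Qed.

Lemma pick_chart_ex x : B x -> exists i, pick_chart x = Some i.
Proof.
move=> /(@subset_closure _ B)/(dom_cover E)[i di]; rewrite /pick_chart.
by case: pickP => [j _|/(_ i)/asboolP//]; exists j.
Qed.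

(** Follows the choice of chart built into [hprod], so that fibre products become Frobenius products
    of single matrix-valued functions. Such a function may jump where the chosen chart changes, but
    it stays measurable. *)
Definition rep (s : sec E) (x : R4 R) : 'M[R[i]]_(n, 2) :=
  if pick_chart x is Some i then s i x else 0.

Lemma repE (s : sec E) x i : pick_chart x = Some i -> rep s x = s i x.
Proof. by rewrite /rep => ->. Qed.

Lemma hprodE (s t : sec E) x : hprod s t x = frob (rep s x) (rep t x).
Proof.
rewrite /hprod /rep /pick_chart; case: pickP => // _; rewrite /frob.
by do 2!rewrite big1// => ? _; rewrite !mxE mul0r.
Qed.

Lemma repP (c : R[i]) (s t : sec E) x : rep (c *: s + t) x = c *: rep s x + rep t x.
Proof. by rewrite /rep; case: pick_chart => //; rewrite scaler0 addr0. Qed.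

Lemma repZ (c : R[i]) (s : sec E) x : rep (c *: s) x = c *: rep s x.
Proof. by rewrite /rep; case: pick_chart => //; rewrite scaler0. Qed.

Lemma repD (s t : sec E) x : rep (s + t) x = rep s x + rep t x.
Proof. by rewrite /rep; case: pick_chart => //; rewrite addr0. Qed.

Lemma repB (s t : sec E) x : rep (s - t) x = rep s x - rep t x.
Proof. by rewrite /rep; case: pick_chart => //; rewrite subr0. Qed.

Lemma rep0 x : rep (0 : sec E) x = 0.
Proof. by rewrite /rep; case: pick_chart. Qed.

Lemma hprod_chart (s t : sec E) i x : compatible s -> compatible t -> B x -> dom i x ->
  hprod s t x = frob (s i x) (t i x).
Proof.
move=> cs ct Bx dx; have [j xj] := pick_chart_ex Bx; have dj := pick_chart_dom xj.
rewrite hprodE !(repE _ xj) (cs j i)// (ct j i)// frob_unitary//.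
by apply: trans_unitary => //; exact: subset_closure.
Qed.

Lemma measurable_dom (i : chart E) : measurable (dom i : set mR4).
Proof. by apply: open_measurable4; exact: dom_open. Qed.

(** The chosen chart depends only on which of the finitely many open sets [dom j] contain the point.
    The set is thus a finite union of atoms [D q] of the Boolean algebra they generate. *)
Lemma measurable_pick (i : chart E) :
  measurable ([set x | pick_chart x = Some i] : set mR4).
Proof.
pose D (q : {ffun chart E -> bool}) : set mR4 :=
  \bigcap_j (if q j then dom j else ~` dom j).
have -> : [set x | pick_chart x = Some i] =
    \bigcup_(q : {ffun chart E -> bool})
      (if [pick j | q j] == Some i then D q else set0).
  apply/seteqP; split=> [x /= xi|x [q _]].
    exists [ffun j => `[< dom j x >]] => //.
    rewrite ifT; last first.
      by apply/eqP; rewrite -xi; apply: eq_pick => j; rewrite ffunE.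
    by move=> j _; rewrite ffunE; case: asboolP.
  case: ifP => // /eqP qi Dq /=; rewrite -qi; apply: eq_pick => j.
  have := Dq j Logic.I; case: (q j) => [dj|ndj]; first exact/asboolP.
  exact/asboolPn.
apply: countable_bigcupT_measurable; first exact: countableP.
move=> q; case: ifP => // _; rewrite /D.
apply: fin_bigcap_measurable; first exact: finite_finset.
by move=> j _; case: (q j); [|apply: measurableC]; exact: measurable_dom.
Qed.

Lemma measurable_fun_charts d (T : measurableType d) (g : chart E -> R4 R -> T)
    (c : T) : measurable (B : set mR4) ->
  (forall i, measurable_fun (B `&` dom i : set mR4) (g i)) ->
  measurable_fun (B : set mR4)
    (fun x => if pick_chart x is Some i then g i x else c).
Proof.
move=> mB mg _ Y mY.
set f := (fun x => _).
have -> : B `&` f @^-1` Y = \bigcup_i ([set x | pick_chart x = Some i] `&`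
    ((B `&` dom i) `&` (g i @^-1` Y))).
  apply/seteqP; split=> [x [Bx]|x [i _ [/= xi [[Bx dx] Yx]]]]; last first.
    by split; rewrite //= /f xi.
  have [i xi] := pick_chart_ex Bx; rewrite /f /= xi => Yx.
  by exists i => //; do !split => //; exact: pick_chart_dom.
apply: countable_bigcupT_measurable; first exact: countableP.
move=> i; apply: measurableI; first exact: measurable_pick.
by apply: mg => //; apply: measurableI => //; exact: measurable_dom.
Qed.

End trivialization.

(** * The L^2 space of sections *)

Section L2_sections.
Context (R : realType) (B : set (R4 R)) (n : nat) (E : hermitian_bundle B n).
Context (oB : open B).
Local Notation mR4 := (R4 (measurableTypeR R)).
Local Notation mu := (@leb4 R).
Implicit Types s t : sec E.

Let mB : measurable (B : set mR4) := open_measurable4 oB.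

Definition measurable_sec s : Prop := forall i a b,
  measurable_fun (B `&` dom i : set mR4) (fun x => complex.Re (s i x a b)) /\
  measurable_fun (B `&` dom i : set mR4) (fun x => complex.Im (s i x a b)).

Definition density s t (x : R4 R) : R := fre (rep s x) (rep t x).

Definition rip s t : R := \int[mu]_(x in B) density s t x.

Lemma measurable_rep s a b : measurable_sec s ->
  measurable_fun (B : set mR4) (fun x => complex.Re (rep s x a b)) /\
  measurable_fun (B : set mR4) (fun x => complex.Im (rep s x a b)).
Proof.
move=> ms; split.
- apply: (eq_measurable_fun (fun x => if pick_chart E x is Some i
    then complex.Re (s i x a b) else 0)) => [x _|].
    by rewrite /rep; case: pick_chart => //; rewrite mxE.
  by apply: (measurable_fun_charts _ mB) => i; have [] := ms i a b.
- apply: (eq_measurable_fun (fun x => if pick_chart E x is Some i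
    then complex.Im (s i x a b) else 0)) => [x _|].
    by rewrite /rep; case: pick_chart => //; rewrite mxE.
  by apply: (measurable_fun_charts _ mB) => i; have [] := ms i a b.
Qed.

Lemma measurable_density s t : measurable_sec s -> measurable_sec t ->
  measurable_fun (B : set mR4) (density s t).
Proof.
move=> ms mt; rewrite /density /fre.
apply: measurable_sum => a; apply: measurable_sum => b.
have [s1 s2] := measurable_rep a b ms; have [t1 t2] := measurable_rep a b mt.
by apply: measurable_funD; apply: measurable_funM.
Qed.

Lemma density_ge0 s x : 0 <= density s s x. Proof. exact: fre_ge0. Qed.

Lemma densityC s t x : density s t x = density t s x. Proof. exact: freC. Qed.

Lemma density_lin (c : R) s t u x :
  density (c%:C *: s + t) u x = c * density s u x + density t u x.
Proof. by rewrite /density repP fre_lin. Qed.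

Lemma density_scale (c : R[i]) s x : density (c *: s) (c *: s) x = normc2 c * density s s x.
Proof. by rewrite /density repZ fre_scale2. Qed.

Lemma density_sqD_le s t x :
  density (s + t) (s + t) x <= 2 * (density s s x + density t t x).
Proof. by rewrite /density repD; exact: fre_sqD_le. Qed.

Lemma L2normsqE s : L2normsq s = (\int[mu]_(x in B) (density s s x)%:E)%E.
Proof. by rewrite /L2normsq; apply: eq_integral => x _; rewrite hprodE Re_frob. Qed.

Lemma L2prodE s t : L2prod s t = rip s t +i* rip s ((0 +i* 1) *: t).
Proof.
rewrite /L2prod /rip; congr (_ +i* _); apply: eq_Rintegral => x _.
  by rewrite hprodE Re_frob.
by rewrite hprodE Im_frob /density repZ.
Qed.

Lemma L2_integrable s : L2 s -> mu.-integrable B (EFin \o density s s).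
Proof.
move=> [_ ms fs]; apply/integrableP; split.
  by apply/measurable_EFinP; exact: measurable_density.
apply: le_lt_trans fs; rewrite L2normsqE le_eqVlt; apply/orP; left; apply/eqP.
by apply: eq_integral => x _ /=; rewrite ger0_norm// density_ge0.
Qed.

Lemma L2_dominated s (g : R4 R -> R) : compatible s -> measurable_sec s ->
  mu.-integrable B (EFin \o g) -> (forall x, B x -> density s s x <= g x) -> L2 s.
Proof.
move=> cs ms /integrableP[mg ig] sg; split => //; rewrite L2normsqE.
apply: le_lt_trans ig; apply: ge0_le_integral => //.
- by move=> x _; rewrite lee_fin density_ge0.
- by apply/measurable_EFinP; exact: measurable_density.
- exact: measurableT_comp.
- by move=> x Bx /=; rewrite lee_fin (le_trans (sg x Bx))// ler_norm.
Qed.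

Lemma L2normsq_rip s : L2 s -> L2normsq s = (rip s s)%:E.
Proof.
move=> Ls; rewrite /rip /Rintegral fineK ?L2normsqE//.
by case: Ls => _ _; rewrite L2normsqE ge0_fin_numE// integral_ge0// => x _; rewrite lee_fin density_ge0.
Qed.

Lemma density_integrable s t : L2 s -> L2 t ->
  mu.-integrable B (EFin \o density s t).
Proof.
move=> Ls Lt; apply: (le_integrable mB _ _
   (integrableD mB (L2_integrable Ls) (L2_integrable Lt))).
  apply/measurable_EFinP; apply: measurable_density.
    by case: Ls.
  by case: Lt.
move=> x _ /=; rewrite lee_fin [leRHS]ger0_norm ?addr_ge0 ?density_ge0//.
exact: fre_abs_le.
Qed.

Lemma measurable_secP (c : R[i]) s t : measurable_sec s -> measurable_sec t ->
  measurable_sec (c *: s + t).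
Proof.
move=> ms mt i a b; have [s1 s2] := ms i a b; have [t1 t2] := mt i a b.
split.
- have : measurable_fun (B `&` dom i : set mR4) (fun x => complex.Re c * complex.Re (s i x a b) -
    complex.Im c * complex.Im (s i x a b) + complex.Re (t i x a b)).
    by apply: measurable_funD => //; apply: measurable_funB; apply: measurable_funM.
  apply: eq_measurable_fun => x _; rewrite !mxE.
  by case: c (s i x a b) (t i x a b) => [? ?] [? ?] [? ?].
- have : measurable_fun (B `&` dom i : set mR4) (fun x => complex.Re c * complex.Im (s i x a b) +
    complex.Im c * complex.Re (s i x a b) + complex.Im (t i x a b)).
    by apply: measurable_funD => //; apply: measurable_funD; apply: measurable_funM.
  apply: eq_measurable_fun => x _; rewrite !mxE.
  by case: c (s i x a b) (t i x a b) => [? ?] [? ?] [? ?].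
Qed.

Lemma L2_0 : L2 (0 : sec E).
Proof.
have c0 : compatible (0 : sec E) by move=> i j x _ _ _; rewrite [RHS]mulmx0.
have m0 : measurable_sec (0 : sec E).
  by move=> i a b; split; apply: (eq_measurable_fun (fun=> 0 : R)) => [x _|];
    by [rewrite mxE|exact: measurable_cst].
split=> //; rewrite L2normsqE (eq_integral (cst 0%E)) ?integral0// => x _.
by rewrite /density rep0 fre0l.
Qed.

Lemma L2_P (c : R[i]) s t : L2 s -> L2 t -> L2 (c *: s + t).
Proof.
move=> Ls Lt; have [cs ms fs] := Ls; have [ct mt ft] := Lt.
apply: (@L2_dominated _ (fun x => 2 * (normc2 c * density s s x + density t t x))).
- move=> i j x Bx di dj; rewrite -[LHS]/(c *: s i x + t i x).
  by rewrite -[X in _ *m X]/(c *: s j x + t j x) (cs i j)// (ct i j)// mulmxDr -scalemxAr.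
- exact: measurable_secP.
- apply: (integrableZl mB 2 (integrableD mB (integrableZl mB (normc2 c) (L2_integrable Ls))
    (L2_integrable Lt))).
- by move=> x Bx; rewrite -density_scale; exact: density_sqD_le.
Qed.

Lemma L2_semi_inner : semi_inner (@L2 R B n E : set (sec E)) rip.
Proof.
split.
- exact: L2_0.
- exact: L2_P.
- by move=> s t _ _; apply: eq_Rintegral => x _; exact: densityC.
- move=> c s t u Ls Lt Lu; rewrite /rip -RintegralZl//; last exact: density_integrable.
  rewrite -RintegralD//; last 2 first.
  + exact: (integrableZl mB c (density_integrable Ls Lu)).
  + exact: density_integrable.
  by apply: eq_Rintegral => x _; exact: density_lin.
- by move=> s _; apply: Rintegral_ge0 => x _; exact: density_ge0.
Qed.

Local Notation N := (snorm rip).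

Lemma L2normsqE_snorm s : L2 s -> L2normsq s = (N s ^+ 2)%:E.
Proof. by move=> Ls; rewrite (snorm_sq L2_semi_inner)// L2normsq_rip. Qed.

Lemma L2_sub : submodule (@L2 R B n E : set (sec E)).
Proof. exact: si_submodule L2_semi_inner. Qed.

(** [aeq] speaks of each chart separately, the norm of the chosen chart only. Finiteness of the
    atlas lets one null set serve all charts in one direction; in the other, the transition law
    carries equality from the chosen chart to any chart. *)
Lemma aeqP s t : L2 s -> L2 t -> aeq s t <-> N (s - t) = 0.
Proof.
move=> Ls Lt; have Lst := submoduleB L2_sub Ls Lt.
have mst : measurable_fun (B : set mR4) (EFin \o density (s - t) (s - t)).
  by apply/measurable_EFinP; apply: measurable_density; case: Lst.
have -> : N (s - t) = 0 <-> ae_eq mu B (EFin \o density (s - t) (s - t)) (cst 0%E).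
  rewrite -(ae_eq_integral_abs mu mB mst).
  have -> : (\int[mu]_(x in B) `|(EFin \o density (s - t)%R (s - t)%R) x| = (N (s - t)%R ^+ 2)%:E)%E.
    rewrite -L2normsqE_snorm// L2normsqE; apply: eq_integral => x _ /=.
    by rewrite ger0_norm// density_ge0.
  split=> [->|[]/eqP]; first by rewrite expr0n.
  by rewrite sqrf_eq0 => /eqP.
split=> [st|st].
  have H : {ae mu, forall x, forall i, B x -> dom i x -> s i x = t i x}.
    exact: filter_forall st.
  apply: (@filterS _ _ (ae_filter_ringOfSetsType mu)) H => x st' Bx /=; have [i xi] := pick_chart_ex E Bx.
  congr (_%:E); rewrite /density repB !(repE _ xi) (st' i)//; last exact: pick_chart_dom.
  by rewrite subrr fre0l.
move=> i; apply: (@filterS _ _ (ae_filter_ringOfSetsType mu) _ _ _ (st : {ae mu, forall x, B x -> _})) => x st' Bx di.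
have [j xj] := pick_chart_ex E Bx; have dj := pick_chart_dom xj.
have [[cs _ _] [ct _ _]] := (Ls, Lt).
rewrite (cs i j)// (ct i j)//; congr (_ *m _).
have [/fre_eq0] := st' Bx; rewrite repB !(repE _ xj) => /eqP.
by rewrite subr_eq0 => /eqP.
Qed.

End L2_sections.

(** * Entrywise limits of complex matrices *)

Section sequences_of_matrices.
Context (R : realType).

Lemma ReM (x y : R[i]) : complex.Re (x * y) =
  complex.Re x * complex.Re y - complex.Im x * complex.Im y.
Proof. by case: x y => [? ?] [? ?]. Qed.

Lemma ImM (x y : R[i]) : complex.Im (x * y) =
  complex.Re x * complex.Im y + complex.Im x * complex.Re y.
Proof. by case: x y => [? ?] [? ?]. Qed.

Lemma ReD (x y : R[i]) : complex.Re (x + y) = complex.Re x + complex.Re y.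
Proof. by case: x y => [? ?] [? ?]. Qed.

Lemma ImD (x y : R[i]) : complex.Im (x + y) = complex.Im x + complex.Im y.
Proof. by case: x y => [? ?] [? ?]. Qed.

Lemma cvg_sum_fin (I : Type) (r : seq I) (f : I -> nat -> R) (l : I -> R) :
  (forall i, f i @ \oo --> l i) ->
  (fun k => \sum_(i <- r) f i k) @ \oo --> \sum_(i <- r) l i.
Proof.
move=> fl; elim: r => [|i r IH].
  under eq_fun do rewrite big_nil; rewrite big_nil; exact: cvg_cst.
by under eq_fun do rewrite big_cons; rewrite big_cons; apply: cvgD.
Qed.

Lemma cvg_summable_increments (a_ b_ : nat -> R) (M : R) :
  (forall k, `|a_ k.+1 - a_ k| <= b_ k) -> (forall k, series b_ k <= M) ->
  cvgn a_.
Proof.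
move=> ab bM; have b0 k : 0 <= b_ k by apply: le_trans (ab k).
have cb : cvgn (series b_).
  apply: nondecreasing_is_cvgn; last by exists M => _ [k _ <-].
  by apply/nondecreasing_seqP => k; rewrite seriesSr lerDl.
have ct : cvgn (series (telescope a_)).
  apply: normed_cvg; apply: series_le_cvg cb => // k; exact: normr_ge0.
have -> : a_ = (fun k => a_ 0%N + series (telescope a_) k).
  by apply/funext => k; rewrite -eq_sum_telescope.
by apply: is_cvgD => //; exact: is_cvg_cst.
Qed.

Definition mxcvg m p (M_ : nat -> 'M[R[i]]_(m, p)) (M : 'M[R[i]]_(m, p)) :=
  forall a b, (fun k => complex.Re (M_ k a b)) @ \oo --> complex.Re (M a b) /\
              (fun k => complex.Im (M_ k a b)) @ \oo --> complex.Im (M a b).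

Lemma mxcvg_unique m p (M_ : nat -> 'M[R[i]]_(m, p)) M N :
  mxcvg M_ M -> mxcvg M_ N -> M = N.
Proof.
move=> cM cN; apply/matrixP => a b; have [m1 m2] := cM a b.
have [n1 n2] := cN a b.
have := cvg_unique (@Rhausdorff R) m1 n1; have := cvg_unique (@Rhausdorff R) m2 n2.
by case: (M a b) (N a b) => [x y] [u v] /= -> ->.
Qed.

Lemma mxcvg_mull m p q (T : 'M[R[i]]_(m, p)) (M_ : nat -> 'M[R[i]]_(p, q)) M :
  mxcvg M_ M -> mxcvg (fun k => T *m M_ k) (T *m M).
Proof.
move=> cM a b; split; under eq_fun do rewrite mxE raddf_sum/=;
  rewrite mxE raddf_sum/=; apply: cvg_sum_fin => j; have [c1 c2] := cM j b.
- by under eq_fun do rewrite ReM; rewrite ReM; apply: cvgB; apply: cvgMr.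
- by under eq_fun do rewrite ImM; rewrite ImM; apply: cvgD; apply: cvgMr.
Qed.

Lemma mxcvg_fre m p (K : 'M[R[i]]_(m, p)) M_ M : mxcvg M_ M ->
  (fun k => fre (K - M_ k) (K - M_ k)) @ \oo --> fre (K - M) (K - M).
Proof.
move=> cM; rewrite /fre; apply: cvg_sum_fin => a; apply: cvg_sum_fin => b.
have [c1 c2] := cM a b; under eq_fun do rewrite !mxE !raddfB/=.
rewrite !mxE !raddfB/=; apply: cvgD; apply: cvgM; apply: cvgB => //;
  exact: cvg_cst.
Qed.

Lemma Re_sq_le_fre m p (M : 'M[R[i]]_(m, p)) a b :
  complex.Re (M a b) ^+ 2 <= fre M M.
Proof.
rewrite /fre (bigD1 a)//= (bigD1 b)//= -addrA -addrA -expr2 lerDl addr_ge0//.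
  by rewrite -expr2 sqr_ge0.
by rewrite addr_ge0// ?sumr_ge0// => *; rewrite ?sumr_ge0// => *;
  rewrite addr_ge0// -expr2 sqr_ge0.
Qed.

Lemma Im_sq_le_fre m p (M : 'M[R[i]]_(m, p)) a b :
  complex.Im (M a b) ^+ 2 <= fre M M.
Proof.
have -> : fre M M = fre ((0 +i* 1) *: M) ((0 +i* 1) *: M).
  by rewrite fre_scale2 /normc2 /= expr0n/= add0r expr1n mul1r.
apply: le_trans (Re_sq_le_fre _ a b); rewrite mxE.
by case: (M a b) => x y /=; rewrite mul0r mul1r sub0r sqrrN.
Qed.

End sequences_of_matrices.

(** * Completeness of L^2 *)

Lemma le_limn_einf (R : realType) (u v : nat -> \bar R) :
  (forall k, (u k <= v k)%E) -> (limn_einf u <= limn_einf v)%E.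
Proof.
move=> uv; rewrite !limn_einf_lim; apply: lee_lim; [exact: is_cvg_einfs|exact: is_cvg_einfs|].
apply: nearW => k; apply: le_ereal_inf_tmp => _ [j kj <-].
by apply: le_trans (uv j); apply: ereal_inf_lbound; exists j.
Qed.

Section RieszFischer.
Context (R : realType) (B : set (R4 R)) (n : nat) (E : hermitian_bundle B n).
Context (oB : open B).
Local Notation mR4 := (R4 (measurableTypeR R)).
Local Notation mu := (@leb4 R).
Local Notation N := (snorm (@rip R B n E)).
Implicit Types s t : sec E.

Let mB : measurable (B : set mR4) := open_measurable4 oB.
Let SI := L2_semi_inner E oB.
Let LB s t (Ls : L2 s) (Lt : L2 t) : L2 (s - t) := submoduleB (L2_sub E oB) Ls Lt.

Lemma density_chart s i x : compatible s -> B x -> dom i x ->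
  density s s x = fre (s i x) (s i x).
Proof.
by move=> cs Bx di; rewrite /density -Re_frob -hprodE (hprod_chart cs cs Bx di) Re_frob.
Qed.

Section limit.
Context (u_ : nat -> sec E) (Lu : forall k, L2 (u_ k)).
Context (du : forall k, N (u_ k.+1 - u_ k) <= 2^-1 ^+ k).

(* Since [|y| <= 2 ^- k + 2 ^ k * |y| ^ 2], finiteness of the weighted sum [S x] of the
   squared increments makes the increments at [x] summable. *)
Let d_ k x := density (u_ k.+1 - u_ k) (u_ k.+1 - u_ k) x.
Let w_ k x : R := 2 ^+ k * d_ k x.
Let w_ge0 k x : 0 <= w_ k x.
Proof. by rewrite mulr_ge0 ?exprn_ge0 ?density_ge0. Qed.
Let S x : \bar R := (\sum_(0 <= k <oo) (w_ k x)%:E)%E.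

Let S_ge0 x : (0 <= S x)%E.
Proof. by apply: nneseries_ge0 => k _ _; rewrite lee_fin. Qed.

Let measurable_w k : measurable_fun (B : set mR4) (EFin \o w_ k).
Proof.
apply/measurable_EFinP; apply: measurable_funM => //; apply: measurable_density => //.
  by case: (LB (Lu k.+1) (Lu k)).
by case: (LB (Lu k.+1) (Lu k)).
Qed.

Let measurable_S : measurable_fun (B : set mR4) S.
Proof.
by apply: ge0_emeasurable_sum => [k x _ _|k _]; [rewrite lee_fin|exact: measurable_w].
Qed.

Let ae_S : {ae mu, forall x, B x -> S x \is a fin_num}.
Proof.
apply: (integrable_ae mB); apply/integrableP; split => //.
have -> : (\int[mu]_(x in B) `|S x| = \int[mu]_(x in B) S x)%E.
  by apply: eq_integral => x _; rewrite gee0_abs.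
rewrite integral_nneseries//; last by move=> k x _; rewrite lee_fin.
(* The [k]-th squared increment has integral at most [4^-k], so after weighting by [2^k] the terms
   are at most [2^-k], with sum at most 2. *)
apply: (@le_lt_trans _ _ (2 : R)%:E); last exact: ltry.
apply: lime_le.
  by apply: is_cvg_nneseries => k _ _; apply: integral_ge0 => x _; rewrite lee_fin.
apply: nearW => K.
apply: (@le_trans _ _ (\sum_(0 <= k < K) (2^-1 ^+ k : R)%:E)%E).
  apply: lee_sum => k _.
  have -> : (\int[mu]_(x in B) (w_ k x)%:E = (2 ^+ k * N (u_ k.+1 - u_ k)%R ^+ 2)%:E)%E.
    rewrite EFinM -L2normsqE_snorm ?L2normsqE//; last exact: LB.
    rewrite -ge0_integralZl//.
    - apply/measurable_EFinP; apply: measurable_density => //.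
        by case: (LB (Lu k.+1) (Lu k)).
      by case: (LB (Lu k.+1) (Lu k)).
    - by move=> x _; rewrite lee_fin density_ge0.
  rewrite lee_fin (@le_trans _ _ (2 ^+ k * (2^-1 ^+ k) ^+ 2))//.
    by rewrite ler_wpM2l ?exprn_ge0// lerXn2r ?nnegrE ?sqrtr_ge0 ?exprn_ge0.
  by rewrite expr2 mulrA -exprMn divff// expr1n mul1r.
rewrite sumEFin lee_fin.
have := @geometric_le_lim R K 1 2^-1; rewrite /series/=.
under eq_bigr do rewrite mul1r.
move=> /(_ ler01) h; apply: (le_trans (h _ _)).
- by rewrite invr_gt0.
- by rewrite ger0_norm// invf_lt1// ltr1n.
- by rewrite ler_pdivrMr; lra.
Qed.

Let cvg_entries x i a b : B x -> dom i x -> S x \is a fin_num ->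
  cvgn (fun k => complex.Re (u_ k i x a b)) /\
  cvgn (fun k => complex.Im (u_ k i x a b)).
Proof.
move=> Bx di fS.
have bS k : series (fun k => 2^-1 ^+ k + w_ k x) k <= 2 + fine (S x).
  rewrite /series/= big_split/= lerD//.
    have := @geometric_le_lim R k 1 2^-1; rewrite /series/=.
    under eq_bigr do rewrite mul1r.
    move=> /(_ ler01) h; apply: (le_trans (h _ _)).
    - by rewrite invr_gt0.
    - by rewrite ger0_norm// invf_lt1// ltr1n.
    - by rewrite ler_pdivrMr; lra.
  rewrite -lee_fin fineK// -sumEFin.
  by apply: nneseries_lim_ge => j _ _; rewrite lee_fin.
have key (q y d : R) : 0 < q -> y ^+ 2 <= d -> `|y| <= q^-1 + q * d.
  move=> q0 yd; apply: (@le_trans _ _ (q^-1 + q * y ^+ 2)).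
    rewrite -(ler_pM2l q0) mulrDr mulfV ?gt_eqF//.
    have -> : q * (q * y ^+ 2) = (q * `|y|) ^+ 2.
      by rewrite exprMn real_normK ?num_real// expr2 mulrA.
    (* Multiplied by [q], the claim reads [t <= 1 + t^2]. *)
    by set t := q * `|y|; nra.
  by rewrite lerD2l ler_wpM2l// ltW.
have dk k : d_ k x = fre (u_ k.+1 i x - u_ k i x) (u_ k.+1 i x - u_ k i x).
  by rewrite /d_ (density_chart _ Bx di)//; case: (LB (Lu k.+1) (Lu k)).
split; apply: (cvg_summable_increments _ bS) => k; rewrite -raddfB/=.
- have -> : u_ k.+1 i x a b - u_ k i x a b = (u_ k.+1 i x - u_ k i x) a b by rewrite !mxE.
  rewrite exprVn; apply: key; first by rewrite exprn_gt0.
  by rewrite dk; exact: Re_sq_le_fre.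
- have -> : u_ k.+1 i x a b - u_ k i x a b = (u_ k.+1 i x - u_ k i x) a b by rewrite !mxE.
  rewrite exprVn; apply: key; first by rewrite exprn_gt0.
  by rewrite dk; exact: Im_sq_le_fre.
Qed.

(** The exceptional set, where [S] is infinite, does not depend on a chart. Putting [p] equal to 0
    on it keeps the transition law valid at every point of [B], as [compatible] demands, and not
    just almost everywhere. *)
Let p : sec E := fun i x => if S x \is a fin_num then
  \matrix_(a, b) (limn (fun k => complex.Re (u_ k i x a b)) +i*
                  limn (fun k => complex.Im (u_ k i x a b))) else 0.

Let cvg_p x i : B x -> dom i x -> S x \is a fin_num ->
  mxcvg (fun k => u_ k i x) (p i x).
Proof.
by move=> Bx di fS a b; rewrite /p fS mxE /=; have [] := cvg_entries a b Bx di fS.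
Qed.

Let compatible_p : compatible p.
Proof.
move=> i j x Bx di dj; have [fS|nS] := boolP (S x \is a fin_num); last first.
  by rewrite /p (negbTE nS) mulmx0.
apply: mxcvg_unique (cvg_p Bx di fS) _.
rewrite (_ : (fun k => _) = (fun k => trans i j x *m u_ k j x)).
  by apply: mxcvg_mull; exact: cvg_p.
by apply/funext => k; have [c _ _] := Lu k; rewrite (c i j).
Qed.

Let measurable_G : measurable_fun (B : set mR4) (fun x => ((S x \is a fin_num)%:R : R)).
Proof.
rewrite (_ : (fun x => _) = (fun x => if S x \is a fin_num then 1 else 0)); last first.
  by apply/funext => x; case: ifP.
apply: measurable_fun_if => //; apply: (measurable_fun_bool true).
exact: (emeasurable_fin_num mB measurable_S).
Qed.

Let measurable_p : measurable_sec p.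
Proof.
move=> i a b.
have sub : measurable_fun (B `&` dom i : set mR4) (fun x => ((S x \is a fin_num)%:R : R)).
  exact: measurable_funS measurable_G.
split.
(* Multiplication by the indicator of finiteness of [S] turns almost everywhere convergence into
   convergence at every point. *)
- apply: (measurable_fun_cvg (h := fun k x => (S x \is a fin_num)%:R * complex.Re (u_ k i x a b))).
    move=> k; apply: measurable_funM => //.
    by have [_ m _] := Lu k; have [] := m i a b.
  move=> x [Bx di]; rewrite /p; have [fS|nS] := boolP (S x \is a fin_num).
    under eq_fun do rewrite mul1r.
    by have := cvg_p Bx di fS a b; rewrite /p fS => -[].
  by under eq_fun do rewrite mul0r; rewrite mxE; exact: cvg_cst.
- apply: (measurable_fun_cvg (h := fun k x => (S x \is a fin_num)%:R * complex.Im (u_ k i x a b))).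
    move=> k; apply: measurable_funM => //.
    by have [_ m _] := Lu k; have [] := m i a b.
  move=> x [Bx di]; rewrite /p; have [fS|nS] := boolP (S x \is a fin_num).
    under eq_fun do rewrite mul1r.
    by have := cvg_p Bx di fS a b; rewrite /p fS => -[].
  by under eq_fun do rewrite mul0r; rewrite mxE; exact: cvg_cst.
Qed.

Let N_tail k m : N (u_ k - u_ (k + m)%N) <= 2 * 2^-1 ^+ k.
Proof.
suff : N (u_ k - u_ (k + m)%N) <= 2 * 2^-1 ^+ k - 2 * 2^-1 ^+ (k + m).
  by move=> /le_trans; apply; rewrite gerBl mulr_ge0 ?exprn_ge0.
elim: m => [|m IH]; first by rewrite addn0 !subrr (snorm0 SI).
apply: (le_trans (snorm_triangle SI (Lu k) (Lu (k + m)) (Lu _))).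
apply: (le_trans (lerD IH _)).
  by rewrite (snorm_distC SI) ?addnS; [exact: du|exact: Lu|exact: Lu].
rewrite addnS exprS; set q := _ ^+ (k + m); set q' := _ ^+ k.
lra.
Qed.

(** Fatou's lemma for the squared densities of [u_ k - u_ (k + m)] as [m] grows, with the integrals
    controlled by [N_tail]. The bound is stated for the extended-real norm, because membership of
    [u_ k - p] in L^2 is deduced from it. *)
Let L2normsq_limit k : (L2normsq (u_ k - p)%R <= ((2 * 2^-1 ^+ k) ^+ 2)%:E)%E.
Proof.
have mm m : measurable_fun (B : set mR4) (EFin \o density (u_ k - u_ (k + m)%N) (u_ k - u_ (k + m)%N)).
  apply/measurable_EFinP; apply: measurable_density; by have [] := LB (Lu k) (Lu (k + m)%N).
have ms : measurable_sec (u_ k - p).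
  rewrite addrC -scaleN1r; apply: measurable_secP => //; by have [] := Lu k.
rewrite L2normsqE.
apply: (@le_trans _ _ (\int[mu]_(x in B)
    limn_einf (fun m => (density (u_ k - u_ (k + m)%N)%R (u_ k - u_ (k + m)%N)%R x)%:E))%E).
  apply: (ae_ge0_le_integral mB).
  - by move=> x _; rewrite lee_fin density_ge0.
  - by apply/measurable_EFinP; exact: measurable_density.
  - move=> x _; apply: (@le_trans _ _ (limn_einf (fun=> 0%E : \bar R))).
      by rewrite (cvg_limn_einf_sup (cvg_cst 0%E)).1.
    by apply: le_limn_einf => m; rewrite lee_fin density_ge0.
  - apply: measurableT_comp; first exact: oppe_measurable.
    by apply: measurable_fun_limn_esup => m; exact: measurableT_comp (mm m).
  apply: (@filterS _ _ (ae_filter_ringOfSetsType mu) _ _ _ ae_S) => x fS Bx.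
  have [i di] := pick_chart_ex E Bx; have {}di := pick_chart_dom di.
  have cup : compatible (u_ k - p).
    move=> a b y By da db; have [c _ _] := Lu k.
    rewrite -[LHS]/(u_ k a y - p a y) -[X in _ *m X]/(u_ k b y - p b y).
    by rewrite (c a b)// (compatible_p By da db) mulmxBr.
  rewrite (density_chart cup Bx di).
  rewrite (_ : (fun m => _) = (fun m => (fre (u_ k i x - u_ (k + m)%N i x) (u_ k i x - u_ (k + m)%N i x))%:E)); last first.
    apply/funext => m; rewrite (density_chart _ Bx di)//.
    by case: (LB (Lu k) (Lu (k + m)%N)).
  have cv : (fun m => (fre (u_ k i x - u_ (k + m)%N i x) (u_ k i x - u_ (k + m)%N i x))%:E) @ \oo
     --> (fre (u_ k i x - p i x) (u_ k i x - p i x))%:E.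
    apply: cvg_EFin; first exact: nearW.
    have := @mxcvg_fre _ _ _ (u_ k i x) _ _ (cvg_p Bx di (fS Bx)).
    rewrite -(cvg_shiftn k); apply: cvg_trans; apply: near_eq_cvg.
    by apply: nearW => m /=; rewrite addnC.
  by rewrite (cvg_limn_einf_sup cv).1.
apply: (le_trans (fatou mu mB mm _)); first by move=> m x _; rewrite lee_fin density_ge0.
rewrite -(cvg_limn_einf_sup (cvg_cst ((2 * 2^-1 ^+ k) ^+ 2)%:E)).1.
apply: le_limn_einf => m.
have := L2normsqE_snorm oB (LB (Lu k) (Lu (k + m)%N)).
rewrite L2normsqE => ->; rewrite lee_fin lerXn2r ?nnegrE ?sqrtr_ge0//.
Qed.

Lemma RieszFischer_limit : exists p : sec E,
  L2 p /\ (fun k => N (u_ k - p)) @ \oo --> (0 : R).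
Proof.
have Lup k : L2 (u_ k - p).
  split.
  - move=> a b y By da db; have [c _ _] := Lu k.
    rewrite -[LHS]/(u_ k a y - p a y) -[X in _ *m X]/(u_ k b y - p b y).
    by rewrite (c a b)// (compatible_p By da db) mulmxBr.
  - by rewrite addrC -scaleN1r; apply: measurable_secP => //; case: (Lu k).
  - by apply: le_lt_trans (L2normsq_limit k) _; exact: ltry.
have Lp : L2 p.
  have -> : p = u_ 0%N - (u_ 0%N - p) by rewrite subKr.
  exact: LB.
exists p; split => //.
have b k : 0 <= N (u_ k - p) <= 2 * 2^-1 ^+ k.
  rewrite snorm_ge0 -(@ler_pXn2r _ 2)// ?nnegrE ?snorm_ge0 ?mulr_ge0 ?exprn_ge0//.
  by rewrite -lee_fin -L2normsqE_snorm//; exact: L2normsq_limit.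
apply: (squeeze_cvgr (f := cst 0) (h := geometric 2 2^-1)).
- exact: nearW.
- exact: cvg_cst.
- by apply: cvg_geometric; rewrite ger0_norm// invf_lt1// ltr1n.
Qed.

End limit.

Lemma L2_rapidly_complete : rapidly_complete (@rip R B n E) (@L2 R B n E : set (sec E)).
Proof. by move=> u_ Lu du; exact: RieszFischer_limit. Qed.

End RieszFischer.

(** * Smooth functions and phases *)

Section smooth_functions.
Context (R : realType).
Implicit Types (f g : R4 R -> R) (W O : set (R4 R)) (x v : R4 R).

Let near_open O (P : R4 R -> Prop) x : open O -> O x -> (forall y, O y -> P y) ->
  \forall y \near x, P y.
Proof.
move=> oO Ox OP; have : \forall y \near x, O y by exact: open_nbhs_nbhs.
exact: filterS.
Qed.

Lemma near_eq_continuous f g x : (\forall y \near x, f y = g y) ->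
  {for x, continuous f} -> {for x, continuous g}.
Proof.
move=> fg cf; have : g @ x --> f x by apply: cvg_trans cf; exact: near_eq_cvg.
by rewrite (nbhs_singleton fg).
Qed.

Lemma eq_continuous_at f g x : f =1 g ->
  {for x, continuous f} -> {for x, continuous g}.
Proof. by move=> /funext ->. Qed.

Lemma Ck_on_eq k W f g : open W -> (forall x, W x -> f x = g x) ->
  Ck_on k W f -> Ck_on k W g.
Proof.
move=> oW; elim: k f g => [|k IH] f g fg /= [cf df].
  split=> // x Wx; apply: near_eq_continuous (cf x Wx).
  exact: near_open oW Wx fg.
have nfg x : W x -> \forall y \near x, f y = g y by move=> Wx; exact: near_open oW Wx fg.
split=> [x Wx|mu]; first exact: near_eq_continuous (nfg x Wx) (cf x Wx).
have [d1 d2] := df mu; split=> [x Wx|].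
  exact: near_eq_derivable (nfg x Wx) (d1 x Wx).
by apply: IH d2 => x Wx; apply: near_eq_derive; exact: nfg.
Qed.

Lemma Ck_onS k W O f : O `<=` W -> Ck_on k W f -> Ck_on k O f.
Proof.
move=> OW; elim: k f => [|k IH] f /= [cf df].
  by split=> // x /OW; exact: cf.
split=> [x /OW|mu]; first exact: cf.
by have [d1 d2] := df mu; split=> [x /OW|]; [exact: d1|exact: IH].
Qed.

Lemma Ck_on_local k O f : (forall x, O x -> exists W, [/\ open W, W x & Ck_on k W f]) ->
  Ck_on k O f.
Proof.
elim: k f => [|k IH] f H /=.
  by split=> // x Ox; have [W [oW Wx [cf _]]] := H x Ox; exact: cf.
split=> [x Ox|mu]; first by have [W [oW Wx [cf _]]] := H x Ox; exact: cf.
split=> [x Ox|]; first by have [W [oW Wx [_ df]]] := H x Ox; exact: (df mu).1.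
apply: IH => x Ox; have [W [oW Wx [_ df]]] := H x Ox.
by exists W; split => //; exact: (df mu).2.
Qed.

Lemma Ck_on_pred k W f : Ck_on k.+1 W f -> Ck_on k W f.
Proof.
elim: k f => [|k IH] f; first by case.
by move=> [cf df]; split => // mu; have [d1 d2] := df mu; split => //; exact: IH.
Qed.

Lemma Ck_on_cst k W (c : R) : Ck_on k W (fun=> c).
Proof.
elim: k c => [|k IH] c /=; first by split=> // x _; exact: cvg_cst.
split=> [x _|mu]; first exact: cvg_cst.
split=> [x _|]; first exact: derivable_cst.
rewrite (_ : 'D_(basis4 R mu) _ = fun=> 0) ?IH//.
by apply/funext => x; rewrite derive_cst.
Qed.

Lemma Ck_onD k W f g : open W -> Ck_on k W f -> Ck_on k W g ->
  Ck_on k W (fun x => f x + g x).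
Proof.
move=> oW; elim: k f g => [|k IH] f g /= [cf df] [cg dg].
  by split=> // x Wx; apply: cvgD; [exact: cf|exact: cg].
split=> [x Wx|mu]; first by apply: cvgD; [exact: cf|exact: cg].
have [f1 f2] := df mu; have [g1 g2] := dg mu; split=> [x Wx|].
  by apply: (derivableD (f1 x Wx) (g1 x Wx)).
apply: (Ck_on_eq oW _ (IH _ _ f2 g2)) => x Wx.
by rewrite -(deriveD (f1 x Wx) (g1 x Wx)).
Qed.

Lemma Ck_onM k W f g : open W -> Ck_on k W f -> Ck_on k W g ->
  Ck_on k W (fun x => f x * g x).
Proof.
move=> oW; elim: k f g => [|k IH] f g hf hg.
  by split=> // x Wx; apply: cvgM; [exact: hf.1|exact: hg.1].
have [cf df] := hf; have [cg dg] := hg.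
split=> [x Wx|mu]; first by apply: cvgM; [exact: cf|exact: cg].
have [f1 f2] := df mu; have [g1 g2] := dg mu; split=> [x Wx|].
  by apply: (derivableM (f1 x Wx) (g1 x Wx)).
apply: (Ck_on_eq oW _ (Ck_onD oW (IH _ _ (Ck_on_pred hf) g2) (IH _ _ (Ck_on_pred hg) f2))) => x Wx.
by rewrite -[RHS]/('D_(basis4 R mu) (f * g) x) (deriveM (f1 x Wx) (g1 x Wx)).
Qed.

Lemma smooth_on_open O f : open O -> smooth_on O f <-> forall k, Ck_on k O f.
Proof.
move=> oO; split=> [sf k|ck x Ox]; last by exists O, f.
apply: Ck_on_local => x Ox; have [W [F [oW Wx CF FE]]] := sf x Ox.
exists (W `&` O); split; [exact: openI|by []|].
apply: (@Ck_on_eq _ _ F); first exact: openI.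
  by move=> y [Wy Oy]; exact: FE.
by apply: (@Ck_onS _ W) => //; exact: subIsetl.
Qed.

Lemma smooth_onS S S' f : S' `<=` S -> smooth_on S f -> smooth_on S' f.
Proof.
move=> SS sf x /SS Sx; have [W [F [oW Wx CF FE]]] := sf x Sx.
by exists W, F; split => // y Wy /SS; exact: FE.
Qed.

Lemma is_derive_along f x v (d : R) :
  is_derive (0 : R) 1 (fun h : R => f (h *: v + x)) d -> is_derive x v f d.
Proof.
have e : (fun h : R => h^-1 *: ((f \o shift x) (h *: v) - f x)) =
    (fun h : R => h^-1 *: (((fun h : R => f (h *: v + x)) \o shift 0) (h *: (1 : R)) -
      (fun h : R => f (h *: v + x)) 0)).
  by apply/funext => h; rewrite /= addr0 scale0r add0r [h *: 1]mulr1.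
by move=> [dd <-]; apply: DeriveDef; rewrite ?/derivable ?/derive e.
Qed.

Definition angle (z x : R4 R) : R := 2 * pi * (z.1.1.1 * x.1.1.1 +
  z.1.1.2 * x.1.1.2 + z.1.2 * x.1.2 + z.2 * x.2).

Lemma angle_continuous z : continuous (angle z).
Proof.
move=> x; rewrite /angle; apply: cvgMr.
do !apply: cvgD; apply: cvgMr.
- by apply: (@continuous_comp _ _ _ (fst \o fst) fst);
    [apply: (@continuous_comp _ _ _ fst fst)|]; exact: cvg_fst.
- by apply: (@continuous_comp _ _ _ (fst \o fst) snd);
    [apply: (@continuous_comp _ _ _ fst fst); exact: cvg_fst|exact: cvg_snd].
- by apply: (@continuous_comp _ _ _ fst snd); [exact: cvg_fst|exact: cvg_snd].
- exact: cvg_snd.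
Qed.

(** A two-parameter family closed under directional derivatives: up to a constant factor, [(a, b)]
    becomes [(b, - a)]. Hence induction on the order proves smoothness for all members at once,
    among them the real and imaginary parts of [phase]. *)
Definition trig (a b : R) z x : R := a * cos (angle z x) + b * sin (angle z x).

Lemma trig_continuous a b z : continuous (trig a b z).
Proof.
move=> x; rewrite /trig; apply: cvgD; apply: cvgMr.
- by apply: continuous_comp; [exact: angle_continuous|exact: continuous_cos].
- by apply: continuous_comp; [exact: angle_continuous|exact: continuous_sin].
Qed.

Lemma is_derive_trig a b z x v :
  is_derive x v (trig a b z) (angle z v * trig b (- a) z x).
Proof.
apply: is_derive_along.
have e : (fun h : R => trig a b z (h *: v + x)) =
   (fun h : R => a * cos (h * angle z v + angle z x) + b * sin (h * angle z v + angle z x)).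
  apply/funext => h; rewrite /trig; suff -> : angle z (h *: v + x) = h * angle z v + angle z x by [].
  by rewrite /angle /= /GRing.scale /=; ring.
rewrite e.
have l : is_derive (0 : R) 1 (fun h : R => h * angle z v + angle z x) (angle z v).
  by apply: is_derive_eq; rewrite addr0 scaler0 add0r [_ *: 1]mulr1.
have dc := @is_derive1_comp R cos _ 0 _ _ (is_derive_cos _) l.
have ds := @is_derive1_comp R sin _ 0 _ _ (is_derive_sin _) l.
have := is_deriveD (is_deriveZ a dc) (is_deriveZ b ds).
rewrite mul0r add0r => /is_derive_eq; apply.
by rewrite /trig /= /GRing.scale /=; ring.
Qed.

Lemma Ck_on_trig k a b z W : open W -> Ck_on k W (trig a b z).
Proof.
move=> oW; elim: k a b => [|k IH] a b /=; first by split=> // x _; exact: trig_continuous.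
split=> [x _|mu]; first exact: trig_continuous.
split=> [x _|]; first by have [] := is_derive_trig a b z x (basis4 R mu).
apply: Ck_on_eq oW _ (Ck_onM oW (Ck_on_cst k W (angle z (basis4 R mu))) (IH b (- a))) => x _.
by have /@derive_val -> := is_derive_trig a b z x (basis4 R mu).
Qed.

Lemma angle_basis z mu : angle z (basis4 R mu) = 2 * pi * Defs.coord mu z.
Proof.
rewrite /angle /basis4 /Defs.coord /=; congr (_ * _).
case: mu => [[|[|[|[|m]]]]] //= lt; rewrite (tnth_nth 0) /=; ring.
Qed.

End smooth_functions.

(** * Complex and matrix-valued derivatives, and the phase *)

Section complex_derivative.
Context (R : realType).
Implicit Types (f g : R4 R -> R[i]) (x v : R4 R).

Definition is_cder x v f (d : R[i]) : Prop :=
  is_derive x v (fun y => complex.Re (f y)) (complex.Re d) /\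
  is_derive x v (fun y => complex.Im (f y)) (complex.Im d).

Lemma is_cderD x v f g d e : is_cder x v f d -> is_cder x v g e ->
  is_cder x v (fun y => f y + g y) (d + e).
Proof.
move=> [f1 f2] [g1 g2]; split.
  by under eq_fun do rewrite raddfD/=; rewrite raddfD/=; exact: is_deriveD.
by under eq_fun do rewrite raddfD/=; rewrite raddfD/=; exact: is_deriveD.
Qed.

Lemma is_cderM x v f g d e : is_cder x v f d -> is_cder x v g e ->
  is_cder x v (fun y => f y * g y) (d * g x + f x * e).
Proof.
move=> [f1 f2] [g1 g2]; split.
- rewrite (_ : (fun y => _) = (fun y => complex.Re (f y)) * (fun y => complex.Re (g y)) -
    (fun y => complex.Im (f y)) * (fun y => complex.Im (g y))); last first.
    by apply/funext => y; exact: ReM.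
  have := is_deriveB (is_deriveM f1 g1) (is_deriveM f2 g2).
  move=> /is_derive_eq; apply.
  by rewrite ReD !ReM /GRing.scale/=; ring.
- rewrite (_ : (fun y => _) = (fun y => complex.Re (f y)) * (fun y => complex.Im (g y)) +
    (fun y => complex.Im (f y)) * (fun y => complex.Re (g y))); last first.
    by apply/funext => y; exact: ImM.
  have := is_deriveD (is_deriveM f1 g2) (is_deriveM f2 g1).
  move=> /is_derive_eq; apply.
  by rewrite ImD !ImM /GRing.scale/=; ring.
Qed.

Lemma is_cder_cst x v c : is_cder x v (fun=> c) 0.
Proof. by split; exact: is_derive_cst. Qed.

Lemma is_cder_sum x v (I : Type) (r : seq I) (f : I -> R4 R -> R[i]) d :
  (forall i, is_cder x v (f i) (d i)) ->
  is_cder x v (fun y => \sum_(i <- r) f i y) (\sum_(i <- r) d i).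
Proof.
move=> fd; elim: r => [|i r IH].
  by under eq_fun do rewrite big_nil; rewrite big_nil; exact: is_cder_cst.
by under eq_fun do rewrite big_cons; rewrite big_cons; apply: is_cderD.
Qed.

Lemma pd_mx_eq m p mu (f : R4 R -> 'M[R[i]]_(m, p)) x (D : 'M[R[i]]_(m, p)) :
  (forall a b, is_cder x (basis4 R mu) (fun y => f y a b) (D a b)) -> pd_mx mu f x = D.
Proof.
move=> fD; apply/matrixP => a b; rewrite mxE.
by have [/@derive_val -> /@derive_val ->] := fD a b; case: (D a b).
Qed.

Definition ccont x f : Prop :=
  {for x, continuous (fun y => complex.Re (f y))} /\
  {for x, continuous (fun y => complex.Im (f y))}.

Lemma ccontD x f g : ccont x f -> ccont x g -> ccont x (fun y => f y + g y).
Proof.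
move=> [f1 f2] [g1 g2]; split.
  by apply: eq_continuous_at (cvgD f1 g1) => y; rewrite ReD.
by apply: eq_continuous_at (cvgD f2 g2) => y; rewrite ImD.
Qed.

Lemma ccontM x f g : ccont x f -> ccont x g -> ccont x (fun y => f y * g y).
Proof.
move=> [f1 f2] [g1 g2]; split.
  by apply: eq_continuous_at (cvgB (cvgM f1 g1) (cvgM f2 g2)) => y; rewrite ReM.
by apply: eq_continuous_at (cvgD (cvgM f1 g2) (cvgM f2 g1)) => y; rewrite ImM.
Qed.

Lemma eq_ccont x f g : f =1 g -> ccont x f -> ccont x g.
Proof. by move=> /funext ->. Qed.

Lemma ccont_cst x c : ccont x (fun=> c).
Proof. by split; exact: cvg_cst. Qed.

Lemma ccont_sum x (I : Type) (r : seq I) (f : I -> R4 R -> R[i]) :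
  (forall i, ccont x (f i)) -> ccont x (fun y => \sum_(i <- r) f i y).
Proof.
move=> cf; elim: r => [|i r IH].
  by apply: eq_ccont (ccont_cst x 0) => y; rewrite big_nil.
by apply: eq_ccont (ccontD (cf i) IH) => y; rewrite big_cons.
Qed.

Section smooth_matrix.
Context (m p : nat) (O : set (R4 R)) (oO : open O).
Context (f : R4 R -> 'M[R[i]]_(m, p)) (sf : smooth_mx_on O f).

Lemma smooth_mx_is_cder mu x a b : O x ->
  is_cder x (basis4 R mu) (fun y => f y a b) (pd_mx mu f x a b).
Proof.
move=> Ox; have [s1 s2] := sf a b.
have [_ /(_ mu)[d1 _]] := (smooth_on_open _ oO).1 s1 1%N.
have [_ /(_ mu)[d2 _]] := (smooth_on_open _ oO).1 s2 1%N.
by split; rewrite mxE/=; apply: derivableP; [exact: d1|exact: d2].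
Qed.

Lemma smooth_mx_ccont x a b : O x -> ccont x (fun y => f y a b).
Proof.
move=> Ox; have [s1 s2] := sf a b.
have [c1 _] := (smooth_on_open _ oO).1 s1 0%N.
have [c2 _] := (smooth_on_open _ oO).1 s2 0%N.
by split; [exact: c1|exact: c2].
Qed.

Lemma smooth_mx_pd_ccont mu x a b : O x -> ccont x (fun y => pd_mx mu f y a b).
Proof.
move=> Ox; have [s1 s2] := sf a b.
have [_ /(_ mu)[_ [c1 _]]] := (smooth_on_open _ oO).1 s1 1%N.
have [_ /(_ mu)[_ [c2 _]]] := (smooth_on_open _ oO).1 s2 1%N.
split.
  by apply: eq_continuous_at (c1 x Ox) => y; rewrite mxE.
by apply: eq_continuous_at (c2 x Ox) => y; rewrite mxE.
Qed.

End smooth_matrix.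

Lemma pd_mxM m p q mu (T : R4 R -> 'M[R[i]]_(m, p)) (f : R4 R -> 'M[R[i]]_(p, q))
    (O : set (R4 R)) x : open O -> smooth_mx_on O T -> smooth_mx_on O f -> O x ->
  pd_mx mu (fun y => T y *m f y) x = pd_mx mu T x *m f x + T x *m pd_mx mu f x.
Proof.
move=> oO sT sf Ox; apply: pd_mx_eq => a b.
under eq_fun do rewrite mxE; rewrite !mxE -big_split/=.
apply: is_cder_sum => k; apply: is_cderM; exact: (smooth_mx_is_cder oO).
Qed.

Lemma near_pd_mx m p mu (f g : R4 R -> 'M[R[i]]_(m, p)) x :
  (\forall y \near x, f y = g y) -> pd_mx mu f x = pd_mx mu g x.
Proof.
move=> fg; apply/matrixP => a b; rewrite !mxE; congr (_ +i* _).
  by apply: near_eq_derive; apply: filterS fg => y ->.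
by apply: near_eq_derive; apply: filterS fg => y ->.
Qed.

Definition phase (z x : R4 R) : R[i] := trig 1 0 z x +i* trig 0 (-1) z x.

Lemma is_cder_phase z x mu :
  is_cder x (basis4 R mu) (phase z) (- (0 +i* (2 * pi * Defs.coord mu z)) * phase z x).
Proof.
rewrite -angle_basis /phase; split => /=.
  apply: is_derive_eq (is_derive_trig 1 0 z x (basis4 R mu)) _.
  by rewrite /trig; ring.
apply: is_derive_eq (is_derive_trig 0 (-1) z x (basis4 R mu)) _.
by rewrite /trig; ring.
Qed.

Lemma phaseD z w x : phase (z + w) x = phase z x * phase w x.
Proof.
rewrite /phase /trig; have -> : angle (z + w) x = angle z x + angle w x.
  by rewrite /angle /=; ring.
by rewrite cosD sinD; apply/eqP; rewrite eq_complex /=; apply/andP; split; apply/eqP; ring.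
Qed.

Lemma phase0 x : phase 0 x = 1.
Proof.
rewrite /phase /trig; have -> : angle 0 x = 0 by rewrite /angle /=; ring.
by rewrite cos0 sin0 !mulr0 !mulr1 addr0 addr0.
Qed.

Lemma phase_norm z x : normc2 (phase z x) = 1.
Proof.
by apply: etrans (cos2Dsin2 (angle z x)); rewrite /normc2 /phase /trig /=; ring.
Qed.

Lemma phaseJ z x : (phase z x)^* = phase (- z) x.
Proof.
rewrite /phase /trig; have -> : angle (- z) x = - angle z x by rewrite /angle /=; ring.
rewrite cosN sinN; apply/eqP; rewrite eq_complex /=; apply/andP; split; apply/eqP; ring.
Qed.

Lemma smooth_mx_phase m p z O (f : R4 R -> 'M[R[i]]_(m, p)) : open O ->
  smooth_mx_on O f -> smooth_mx_on O (fun x => phase z x *: f x).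
Proof.
move=> oO sf a b; have [s1 s2] := sf a b.
have c1 := (smooth_on_open _ oO).1 s1; have c2 := (smooth_on_open _ oO).1 s2.
split; apply/(smooth_on_open _ oO) => k.
- apply: Ck_on_eq oO _ (Ck_onD oO (Ck_onM oO (Ck_on_trig k 1 0 z oO) (c1 k))
    (Ck_onM oO (Ck_on_trig k 0 1 z oO) (c2 k))) => x Ox.
  by rewrite mxE ReM /phase /trig /=; ring.
- apply: Ck_on_eq oO _ (Ck_onD oO (Ck_onM oO (Ck_on_trig k 1 0 z oO) (c2 k))
    (Ck_onM oO (Ck_on_trig k 0 (-1) z oO) (c1 k))) => x Ox.
  by rewrite mxE ImM /phase /trig /=; ring.
Qed.

End complex_derivative.

(** * Multiplication operators on L^2 *)

Section multiplication.
Context (R : realType) (B : set (R4 R)) (n : nat) (E : hermitian_bundle B n).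
Context (oB : open B).
Local Notation mR4 := (R4 (measurableTypeR R)).
Local Notation mu := (@leb4 R).
Local Notation N := (snorm (@rip R B n E)).
Implicit Types s t : sec E.

Let mB : measurable (B : set mR4) := open_measurable4 oB.
Let SI := L2_semi_inner E oB.

Definition mulf (u : R4 R -> R[i]) s : sec E := fun i x => u x *: s i x.

Lemma rep_mulf u s x : rep (mulf u s) x = u x *: rep s x.
Proof. by rewrite /rep; case: pick_chart => //; rewrite scaler0. Qed.

Lemma mulfP u (c : R[i]) s t : mulf u (c *: s + t) = c *: mulf u s + mulf u t.
Proof.
apply/funext => i; apply/funext => x; rewrite -[LHS]/(u x *: (c *: s i x + t i x)).
by rewrite scalerDr scalerA mulrC -scalerA.
Qed.

Lemma mulfD u s t : mulf u (s + t) = mulf u s + mulf u t.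
Proof. by rewrite -[s]scale1r mulfP !scale1r. Qed.

Lemma mulfZ u (c : R[i]) s : mulf u (c *: s) = c *: mulf u s.
Proof.
apply/funext => i; apply/funext => x; rewrite -[LHS]/(u x *: (c *: s i x)).
by rewrite scalerA mulrC -scalerA.
Qed.

Lemma mulfB u s t : mulf u (s - t) = mulf u s - mulf u t.
Proof. by rewrite mulfD -scaleN1r mulfZ scaleN1r. Qed.

Lemma mulf_mulf u v s : mulf u (mulf v s) = mulf (fun x => u x * v x) s.
Proof. by apply/funext => i; apply/funext => x; rewrite /mulf scalerA. Qed.

Lemma mulf_cst (c : R[i]) s : mulf (fun=> c) s = c *: s.
Proof. by []. Qed.

(* [u] acts on L^2 with operator norm at most [M] *)
Record multiplier (u : R4 R -> R[i]) (M : R) : Prop := Multiplier {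
  multiplier_Re : measurable_fun (B : set mR4) (fun x => complex.Re (u x));
  multiplier_Im : measurable_fun (B : set mR4) (fun x => complex.Im (u x));
  multiplier_ge0 : 0 <= M;
  multiplier_le : forall x, B x -> normc2 (u x) <= M ^+ 2
}.

Lemma ccont_multiplier u M : (forall x, B x -> ccont x u) -> 0 <= M ->
  (forall x, B x -> normc2 (u x) <= M ^+ 2) -> multiplier u M.
Proof.
move=> cu M0 uM; split => //.
  by apply: continuous_measurable4 => // x /cu[].
by apply: continuous_measurable4 => // x /cu[].
Qed.

Lemma L2_mulf u M s : multiplier u M -> L2 s -> L2 (mulf u s).
Proof.
move=> [mr mi M0 uM] Ls; have [cs ms fs] := Ls.
have sub (f : R4 R -> R) i : measurable_fun (B : set mR4) f ->
    measurable_fun (B `&` dom (h := E) i : set mR4) f.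
  by apply: measurable_funS => //; exact: subIsetl.
apply: (@L2_dominated _ _ _ _ oB _ (fun x => M ^+ 2 * density s s x)).
- move=> i j x Bx di dj; rewrite /mulf (cs i j)//; exact: scalemxAr.
- move=> i a b; have [m1 m2] := ms i a b; split.
    apply: (eq_measurable_fun (fun x => complex.Re (u x) * complex.Re (s i x a b) -
      complex.Im (u x) * complex.Im (s i x a b))) => [x _|].
      by rewrite mxE ReM.
    by apply: measurable_funB; apply: measurable_funM => //; exact: sub.
  apply: (eq_measurable_fun (fun x => complex.Re (u x) * complex.Im (s i x a b) +
    complex.Im (u x) * complex.Re (s i x a b))) => [x _|].
    by rewrite mxE ImM.
  by apply: measurable_funD; apply: measurable_funM => //; exact: sub.
- exact: (integrableZl mB (M ^+ 2) (L2_integrable oB Ls)).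
- move=> x Bx; rewrite /density rep_mulf fre_scale2.
  by apply: ler_wpM2r; [exact: fre_ge0|exact: uM].
Qed.

Lemma snorm_mulf u M s : multiplier u M -> L2 s -> N (mulf u s) <= M * N s.
Proof.
move=> mu_ Ls; have Lus := L2_mulf mu_ Ls; have [_ _ M0 uM] := mu_.
rewrite -(@ler_pXn2r _ 2)// ?nnegrE ?mulr_ge0 ?snorm_ge0//.
rewrite exprMn !(snorm_sq SI)// /rip -RintegralZl//; last exact: L2_integrable.
apply: le_Rintegral => //.
- exact: L2_integrable.
- exact: (integrableZl mB (M ^+ 2) (L2_integrable oB Ls)).
- move=> x Bx; rewrite /density rep_mulf fre_scale2.
  by apply: ler_wpM2r; [exact: fre_ge0|exact: uM].
Qed.

Lemma density_eq s s' t t' x :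
  (forall i, B x -> dom (h := E) i x -> s i x = s' i x) ->
  (forall i, B x -> dom (h := E) i x -> t i x = t' i x) -> B x ->
  density s t x = density s' t' x.
Proof.
move=> ss tt Bx; have [i xi] := pick_chart_ex E Bx; have di := pick_chart_dom xi.
by rewrite /density !(repE _ xi) ss ?tt.
Qed.

Lemma rip_eq s s' t t' :
  (forall i x, B x -> dom (h := E) i x -> s i x = s' i x) ->
  (forall i x, B x -> dom (h := E) i x -> t i x = t' i x) -> rip s t = rip s' t'.
Proof.
move=> ss tt; apply: eq_Rintegral => x; rewrite inE => Bx.
by apply: density_eq => // i; [exact: ss|exact: tt].
Qed.

Lemma L2prod_eq s s' t t' :
  (forall i x, B x -> dom (h := E) i x -> s i x = s' i x) ->
  (forall i x, B x -> dom (h := E) i x -> t i x = t' i x) -> L2prod s t = L2prod s' t'.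
Proof.
move=> ss tt; rewrite !L2prodE (rip_eq ss tt); congr (_ +i* _).
by apply: rip_eq => // i x Bx di; congr (_ *: _); exact: tt.
Qed.

Lemma phaseK (z x : R4 R) : phase (- z) x * phase z x = 1.
Proof. by rewrite -phaseD addNr phase0. Qed.

Lemma mulf_phaseK (z : R4 R) s : mulf (phase z) (mulf (phase (- z)) s) = s.
Proof.
apply/funext => i; apply/funext => x; rewrite /mulf scalerA mulrC phaseK.
by rewrite scale1r.
Qed.

Lemma mulf_phaseNK (z : R4 R) s : mulf (phase (- z)) (mulf (phase z) s) = s.
Proof. by rewrite -[X in mulf _ (mulf (phase X) _)]opprK mulf_phaseK. Qed.

Lemma ccont_phase (z x : R4 R) : ccont x (phase z).
Proof. by split; exact: trig_continuous. Qed.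

Lemma phase_multiplier (z : R4 R) : multiplier (phase z) 1.
Proof.
apply: ccont_multiplier => // [x _|x _]; first exact: ccont_phase.
by rewrite phase_norm expr1n.
Qed.

Lemma rip_phase (z : R4 R) s t : rip (mulf (phase z) s) (mulf (phase z) t) = rip s t.
Proof.
apply: eq_Rintegral => x _.
by rewrite /density !rep_mulf fre_scale scalerA phaseJ phaseK scale1r.
Qed.

Lemma L2prod_phase (z : R4 R) s t :
  L2prod (mulf (phase z) s) (mulf (phase z) t) = L2prod s t.
Proof. by rewrite !L2prodE rip_phase -mulfZ rip_phase. Qed.

Lemma snorm_phase (z : R4 R) s : N (mulf (phase z) s) = N s.
Proof. by rewrite /snorm rip_phase. Qed.

Lemma L2_scale (c : R[i]) s : L2 s -> L2 (c *: s).
Proof. exact: (submoduleZ _ (L2_sub E oB)). Qed.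

(** Anti-self-adjointness of [i] for the real form; together with real linearity it yields complex
    linearity of [L2prod]. *)
Lemma rip_i s t : L2 s -> L2 t -> rip ((0 +i* 1) *: s) t = - rip s ((0 +i* 1) *: t).
Proof.
move=> Ls Lt; rewrite -(si_Nr SI) //; last exact: L2_scale.
apply: eq_Rintegral => x _; rewrite /density repZ fre_scale -scaleN1r scalerA repZ.
by congr (fre _ (_ *: _)); apply/eqP; rewrite eq_complex/=; apply/andP; split;
  apply/eqP; ring.
Qed.

Lemma complex_split (c : R[i]) s :
  c *: s = (complex.Re c)%:C *: s + (complex.Im c)%:C *: ((0 +i* 1) *: s).
Proof.
rewrite scalerA -scalerDl; congr (_ *: _); case: c => a b; apply/eqP.
by rewrite eq_complex/=; apply/andP; split; apply/eqP; ring.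
Qed.

Lemma L2prod_lin (c : R[i]) s t w : L2 s -> L2 t -> L2 w ->
  L2prod (c *: s + t) w = c * L2prod s w + L2prod t w.
Proof.
move=> Ls Lt Lw.
have key v : L2 v -> rip (c *: s + t) v =
    complex.Re c * rip s v - complex.Im c * rip s ((0 +i* 1) *: v) + rip t v.
  move=> Lv; rewrite complex_split -addrA (si_lin SI)//; last first.
    by apply: (si_memP SI) => //; exact: L2_scale.
  rewrite (si_lin SI)//; last exact: L2_scale.
  by rewrite rip_i// mulrN addrA.
rewrite !L2prodE !key//; last exact: L2_scale.
have e : rip s ((0 +i* 1) *: ((0 +i* 1) *: w)) = - rip s w.
  have -> : (0 +i* 1) *: ((0 +i* 1) *: w) = - w.
    rewrite scalerA -[RHS]scaleN1r; congr (_ *: _).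
    by apply/eqP; rewrite eq_complex/=; apply/andP; split; apply/eqP; ring.
  exact: (si_Nr SI Lw Ls).
rewrite e; case: c {key} => a b; apply/eqP.
by rewrite eq_complex/=; apply/andP; split; apply/eqP; ring.
Qed.

End multiplication.

(** * The Dirac operator and its kernel *)

Section dirac_operator.
Context (R : realType) (B : set (R4 R)) (n : nat) (E : hermitian_bundle B n).
Context (oB : open B).
Local Notation mR4 := (R4 (measurableTypeR R)).
Local Notation mu := (@leb4 R).
Local Notation N := (snorm (@rip R B n E)).
Implicit Types (s t phi : sec E) (A : potential E).

Let mB : measurable (B : set mR4) := open_measurable4 oB.
Let SI := L2_semi_inner E oB.

Let odom (i : chart E) : open (B `&` dom i).
Proof. by apply: openI => //; exact: dom_open. Qed.

Lemma smooth_mx_onS m p (S S' : set (R4 R)) (f : R4 R -> 'M[R[i]]_(m, p)) :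
  S' `<=` S -> smooth_mx_on S f -> smooth_mx_on S' f.
Proof.
by move=> SS sf a b; have [f1 f2] := sf a b; split; exact: smooth_onS SS _.
Qed.

Lemma pd_mx_phase m p nu z (O : set (R4 R)) (f : R4 R -> 'M[R[i]]_(m, p)) x :
  open O -> smooth_mx_on O f -> O x ->
  pd_mx nu (fun y => phase z y *: f y) x =
  phase z x *: (pd_mx nu f x - (0 +i* (2 * pi * Defs.coord nu z)) *: f x).
Proof.
move=> oO sf Ox; apply: pd_mx_eq => a b.
have := is_cderM (is_cder_phase z x nu) (smooth_mx_is_cder oO sf nu a b Ox).
rewrite (_ : (fun y => (phase z y *: f y) a b) = (fun y => phase z y * f y a b)).
  suff -> : (phase z x *: (pd_mx nu f x - (0 +i* (2 * pi * Defs.coord nu z)) *: f x)) a b =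
    - (0 +i* (2 * pi * Defs.coord nu z)) * phase z x * f x a b +
    phase z x * pd_mx nu f x a b by [].
  by rewrite mxE [X in _ * X]mxE [X in _ + X]mxE [X in - X]mxE; ring.
by apply/funext => y; rewrite mxE.
Qed.

(** A relation between two potentials, so that the same lemmas serve to pass from [A] to [twist A z]
    and, with [- z], back again. *)
Definition shifted A A' z := forall i nu x,
  A' i nu x = A i nu x + (0 +i* (2 * pi * Defs.coord nu z))%:M.

(** The derivative of the phase contributes [- 2 pi i z_nu], which cancels the shift of the
    potential in each covariant derivative. *)
Lemma dirac_phase (c : 'I_4 -> 'M[R[i]]_2) A A' z phi i x : shifted A A' z ->
  smooth_mx_on (B `&` dom i) (phi i) -> B x -> dom i x ->
  Defs.dirac c A' (mulf (phase z) phi) i x = mulf (phase z) (Defs.dirac c A phi) i x.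
Proof.
move=> AA sphi Bx di.
have aux (p k : R[i]) (X Y F : 'M[R[i]]_(n, 2)) :
    p *: (X - k *: F) + (p *: Y + k *: (p *: F)) = p *: (X + Y).
  by rewrite (scalerA k) (mulrC k) -scalerA -!scalerDr addrACA addNr addr0.
rewrite /Defs.dirac /mulf scaler_sumr; apply: eq_bigr => nu _.
rewrite scalemxAl; congr (_ *m _); rewrite /covd /mulf AA.
rewrite (pd_mx_phase _ _ (@odom i) sphi) // mulmxDl mul_scalar_mx -scalemxAr.
exact: aux.
Qed.

Lemma test_section_phase z phi : test_section phi -> test_section (mulf (phase z) phi).
Proof.
move=> [cphi sphi [K [cK KB K0]]]; split.
- by move=> i j x Bx di dj; rewrite /mulf (cphi i j)//; exact: scalemxAr.
- by move=> i; exact: smooth_mx_phase.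
- by exists K; split => // i x Bx di Kx; rewrite /mulf K0// scaler0.
Qed.

(** The kernel is defined weakly, so the phase is moved across the pairing by unitarity. Testing
    [phase z . s] against [phi] amounts to testing [s] against [phase (- z) . phi], which is again a
    test section. *)
Lemma ker_dirac_phase S A A' z s : shifted A A' z ->
  ker_dirac S A s -> ker_dirac S A' (mulf (phase z) s).
Proof.
move=> AA [Ls ks]; split; first exact: (L2_mulf oB (phase_multiplier oB z)).
move=> phi tphi; rewrite -(ks _ (test_section_phase (- z) tphi)).
rewrite -[RHS](L2prod_phase z); apply: L2prod_eq => // i x Bx di.
rewrite -{1}(mulf_phaseK z phi); apply: dirac_phase => //.
by have [_ + _] := test_section_phase (- z) tphi; apply.
Qed.

Lemma shifted_twist A z : shifted A (twist A z) z.
Proof. by []. Qed.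

Lemma shifted_twistN A z : shifted (twist A z) A (- z).
Proof.
move=> i nu x; rewrite /twist -addrA -raddfD/=.
have -> : Defs.coord nu (- z) = - Defs.coord nu z.
  by case: nu => [[|[|[|[|?]]]]] lt.
suff -> : (0 +i* (2 * pi * Defs.coord nu z)) + (0 +i* (2 * pi * - Defs.coord nu z)) = 0.
  by rewrite raddf0 addr0.
by apply/eqP; rewrite eq_complex/=; apply/andP; split; apply/eqP; ring.
Qed.

Lemma nahm_fibreP S A z s :
  nahm_fibre S A z s <-> ker_dirac S A (mulf (phase (- z)) s).
Proof.
split; first exact: ker_dirac_phase (shifted_twistN A z).
by move=> /(ker_dirac_phase (shifted_twist A z)); rewrite mulf_phaseK.
Qed.

Section connection.
Context (A : potential E) (cA : is_connection A) (c : 'I_4 -> 'M[R[i]]_2).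

(** The derivative of the transition function, produced by the product rule, is cancelled by the
    inhomogeneous term of the gauge law. *)
Lemma covd_compatible nu phi i j x : test_section phi -> B x -> dom i x -> dom j x ->
  covd A nu phi i x = trans i j x *m covd A nu phi j x.
Proof.
move=> [cphi sphi _] Bx di dj; have [sA _ gA] := cA.
have oO : open (B `&` dom i `&` dom j) by apply: openI => //; exact: dom_open.
have sT : smooth_mx_on (B `&` dom i `&` dom j) (trans i j).
  apply: smooth_mx_onS (trans_smooth i j) => y [[By ? ?]]; do !split => //.
  exact: subset_closure.
have sj : smooth_mx_on (B `&` dom i `&` dom j) (phi j).
  by apply: smooth_mx_onS (sphi j) => y [[]].
rewrite /covd mulmxDr.
have -> : pd_mx nu (phi i) x = pd_mx nu (fun y => trans i j y *m phi j y) x.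
  apply: near_pd_mx; have : \forall y \near x, (B `&` dom i `&` dom j) y.
    by apply: open_nbhs_nbhs; do !split.
  by apply: filterS => y [[By ? ?]]; exact: cphi.
have Ox : (B `&` dom i `&` dom j) x by [].
rewrite (pd_mxM _ oO sT sj Ox).
rewrite (cphi i j x Bx di dj) (mulmxA (A i nu x)) gA// mulmxBl -mulmxA.
by rewrite [LHS]addrC addrA subrK addrC.
Qed.

Lemma dirac_compatible phi : test_section phi -> compatible (Defs.dirac c A phi).
Proof.
move=> tphi i j x Bx di dj; rewrite /Defs.dirac mulmx_sumr; apply: eq_bigr => nu _.
by rewrite (covd_compatible _ tphi Bx di dj) mulmxA.
Qed.

Lemma dirac_ccont phi i x a b : test_section phi -> B x -> dom i x ->
  ccont x (fun y => Defs.dirac c A phi i y a b).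
Proof.
move=> [_ sphi _] Bx di; have [sA _ _] := cA.
have sAi nu : smooth_mx_on (B `&` dom i) (A i nu).
  apply: smooth_mx_onS (sA i nu) => y [By ?]; split => //; exact: subset_closure.
apply: (@eq_ccont _ _ (fun y => \sum_(nu < 4) \sum_(k < 2)
  ((pd_mx nu (phi i) y a k + \sum_(l < n) A i nu y a l * phi i y l k) * (c nu)^T k b))).
  move=> y; rewrite /Defs.dirac summxE; apply: eq_bigr => nu _.
  rewrite [RHS]mxE; apply: eq_bigr => k _; congr (_ * _).
  by rewrite /covd [RHS]mxE; congr (_ + _); rewrite mxE.
apply: ccont_sum => nu; apply: ccont_sum => k; apply: ccontM; last exact: ccont_cst.
apply: ccontD; first exact: (smooth_mx_pd_ccont (@odom i) (sphi i)).
apply: ccont_sum => l; apply: ccontM; first exact: (smooth_mx_ccont (@odom i) (sAi nu)).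
exact: (smooth_mx_ccont (@odom i) (sphi i)).
Qed.

Lemma dirac_support phi (K : set (R4 R)) i x : compact K ->
  (forall i x, B x -> dom i x -> ~ K x -> phi i x = 0) ->
  B x -> dom i x -> ~ K x -> Defs.dirac c A phi i x = 0.
Proof.
move=> cK K0 Bx di nKx.
have clK : closed K by apply: compact_closed => //; exact: norm_hausdorff.
have nr : \forall y \near x, phi i y = 0.
  have : \forall y \near x, ((B `&` dom i) `&` ~` K) y.
    apply: open_nbhs_nbhs; split; last by do !split.
    by apply: openI; [exact: (@odom i)|exact: closed_openC].
  by apply: filterS => y [[By ?] ?]; exact: K0.
rewrite /Defs.dirac big1// => nu _; rewrite /covd K0// mulmx0 addr0.
rewrite (@near_pd_mx _ _ _ _ _ (fun=> 0) _ nr).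
rewrite (@pd_mx_eq _ _ _ _ _ _ 0) ?mul0mx// => a b.
by rewrite !mxE; exact: is_cder_cst.
Qed.

Lemma continuous_at_sum (I : Type) (r : seq I) (f : I -> R4 R -> R) x :
  (forall i, {for x, continuous (f i)}) ->
  {for x, continuous (fun y => \sum_(i <- r) f i y)}.
Proof.
move=> cf; elim: r => [|i r IH].
  by apply: (@eq_continuous_at _ (fun=> 0)); [move=> y; rewrite big_nil|exact: cvg_cst].
by apply: eq_continuous_at (cvgD (cf i) IH) => y; rewrite big_cons.
Qed.

Lemma dirac_density_continuous phi x : test_section phi -> B x ->
  {for x, continuous (density (Defs.dirac c A phi) (Defs.dirac c A phi))}.
Proof.
move=> tphi Bx; have [i xi] := pick_chart_ex E Bx; have di := pick_chart_dom xi.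
apply: (@near_eq_continuous _ (fun y => fre (Defs.dirac c A phi i y) (Defs.dirac c A phi i y))).
  have : \forall y \near x, (B `&` dom i) y by apply: open_nbhs_nbhs.
  apply: filterS => y [By dy]; rewrite (density_chart _ By dy)//.
  exact: dirac_compatible.
rewrite /fre; apply: continuous_at_sum => a; apply: continuous_at_sum => b.
have [c1 c2] := dirac_ccont a b tphi Bx di.
by apply: cvgD; apply: cvgM.
Qed.

Lemma dirac_bounded phi : test_section phi -> exists M : R,
  forall x, B x -> density (Defs.dirac c A phi) (Defs.dirac c A phi) x <= M.
Proof.
move=> tphi; have [_ _ [K [cK KB K0]]] := tphi.
(* The extreme value theorem needs a point of [K]; when [K] is empty the Dirac image vanishes on
   [B]. *)
have [K_ex|nK] := pselect (K !=set0).
  have [y yK yM] := compact_EVT_max K_ex cK (f := density (Defs.dirac c A phi) (Defs.dirac c A phi))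
    (continuous_in_subspaceT (fun x xK => dirac_density_continuous tphi (KB _ (set_mem xK)))).
  exists (density (Defs.dirac c A phi) (Defs.dirac c A phi) y) => x Bx.
  have [Kx|nKx] := pselect (K x); first by apply: yM; rewrite inE.
  have [i xi] := pick_chart_ex E Bx; have di := pick_chart_dom xi.
  rewrite {1}/density !(repE _ xi) (dirac_support cK K0)// fre0l.
  exact: density_ge0.
exists 0 => x Bx; have nKx : ~ K x by move=> Kx; apply: nK; exists x.
have [i xi] := pick_chart_ex E Bx; have di := pick_chart_dom xi.
by rewrite {1}/density !(repE _ xi) (dirac_support cK K0)// fre0l.
Qed.

(** Makes the functionals that define the kernel linear and continuous on L^2. The image is
    continuous, vanishes off a compact subset of [B] and is therefore bounded, and [B] has finite
    measure. *)
Lemma L2_dirac phi : bounded_set B -> test_section phi -> L2 (Defs.dirac c A phi).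
Proof.
move=> bB tphi; have [M ub] := dirac_bounded tphi.
apply: (@L2_dominated _ _ _ _ oB _ (fun=> M)).
- exact: dirac_compatible.
- move=> i a b; split; apply: continuous_measurable4 => // x [Bx di];
    by have [] := dirac_ccont a b tphi Bx di.
- apply/integrableP; split; first exact: measurable_cst.
  rewrite integral_cst//= -ge0_fin_numE; last by rewrite mule_ge0.
  by rewrite fin_numM// ge0_fin_numE//; exact: leb4_bounded.
- exact: ub.
Qed.

End connection.

Section kernel.
Context (S : spinors R) (A : potential E) (cA : is_connection A) (bB : bounded_set B).
Local Notation H := (ker_dirac S A).

Lemma ker_dirac_L2 : H `<=` (@L2 R B n E : set (sec E)).
Proof. by move=> s []. Qed.

Lemma ker_dirac_submodule : submodule (H : set (sec E)).
Proof.
have L0 := L2_0 E.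
split.
  split=> // phi tphi; have Ld := L2_dirac cA (clp S) bB tphi.
  have := L2prod_lin oB 0 L0 L0 Ld; rewrite scaler0 addr0 mul0r add0r => _.
  by rewrite L2prodE !(si_0l SI)//; exact: (L2_scale oB).
move=> a u v [Lu ku] [Lv kv]; split; first exact: L2_P.
move=> phi tphi; have Ld := L2_dirac cA (clp S) bB tphi.
by rewrite (L2prod_lin oB)// ku// kv// mulr0 addr0.
Qed.

Lemma ker_dirac_closed p : L2 p ->
  (forall e : R, 0 < e -> exists s, H s /\ N (s - p) <= e) -> H p.
Proof.
move=> Lp cl; split=> // phi tphi.
have Ld := L2_dirac cA (clp S) bB tphi.
have key w : L2 w -> (forall s, H s -> rip s w = 0) -> rip p w = 0.
  move=> Lw w0; apply/eqP; rewrite -normr_le0; apply/ler_addgt0Pl => e e0.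
  (* The approximation error is divided by [N w + 1] because [N w] itself may be 0. *)
  rewrite addr0; have Nw : 0 < N w + 1 by rewrite ltr_pwDr// snorm_ge0.
  have [s [Hs sp]] := cl (e / (N w + 1)) (divr_gt0 e0 Nw).
  have Ls := ker_dirac_L2 Hs.
  rewrite -[rip p w]subr0 -(w0 _ Hs) -(si_Bl SI)//.
  apply: (le_trans (si_CauchySchwarz SI _ Lw)); first exact: (submoduleB (L2_sub E oB)).
  rewrite (snorm_distC SI)//; apply: (le_trans (ler_wpM2r (snorm_ge0 _ _) sp)).
  by rewrite mulrAC ler_pdivrMr// ler_pM2l// lerDl.
rewrite L2prodE; congr (_ +i* _).
  by apply: key => // s [_ /(_ _ tphi)]; rewrite L2prodE => -[].
by apply: key; [exact: L2_scale|move=> s [_ /(_ _ tphi)]; rewrite L2prodE => -[]].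
Qed.

Lemma ker_dirac_complete : rapidly_complete (@rip R B n E) (H : set (sec E)).
Proof.
move=> u_ Hu du; have [p [Lp up]] := L2_rapidly_complete oB (fun k => ker_dirac_L2 (Hu k)) du.
exists p; split => //; apply: ker_dirac_closed => // e e0.
have /cvgrPdist_le/(_ e e0)[k _ /(_ k (leqnn k))/=] := up.
by rewrite sub0r normrN ger0_norm ?snorm_ge0// => ?; exists (u_ k).
Qed.

End kernel.

(* The projections onto [ker_dirac S A] and onto the fibres of the Nahm
   transform are both instances of this. *)
Lemma projP (H : set (sec E)) s p : H `<=` (@L2 R B n E : set (sec E)) ->
  submodule H -> L2 s -> H p -> (forall h, H h -> rip (s - p) h = 0) ->
  H (Defs.proj H s) /\ N (Defs.proj H s - p) = 0.
Proof.
move=> HL sH Ls Hp op.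
(* [proj] falls back on a default value when no projection exists, so a witness comes first. Real
   orthogonality to [H] gives complex orthogonality because [H] is stable under [i]. *)
have ex : exists q, H q /\ forall h, H h -> L2prod (s - q) h = 0.
  exists p; split=> // h Hh; rewrite L2prodE op//.
  by congr (_ +i* _); apply: op; exact: submoduleZ.
have [Hq oq] : H (Defs.proj H s) /\ forall h, H h -> L2prod (s - Defs.proj H s) h = 0.
  exact: (@xgetPex _ 0 [set p | H p /\ forall h, H h -> L2prod (s - p) h = 0]).
split=> //.
have LB (u v : sec E) : L2 u -> L2 v -> L2 (u - v) by exact: (submoduleB (L2_sub E oB)).
have Lp := HL _ Hp; have Lq := HL _ Hq.
have Hd : H (Defs.proj H s - p) by exact: submoduleB.
rewrite /snorm; suff -> : rip (Defs.proj H s - p) (Defs.proj H s - p) = 0 by rewrite sqrtr0.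
have -> : rip (Defs.proj H s - p) (Defs.proj H s - p) = rip ((s - p) - (s - Defs.proj H s)) (Defs.proj H s - p).
  by congr (rip _ _); rewrite opprB [RHS]addrC addrA subrK.
rewrite (si_Bl SI) ?op//; try exact: LB.
by have := oq _ Hd; rewrite L2prodE => -[->]; rewrite subr0.
Qed.

End dirac_operator.

(** * Symmetry of second derivatives *)

Section mean_value_estimates.
Context (R : realType).

Lemma is_derive_continuous (f : R -> R) (x d : R) : is_derive x 1 f d -> {for x, continuous f}.
Proof. by move=> [/derivable1_diffP df _]; exact: differentiable_continuous. Qed.

Lemma MVT_from (f df : R -> R) (a b : R) :
  (forall x : R, is_derive x 1 f (df x)) ->
  exists c, `|c - a| <= `|b - a| /\ f b - f a = df c * (b - a).
Proof.
move=> fd.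
have cf (x y : R) : {within `[x, y], continuous f}.
  by apply: continuous_subspaceT => t; exact: is_derive_continuous (fd t).
have [ab|/ltW ba] := leP a b.
  have [c] := MVT_segment ab (fun x _ => fd x) (cf a b).
  rewrite in_itv/= => /andP[ac cb] e; exists c; split => //.
  by rewrite !ger0_norm ?subr_ge0// lerD2r.
have [c] := MVT_segment ba (fun x _ => fd x) (cf b a).
rewrite in_itv/= => /andP[bc ca] e; exists c; split.
  by rewrite !ler0_norm ?subr_le0// lerN2 lerD2r.
by rewrite -opprB e -mulrN opprB.
Qed.

Lemma abs_sin_le (t : R) : `|sin t| <= `|t|.
Proof.
have [c [_]] := MVT_from 0 t (@is_derive_sin R); rewrite sin0 !subr0 => ->.
rewrite normrM ler_piMl// ler_norml.
by rewrite cos_geN1 cos_le1.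
Qed.

Lemma abs_cosB1_le (t : R) : `|cos t - 1| <= `|t|.
Proof.
have [c [_]] := MVT_from 0 t (@is_derive_cos R); rewrite cos0 !subr0 => ->.
by rewrite normrM normrN ler_piMl// ler_norml sin_geN1 sin_le1.
Qed.

(** The quadratic Taylor bounds leave a factor [|t|] after division by [t], which is what the
    difference quotients of the phase require. *)
Lemma abs_cosB1_le_sq (t : R) : `|cos t - 1| <= t ^+ 2.
Proof.
have [c [ct]] := MVT_from 0 t (@is_derive_cos R); rewrite cos0 !subr0 in ct * => ->.
rewrite normrM normrN -(real_normK (num_real t)) expr2 ler_wpM2r//.
exact: le_trans (abs_sin_le c) ct.
Qed.

Lemma abs_sinB_le_sq (t : R) : `|sin t - t| <= t ^+ 2.
Proof.
have d (x : R) : is_derive x 1 (fun x => sin x - x) (cos x - 1).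
  by have := is_deriveB (is_derive_sin x) (is_derive_id x 1).
have [c [ct]] := MVT_from 0 t d; rewrite sin0 !subr0 in ct * => ->.
rewrite normrM -(real_normK (num_real t)) expr2 ler_wpM2r//.
exact: le_trans (abs_cosB1_le c) ct.
Qed.

Lemma is_derive_line (f : R4 R -> R) (x v : R4 R) (s d : R) :
  is_derive (s *: v + x) v f d -> is_derive s 1 (fun h : R => f (h *: v + x)) d.
Proof.
have e : (fun h : R => h^-1 *: (((fun h : R => f (h *: v + x)) \o shift s) (h *: (1 : R)) -
      (fun h : R => f (h *: v + x)) s)) =
    (fun h : R => h^-1 *: ((f \o shift (s *: v + x)) (h *: v) - f (s *: v + x))).
  by apply/funext => h; rewrite /= [h *: 1]mulr1 scalerDl addrA.
by move=> [dd <-]; apply: DeriveDef; rewrite ?/derivable ?/derive e.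
Qed.

Section second_difference.
Context (f f1 f21 : R4 R -> R) (u v : R4 R).
Context (d1 : forall z, is_derive z u f (f1 z)).
Context (d21 : forall z, is_derive z v f1 (f21 z)).

(** The mean value theorem is applied twice: along [u] to the increment of [f] in direction
    [t *: v], then along [v] to [f1]. *)
Lemma second_difference z (t : R) : exists a b : R, [/\ `|a| <= `|t|, `|b| <= `|t| &
  f (t *: u + (t *: v + z)) - f (t *: v + z) - (f (t *: u + z) - f z) =
  f21 (a *: u + (b *: v + z)) * t * t].
Proof.
pose h (s : R) := f (s *: u + (t *: v + z)) - f (s *: u + z).
have dh (s : R) : is_derive s 1 h (f1 (s *: u + (t *: v + z)) - f1 (s *: u + z)).
  have := is_deriveB (is_derive_line (d1 (s *: u + (t *: v + z)))) (is_derive_line (d1 (s *: u + z))).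
  by [].
have [a []] := MVT_from 0 t dh; rewrite !subr0 /h !scale0r !add0r => at_ e1.
have dk (s : R) : is_derive s 1 (fun s => f1 (s *: v + (a *: u + z))) (f21 (s *: v + (a *: u + z))).
  exact: is_derive_line.
have [b []] := MVT_from 0 t dk; rewrite !subr0 !scale0r !add0r => bt e2.
exists a, b; split => //.
rewrite [X in f21 X]addrCA -e2 [X in f1 X - _]addrCA -e1; ring.
Qed.

End second_difference.

(** The second difference is symmetric in [u] and [v]. Computing it in both orders makes [f21] and
    [f12] agree at two points close to [z], and continuity at [z] concludes. *)
Lemma second_derivatives_symmetric (f f1 f2 f12 f21 : R4 R -> R) (u v z : R4 R) :
  (forall z, is_derive z u f (f1 z)) -> (forall z, is_derive z v f (f2 z)) ->
  (forall z, is_derive z v f1 (f21 z)) -> (forall z, is_derive z u f2 (f12 z)) ->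
  {for z, continuous f12} -> {for z, continuous f21} -> f12 z = f21 z.
Proof.
move=> d1 d2 d21 d12 c12 c21.
apply/eqP; rewrite -subr_eq0 -normr_le0; apply/ler_addgt0Pl => e e0; rewrite addr0.
have e20 : 0 < e / 2 by lra.
have near_par (g : R4 R -> R) (p q : R4 R) : {for z, continuous g} ->
    exists2 r : R, 0 < r & forall a b : R, `|a| <= r -> `|b| <= r ->
      `|g z - g (a *: p + (b *: q + z))| <= e / 2.
  move=> cg; have /cvgrPdist_le/(_ _ e20)/nbhs_ballP[d /= d0 gd] := cg.
  (* This radius keeps the norm of [a *: p + b *: q] below [d]; the summand 1 covers [p = q = 0]. *)
  exists (d / (`|p| + `|q| + 1)).
    by rewrite divr_gt0// ltr_pwDr// addr_ge0.
  move=> a b ad bd; apply: gd; rewrite -ball_normE /ball_/= addrA [_ + z]addrC opprD addNKr normrN.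
  apply: (le_lt_trans (ler_normD _ _)); rewrite !normrZ.
  have K : 0 < `|p| + `|q| + 1 by rewrite ltr_pwDr// addr_ge0.
  apply: (@le_lt_trans _ _ (d / (`|p| + `|q| + 1) * (`|p| + `|q|))).
    by rewrite mulrDr lerD// ler_wpM2r.
  by rewrite mulrAC ltr_pdivrMr// ltr_pM2l// ltrDl.
have [r1 r10 h1] := near_par f21 u v c21.
have [r2 r20 h2] := near_par f12 v u c12.
pose t := Num.min r1 r2.
have t0 : 0 < t by rewrite lt_min r10 r20.
have [a [b [at_ bt e1]]] := second_difference d1 d21 z t.
have [a' [b' [at' bt' e2]]] := second_difference d2 d12 z t.
have tr1 : `|t| <= r1 by rewrite gtr0_norm// ge_min lexx.
have tr2 : `|t| <= r2 by rewrite gtr0_norm// ge_min lexx orbT.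
have E : f21 (a *: u + (b *: v + z)) = f12 (a' *: v + (b' *: u + z)).
  have tn0 : t != 0 by rewrite gt_eqF.
  apply: (mulIf tn0); apply: (mulIf tn0); rewrite -e1 -e2.
  by rewrite [t *: u + (t *: v + z)]addrCA; ring.
have k1 := h1 a b (le_trans at_ tr1) (le_trans bt tr1).
have k2 := h2 a' b' (le_trans at' tr2) (le_trans bt' tr2).
have -> : f12 z - f21 z = (f12 z - f12 (a' *: v + (b' *: u + z))) -
   (f21 z - f21 (a *: u + (b *: v + z))) by rewrite E; ring.
apply: (le_trans (ler_normB _ _)); lra.
Qed.

End mean_value_estimates.

(** * L^2 derivatives *)

Section L2_calculus.
Context (R : realType) (B : set (R4 R)) (n : nat) (E : hermitian_bundle B n).
Context (oB : open B) (bB : bounded_set B).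
Local Notation N := (snorm (@rip R B n E)).
Implicit Types (s g h : sec E) (f : R4 R -> sec E) (z w v : R4 R).

Let SI := L2_semi_inner E oB.
Let LB s (t : sec E) (Ls : L2 s) (Lt : L2 t) : L2 (s - t) := submoduleB (L2_sub E oB) Ls Lt.
Let LD s (t : sec E) (Ls : L2 s) (Lt : L2 t) : L2 (s + t) := submoduleD (L2_sub E oB) Ls Lt.
Let LZ (c : R[i]) s (Ls : L2 s) : L2 (c *: s) := L2_scale oB c Ls.

Definition eqv s (t : sec E) : Prop := [/\ L2 s, L2 t & N (s - t) = 0].

Lemma eqv_aeq s t : eqv s t -> aeq s t.
Proof. by move=> [Ls Lt e]; apply/(aeqP oB Ls Lt). Qed.

Lemma aeq_eqv s (t : sec E) : L2 s -> L2 t -> aeq s t -> eqv s t.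
Proof. by move=> Ls Lt /(aeqP oB Ls Lt). Qed.

Lemma eqv_le0 s (t : sec E) : L2 s -> L2 t -> N (s - t) <= 0 -> eqv s t.
Proof. by move=> Ls Lt st; split=> //; apply: le_anti; rewrite st snorm_ge0. Qed.

Lemma eqv_refl s : L2 s -> eqv s s.
Proof. by move=> Ls; split; rewrite // subrr (snorm0 SI). Qed.

Lemma eqv_sym s t : eqv s t -> eqv t s.
Proof. by move=> [Ls Lt st]; split => //; rewrite (snorm_distC SI). Qed.

Lemma eqv_trans t s h : eqv s t -> eqv t h -> eqv s h.
Proof.
move=> [Ls Lt st] [_ Lh th]; apply: eqv_le0 => //.
by apply: (le_trans (snorm_triangle SI Ls Lt Lh)); rewrite st th addr0.
Qed.

Lemma eqvD s s' t t' : eqv s s' -> eqv t t' -> eqv (s + t) (s' + t').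
Proof.
move=> [Ls Ls' e1] [Lt Lt' e2]; apply: eqv_le0; [exact: LD|exact: LD|].
have -> : s + t - (s' + t') = (s - s') + (t - t') by rewrite opprD addrACA.
apply: (le_trans (snormD SI _ _)); [exact: LB|exact: LB|].
by rewrite e1 e2 addr0.
Qed.

(** Linearity is only up to [eqv], so as to include projections, whose values are chosen
    representatives. The norm bound then makes [T] respect [eqv]. *)
Record bounded_op (T : sec E -> sec E) (M : R) : Prop := BoundedOp {
  bounded_op_L2 : forall s, L2 s -> L2 (T s);
  bounded_op_lin : forall (c : R[i]) s (t : sec E), L2 s -> L2 t ->
    eqv (T (c *: s + t)) (c *: T s + T t);
  bounded_op_le : forall s, L2 s -> N (T s) <= M * N s
}.

Lemma multiplier_bounded_op u M : multiplier B u M -> bounded_op (mulf u) M.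
Proof.
move=> mu_; split=> [s Ls|c s t Ls Lt|s Ls].
- exact: (L2_mulf oB mu_).
- rewrite mulfP; apply: eqv_refl; apply: LD; [apply: LZ|]; exact: (L2_mulf oB mu_).
- exact: (snorm_mulf oB mu_).
Qed.

Lemma scale_multiplier (c : R[i]) : multiplier B (fun=> c) (Num.sqrt (normc2 c)).
Proof.
apply: (ccont_multiplier oB) => [x _||x _]; [exact: ccont_cst|exact: sqrtr_ge0|].
by rewrite sqr_sqrtr// normc2_ge0.
Qed.

Lemma bounded_op_congr T M s t : bounded_op T M -> eqv s t -> eqv (T s) (T t).
Proof.
move=> [TL Tl Tb] [Ls Lt st]; have e0 := Tl (-1) t s Lt Ls.
rewrite !scaleN1r (addrC (- t)) (addrC (- T t)) in e0; have [LT1 LT2 e] := e0.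
apply: eqv_le0; [exact: TL|exact: TL|].
have -> : T s - T t = T (s - t) - (T (s - t) - (T s - T t)) by rewrite subKr.
apply: (le_trans (snormB SI LT1 _)); first exact: LB.
rewrite e addr0; apply: (le_trans (Tb _ (LB Ls Lt))).
by rewrite st mulr0.
Qed.

Lemma eqvZ (c : R[i]) s t : eqv s t -> eqv (c *: s) (c *: t).
Proof.
exact: (bounded_op_congr (multiplier_bounded_op (scale_multiplier c))).
Qed.

Lemma eqvB s s' t t' : eqv s s' -> eqv t t' -> eqv (s - t) (s' - t').
Proof.
move=> e1 e2; rewrite -(scaleN1r t) -(scaleN1r t').
by apply: eqvD e1 _; exact: eqvZ.
Qed.

Lemma bounded_op_comp T T' M M' : bounded_op T M -> bounded_op T' M' -> 0 <= M ->
  bounded_op (T \o T') (M * M').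
Proof.
move=> bT [TL' Tl' Tb']; have [TL Tl Tb] := bT; split=> [s Ls|c s t Ls Lt|s Ls] /=.
- by apply: TL; exact: TL'.
- apply: (eqv_trans (bounded_op_congr bT (Tl' c s t Ls Lt))).
  by apply: Tl; exact: TL'.
- apply: (le_trans (Tb _ (TL' _ Ls))); rewrite -mulrA ler_wpM2l//.
  exact: Tb'.
Qed.

Lemma bounded_opZ T M (c : R[i]) s : bounded_op T M -> L2 s ->
  eqv (T (c *: s)) (c *: T s).
Proof.
move=> [TL Tl Tb] Ls; have L0 := L2_0 E; have T0 : eqv (T 0) 0.
  apply: eqv_le0; [exact: TL|exact: L0|].
  by rewrite subr0; apply: (le_trans (Tb _ L0)); rewrite (snorm0 SI) mulr0.
rewrite -[c *: s]addr0; apply: (eqv_trans (Tl c s 0 Ls L0)).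
rewrite -[X in eqv _ X]addr0; apply: eqvD T0.
exact: (eqv_refl (LZ c (TL _ Ls))).
Qed.

Definition L2_derivative f z v g : Prop :=
  (fun t : R => N ((t^-1)%:C *: (f (z + t *: v) - f z) - g)) @ 0^' --> (0 : R).

Lemma L2normsq_cvg0 (T : Type) (F : set_system T) (FF : Filter F) (u : T -> sec E) :
  (forall x, L2 (u x)) ->
  (fun x => L2normsq (u x)) @ F --> 0%E <-> (fun x => N (u x)) @ F --> (0 : R).
Proof.
move=> Lu; have -> : (fun x => L2normsq (u x)) = (fun x => (N (u x) ^+ 2)%:E).
  by apply/funext => x; rewrite L2normsqE_snorm.
split=> [h0|h]; last first.
  apply: cvg_EFin; first exact: nearW.
  have h2 := cvgM h h; rewrite mulr0 in h2; exact: h2.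
have h := fine_cvg h0.
have -> : (fun x => N (u x)) = (fun x => Num.sqrt (N (u x) ^+ 2)).
  by apply/funext => x; rewrite sqrtr_sqr ger0_norm// snorm_ge0.
rewrite -[X in _ --> X]sqrtr0; apply: (@continuous_cvg _ _ _ _ _ _ Num.sqrt).
  exact: sqrt_continuous.
exact: h.
Qed.

Lemma is_L2pdE nu f z g : (forall z, L2 (f z)) ->
  is_L2pd nu f z g <-> L2 g /\ L2_derivative f z (basis4 R nu) g.
Proof.
move=> Lf; split=> -[Lg h]; split=> //.
  have Lq (t : R) : L2 ((t^-1)%:C *: (f (z + t *: basis4 R nu) - f z) - g).
    by apply: LB => //; apply: LZ; exact: LB.
  exact: ((L2normsq_cvg0 _ Lq).1 h).
have Lq (t : R) : L2 ((t^-1)%:C *: (f (z + t *: basis4 R nu) - f z) - g).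
  by apply: LB => //; apply: LZ; exact: LB.
exact: ((L2normsq_cvg0 _ Lq).2 h).
Qed.

Lemma snorm_squeeze (T : Type) (F : set_system T) (FF : Filter F) (u : T -> sec E) (b : T -> R) :
  (\forall x \near F, N (u x) <= b x) -> b @ F --> (0 : R) ->
  (fun x => N (u x)) @ F --> (0 : R).
Proof.
move=> ub b0; apply: (@squeeze_cvgr _ _ _ _ (cst 0) b) => //; last exact: cvg_cst.
by apply: filterS ub => x xb; rewrite snorm_ge0.
Qed.

Lemma cvg0_ge (b : R -> R) (c : R) : (forall t, c <= b t) -> b @ 0^' --> (0 : R) -> c <= 0.
Proof.
move=> cb b0; rewrite -(cvg_lim _ b0)//; apply: limr_ge; first by apply/cvg_ex; exists 0.
exact: nearW.
Qed.

Lemma L2_derivative_unique f z v g h : (forall z, L2 (f z)) -> L2 g -> L2 h ->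
  L2_derivative f z v g -> L2_derivative f z v h -> eqv g h.
Proof.
move=> Lf Lg Lh dg dh; apply: eqv_le0 => //.
have gh := cvgD dg dh; rewrite addr0 in gh.
suff key (t : R) : N (g - h) <= N ((t^-1)%:C *: (f (z + t *: v) - f z) - g) +
    N ((t^-1)%:C *: (f (z + t *: v) - f z) - h) by exact: (cvg0_ge key (gh _)).
have Lq : L2 ((t^-1)%:C *: (f (z + t *: v) - f z)) by apply: LZ; exact: LB.
by apply: (le_trans (snorm_triangle SI Lg Lq Lh)); rewrite (snorm_distC SI Lg Lq).
Qed.

Lemma L2_derivative_eqv f f' z v g g' : (forall z, eqv (f z) (f' z)) -> eqv g g' ->
  L2_derivative f z v g -> L2_derivative f' z v g'.
Proof.
move=> ff gg; apply: snorm_squeeze; apply: nearW => t.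
have [Lq' Lq e] : eqv ((t^-1)%:C *: (f' (z + t *: v) - f' z) - g')
    ((t^-1)%:C *: (f (z + t *: v) - f z) - g).
  apply: eqvB; last exact: eqv_sym.
  by apply: eqvZ; apply: eqvB; apply: eqv_sym.
set x := (_ - g') in Lq' e *; set y := (_ - g) in Lq e *.
have -> : x = (x - y) + y by rewrite subrK.
by apply: (le_trans (snormD SI (LB Lq' Lq) Lq)); rewrite e add0r.
Qed.

Lemma L2_derivativeP (c : R[i]) f f' z v g g' : (forall z, L2 (f z)) -> (forall z, L2 (f' z)) ->
  L2 g -> L2 g' -> L2_derivative f z v g -> L2_derivative f' z v g' ->
  L2_derivative (fun z => c *: f z + f' z) z v (c *: g + g').
Proof.
move=> Lf Lf' Lg Lg' d d'.
have bc := scale_multiplier c.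
apply: (@snorm_squeeze _ _ _ _ (fun t =>
   Num.sqrt (normc2 c) * N ((t^-1)%:C *: (f (z + t *: v) - f z) - g) +
   N ((t^-1)%:C *: (f' (z + t *: v) - f' z) - g'))); last first.
  rewrite -[X in _ --> X](_ : Num.sqrt (normc2 c) * 0 + 0 = 0 :> R); last first.
    by rewrite mulr0 addr0.
  by apply: cvgD d'; apply: cvgMr; exact: d.
apply: nearW => t.
have Lq : L2 ((t^-1)%:C *: (f (z + t *: v) - f z) - g) by apply: LB => //; apply: LZ; exact: LB.
have Lq' : L2 ((t^-1)%:C *: (f' (z + t *: v) - f' z) - g') by apply: LB => //; apply: LZ; exact: LB.
have -> : (t^-1)%:C *: (c *: f (z + t *: v) + f' (z + t *: v) - (c *: f z + f' z)) - (c *: g + g') =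
   c *: ((t^-1)%:C *: (f (z + t *: v) - f z) - g) + ((t^-1)%:C *: (f' (z + t *: v) - f' z) - g').
  rewrite [in RHS]scalerBr scalerA (mulrC c) -scalerA addrACA -opprD; congr (_ - _).
  by rewrite -scalerDr; congr (_ *: _); rewrite scalerBr addrACA -opprD.
apply: (le_trans (snormD SI (LZ c Lq) Lq')); rewrite lerD2r.
exact: (snorm_mulf oB bc Lq).
Qed.

Lemma L2_derivative_bounded_op T M f z v g : bounded_op T M -> 0 <= M ->
  (forall z, L2 (f z)) -> L2 g -> L2_derivative f z v g ->
  L2_derivative (fun z => T (f z)) z v (T g).
Proof.
move=> bT M0 Lf Lg d; have [TL Tl Tb] := bT.
apply: (@snorm_squeeze _ _ _ _ (fun t =>
   M * N ((t^-1)%:C *: (f (z + t *: v) - f z) - g))); last first.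
  rewrite -[X in _ --> X](_ : M * 0 = 0 :> R); last by rewrite mulr0.
  by apply: cvgMr; exact: d.
apply: nearW => t.
have Lq : L2 ((t^-1)%:C *: (f (z + t *: v) - f z) - g) by apply: LB => //; apply: LZ; exact: LB.
apply: le_trans (Tb _ Lq).
have Tsub a b : L2 a -> L2 b -> eqv (T a - T b) (T (a - b)).
  move=> La Lb; apply: eqv_sym; rewrite addrC -scaleN1r.
  by apply: (eqv_trans (Tl (-1) b a Lb La)); rewrite scaleN1r addrC; apply: eqv_refl; apply: LB; exact: TL.
have [L1 L2' e] : eqv ((t^-1)%:C *: (T (f (z + t *: v)) - T (f z)) - T g)
    (T ((t^-1)%:C *: (f (z + t *: v) - f z) - g)).
  apply: (@eqv_trans (T ((t^-1)%:C *: (f (z + t *: v) - f z)) - T g)); last first.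
    by apply: Tsub => //; apply: LZ; exact: LB.
  apply: eqvB; last by apply: eqv_refl; exact: TL.
  apply: (@eqv_trans ((t^-1)%:C *: T (f (z + t *: v) - f z))).
    by apply: eqvZ; exact: Tsub.
  by apply: eqv_sym; exact: (bounded_opZ _ bT (LB (Lf _) (Lf _))).
set x := (X in N X <= _); set y := (X in _ <= N X).
have -> : x = (x - y) + y by rewrite subrK.
by apply: (le_trans (snormD SI (LB L1 L2') L2')); rewrite e add0r.
Qed.

End L2_calculus.

(** * Norm estimates and derivatives for the phase *)

Section phase_calculus.
Context (R : realType) (B : set (R4 R)) (n : nat) (E : hermitian_bundle B n).
Context (oB : open B) (bB : bounded_set B).
Local Notation N := (snorm (@rip R B n E)).
Implicit Types (s g h : sec E) (f : R4 R -> sec E) (x y z w v : R4 R).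

Let SI := L2_semi_inner E oB.
Let LB s (t : sec E) (Ls : L2 s) (Lt : L2 t) : L2 (s - t) := submoduleB (L2_sub E oB) Ls Lt.
Let LD s (t : sec E) (Ls : L2 s) (Lt : L2 t) : L2 (s + t) := submoduleD (L2_sub E oB) Ls Lt.
Let LZ (c : R[i]) s (Ls : L2 s) : L2 (c *: s) := L2_scale oB c Ls.
Let Lm u M s (mu_ : multiplier B u M) (Ls : L2 s) : L2 (mulf u s) := L2_mulf oB mu_ Ls.

(** The uniform estimate on the bounded domain behind the operator bounds for [dphase] and for
    increments of the phase. In the constant, 4 counts the coordinates and [M'] bounds the norm on
    [B]. *)
Lemma angle_bound : exists2 C : R, 0 <= C & forall x y, B x -> `|angle y x| <= C * `|y|.
Proof.
have [M [_ bM]] := bB; pose M' := `|M| + 1.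
have xM x : B x -> `|x| <= M' by apply: bM; rewrite (le_lt_trans (ler_norm M))// ltrDl.
have M0 : 0 <= M' by rewrite addr_ge0.
have pi0 : 0 <= pi :> R by exact: pi_ge0.
have p1 (a b : R4 R) : `|a.1.1.1 * b.1.1.1| <= `|a| * `|b|.
  by rewrite normrM ler_pM// !prod_normE !le_max ?lexx ?orbT.
have p2 (a b : R4 R) : `|a.1.1.2 * b.1.1.2| <= `|a| * `|b|.
  by rewrite normrM ler_pM// !prod_normE !le_max ?lexx ?orbT.
have p3 (a b : R4 R) : `|a.1.2 * b.1.2| <= `|a| * `|b|.
  by rewrite normrM ler_pM// !prod_normE !le_max ?lexx ?orbT.
have p4 (a b : R4 R) : `|a.2 * b.2| <= `|a| * `|b|.
  by rewrite normrM ler_pM// !prod_normE !le_max ?lexx ?orbT.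
exists (2 * pi * (4 * M')) => [|x y Bx]; first by rewrite !mulr_ge0.
rewrite /angle normrM ger0_norm ?mulr_ge0// -[leRHS]mulrA ler_wpM2l ?mulr_ge0//.
apply: (@le_trans _ _ (4 * (`|y| * `|x|))); last first.
  by rewrite -mulrA ler_wpM2l// mulrC ler_wpM2r// xM.
have K (a b c d m : R) : `|a| <= m -> `|b| <= m -> `|c| <= m -> `|d| <= m ->
    `|a + b + c + d| <= 4 * m.
  rewrite !ler_norml => /andP[? ?] /andP[? ?] /andP[? ?] /andP[? ?].
  by apply/andP; split; lra.
by apply: K.
Qed.

(* The derivative of [phase] at the origin in the direction [w]. *)
Definition dphase w x : R[i] := 0 +i* (- angle w x).

Lemma ccont_dphase w x : ccont x (dphase w).
Proof.
split; first exact: cvg_cst.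
by apply: cvgN; exact: angle_continuous.
Qed.

Lemma angleZ (k : R) w x : angle (k *: w) x = k * angle w x.
Proof. by rewrite /angle /= /GRing.scale /=; ring. Qed.

Lemma dphase_multiplier w : exists2 M : R, 0 <= M & multiplier B (dphase w) M.
Proof.
have [C C0 hC] := angle_bound; have M0 : 0 <= C * `|w| by rewrite mulr_ge0.
exists (C * `|w|) => //; apply: (ccont_multiplier oB) => // [x _|x Bx].
  exact: ccont_dphase.
rewrite /normc2 /= expr0n/= add0r sqrrN -(real_normK (num_real (angle w x))).
by rewrite lerXn2r ?nnegrE// hC.
Qed.

Lemma phase_sub1_multiplier : exists2 C : R, 0 <= C &
  forall y, multiplier B (fun x => phase y x - 1) (C * `|y|).
Proof.
have [C C0 hC] := angle_bound; exists (2 * C) => [|y]; first by rewrite mulr_ge0.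
apply: (ccont_multiplier oB) => [x _||x Bx].
- by apply: ccontD; [exact: ccont_phase|exact: ccont_cst].
- by rewrite !mulr_ge0.
have -> : normc2 (phase y x - 1) = (cos (angle y x) - 1) ^+ 2 + sin (angle y x) ^+ 2.
  by rewrite /normc2 /phase /trig /=; ring.
have sq (a b : R) : `|a| <= b -> a ^+ 2 <= b ^+ 2.
  move=> ab; rewrite -(real_normK (num_real a)) lerXn2r// nnegrE//.
  exact: le_trans ab.
have h1 := sq _ _ (le_trans (abs_cosB1_le (angle y x)) (hC _ y Bx)).
have h2 := sq _ _ (le_trans (abs_sin_le (angle y x)) (hC _ y Bx)).
apply: (le_trans (lerD h1 h2)); rewrite -[2 * C * _]mulrA exprMn.
by have := sqr_ge0 (C * `|y|); lra.
Qed.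

(** Differentiability of the phase at the origin in operator norm. With [th = t * angle w x], the
    real and imaginary errors are, up to sign, [cos th - 1] and [sin th - th] over [t], both of
    order [t] uniformly on [B]. *)
Lemma phase_quotient_multiplier w : exists2 C : R, 0 <= C &
  forall t : R, t != 0 -> multiplier B
    (fun x => (t^-1)%:C * (phase (t *: w) x - 1) - dphase w x) (C * `|t|).
Proof.
have [C C0 hC] := angle_bound; exists (2 * (C * `|w|) ^+ 2) => [|t t0].
  by rewrite mulr_ge0 ?sqr_ge0.
apply: (ccont_multiplier oB) => [x _||x Bx].
- apply: (@eq_ccont _ _ (fun y => (t^-1)%:C * (phase (t *: w) y - 1) + (-1) * dphase w y)).
    by move=> y; rewrite mulN1r.
  apply: ccontD; apply: ccontM; try exact: ccont_cst; last exact: ccont_dphase.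
  by apply: ccontD; [exact: ccont_phase|exact: ccont_cst].
- by rewrite !mulr_ge0 ?sqr_ge0.
set a := angle w x; set th := t * a.
have -> : normc2 ((t^-1)%:C * (phase (t *: w) x - 1) - dphase w x) =
    (t^-1 * (cos th - 1)) ^+ 2 + (t^-1 * (sin th - th)) ^+ 2.
  by rewrite /normc2 /phase /trig /dphase /= angleZ -/a -/th /th; field.
have aC : `|a| <= C * `|w| by exact: hC.
have a2 : a ^+ 2 <= (C * `|w|) ^+ 2.
  by rewrite -(real_normK (num_real a)) lerXn2r// nnegrE// mulr_ge0.
set D := (C * `|w|) ^+ 2 in a2 *; have D0 : 0 <= D by rewrite sqr_ge0.
have sq (b : R) : `|b| <= th ^+ 2 -> (t^-1 * b) ^+ 2 <= (D * `|t|) ^+ 2.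
  move=> bt; rewrite -(real_normK (num_real (t^-1 * b))) lerXn2r ?nnegrE ?mulr_ge0//.
  rewrite normrM normfV mulrC ler_pdivrMr ?normr_gt0// (le_trans bt)//.
  rewrite /th exprMn -(real_normK (num_real t)) [leLHS]mulrC.
  have -> : D * `|t| * `|t| = D * `|t| ^+ 2 by ring.
  by rewrite ler_wpM2r// sqr_ge0.
apply: (le_trans (lerD (sq _ (abs_cosB1_le_sq th)) (sq _ (abs_sinB_le_sq th)))).
by rewrite -[2 * D * _]mulrA (exprMn 2); have := sqr_ge0 (D * `|t|); lra.
Qed.

(** The product rule for a phase acting on a curve. The factor [k] is taken to be 1 or -1, to leave
    the trivialization or to enter it. *)
Lemma L2_derivative_phase (k : R) f z v g : (forall z, L2 (f z)) -> L2 g ->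
  L2_derivative f z v g ->
  L2_derivative (fun z => mulf (phase (k *: z)) (f z)) z v
    (mulf (phase (k *: z)) (g + mulf (dphase (k *: v)) (f z))).
Proof.
move=> Lf Lg d; set w := k *: v.
have [C1 C10 m1] := phase_sub1_multiplier.
have [C2 C20 m2] := phase_quotient_multiplier w.
apply: (@snorm_squeeze _ _ _ _ _ _ _ _ (fun t => N ((t^-1)%:C *: (f (z + t *: v) - f z) - g) +
    (C1 * `|w| * N g + C2 * N (f z)) * `|t|)); last first.
  rewrite -[X in _ --> X](_ : 0 + (C1 * `|w| * N g + C2 * N (f z)) * `|0 : R| = 0 :> R); last first.
    by rewrite normr0 mulr0 addr0.
  apply: cvgD; first exact: d.
  by apply: cvgMr; apply: cvg_within_filter; exact: norm_continuous.
near=> t; have t0 : t != 0 by near: t; exact: nbhs_dnbhs_neq.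
have Lq : L2 ((t^-1)%:C *: (f (z + t *: v) - f z) - g) by apply: LB => //; apply: LZ; exact: LB.
have Lr := Lm (m1 (t *: w)) Lg; have Lr' := Lm (m2 t t0) (Lf z).
(* Once the unitary factor [phase (k *: z)] is taken out, the error splits into the error for [f],
   the variation of the phase on [g], and the quotient error of the phase on [f z]. *)
have -> : (t^-1)%:C *: (mulf (phase (k *: (z + t *: v))) (f (z + t *: v)) - mulf (phase (k *: z)) (f z)) -
    mulf (phase (k *: z)) (g + mulf (dphase w) (f z)) =
  mulf (phase (k *: z)) (mulf (phase (t *: w)) ((t^-1)%:C *: (f (z + t *: v) - f z) - g) +
    (mulf (fun x => phase (t *: w) x - 1) g +
     mulf (fun x => (t^-1)%:C * (phase (t *: w) x - 1) - dphase w x) (f z))).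
  apply/funext => i; apply/funext => x; apply/matrixP => a b.
  have -> : phase (k *: (z + t *: v)) = (fun x => phase (k *: z) x * phase (t *: w) x).
    by apply/funext => y; rewrite scalerDr phaseD /w !scalerA (mulrC k).
  by rewrite /mulf !mxE; ring.
rewrite snorm_phase.
apply: (le_trans (snormD SI _ (LD Lr Lr'))).
  exact: (Lm (phase_multiplier oB _)).
rewrite snorm_phase lerD2l; apply: (le_trans (snormD SI Lr Lr')).
have b1 := snorm_mulf oB (m1 (t *: w)) Lg; have b2 := snorm_mulf oB (m2 t t0) (Lf z).
apply: (le_trans (lerD b1 b2)); rewrite normrZ le_eqVlt; apply/orP; left; apply/eqP; ring.
Unshelve. all: by end_near.
Qed.

Lemma L2_continuous_phase s z : L2 s ->
  (fun w => N (mulf (phase w) s - mulf (phase z) s)) @ z --> (0 : R).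
Proof.
move=> Ls; have [C C0 m1] := phase_sub1_multiplier.
apply: (@snorm_squeeze _ _ _ _ _ _ _ _ (fun w => C * `|w - z| * N s)); last first.
  rewrite -[X in _ --> X](_ : C * `|z - z| * N s = 0 :> R); last first.
    by rewrite subrr normr0 mulr0 mul0r.
  apply: cvgMl; apply: cvgMr; apply: cvg_norm; apply: cvgB; [exact: cvg_id|exact: cvg_cst].
apply: nearW => w.
have -> : mulf (phase w) s - mulf (phase z) s =
    mulf (phase z) (mulf (fun x => phase (w - z) x - 1) s).
  apply/funext => i; apply/funext => x; apply/matrixP => a b.
  have -> : phase w = (fun x => phase z x * phase (w - z) x).
    by apply/funext => y; rewrite -phaseD addrCA subrr addr0.
  by rewrite /mulf !mxE; ring.
by rewrite snorm_phase; exact: (snorm_mulf oB (m1 (w - z)) Ls).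
Qed.

(* The curves [z |-> phase z . s] are smooth in L^2 although multiplication by
   [phase z] is an operator-valued function: all coordinates are bounded on [B]. *)
Lemma L2Ck_phase k s : L2 s -> L2Ck k (fun z => mulf (phase z) s).
Proof.
elim: k s => [|k IH] s Ls /=.
  split=> // z; first exact: (Lm (phase_multiplier oB _)).
  apply/L2normsq_cvg0 => //; last exact: L2_continuous_phase.
  by move=> w; apply: LB; exact: (Lm (phase_multiplier oB _)).
split=> [z|z|nu]; first exact: (Lm (phase_multiplier oB _)).
  apply/L2normsq_cvg0 => //; last exact: L2_continuous_phase.
  by move=> w; apply: LB; exact: (Lm (phase_multiplier oB _)).
have [M M0 mM] := dphase_multiplier (basis4 R nu).
have Lms := Lm mM Ls.
have Lp w : L2 (mulf (phase w) s) := Lm (phase_multiplier oB w) Ls.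
have Ld w : L2 (mulf (phase w) (mulf (dphase (basis4 R nu)) s)) :=
  Lm (phase_multiplier oB w) Lms.
(* The derivative is again the phase applied to a fixed L^2 section, so the induction hypothesis
   covers it. *)
exists (fun z => mulf (phase z) (mulf (dphase (basis4 R nu)) s)); split; last exact: IH.
move=> z; apply: (proj2 (is_L2pdE oB nu z _ Lp)); split; first exact: Ld.
have d0 : L2_derivative (fun _ : R4 R => s) z (basis4 R nu) 0.
  rewrite /L2_derivative (_ : (fun t => _) = fun=> 0); first exact: cvg_cst.
  by apply/funext => t; rewrite subrr scaler0 subrr (snorm0 SI).
have d1 := L2_derivative_phase 1 (fun _ => Ls) (L2_0 E) d0.
have e : (fun z => mulf (phase (1 *: z)) s) = (fun z => mulf (phase z) s).
  by apply/funext => w; rewrite scale1r.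
by rewrite e (scale1r z) (scale1r (basis4 R nu)) add0r in d1.
Qed.

End phase_calculus.

(** * Orthogonal projections as bounded operators *)

Section projections.
Context (R : realType) (B : set (R4 R)) (n : nat) (E : hermitian_bundle B n).
Context (oB : open B).
Local Notation N := (snorm (@rip R B n E)).
Implicit Types (s g h p : sec E) (f : R4 R -> sec E) (x y z w v : R4 R).

Let SI := L2_semi_inner E oB.
Let LB s (t : sec E) (Ls : L2 s) (Lt : L2 t) : L2 (s - t) := submoduleB (L2_sub E oB) Ls Lt.
Let LD s (t : sec E) (Ls : L2 s) (Lt : L2 t) : L2 (s + t) := submoduleD (L2_sub E oB) Ls Lt.
Let LZ (c : R[i]) s (Ls : L2 s) : L2 (c *: s) := L2_scale oB c Ls.

Lemma rip_scale (c : R[i]) s h : rip (c *: s) h = rip s (c^* *: h).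
Proof. by apply: eq_Rintegral => x _; rewrite /density !repZ fre_scale. Qed.

Lemma rip_eqv0 s (t h : sec E) : eqv s t -> L2 h -> rip s h = rip t h.
Proof.
move=> [Ls Lt e] Lh; apply/eqP; rewrite -subr_eq0 -(si_Bl SI Ls Lt Lh) -normr_le0.
by apply: (le_trans (si_CauchySchwarz SI (LB Ls Lt) Lh)); rewrite e mul0r.
Qed.

Section complete_submodule.
Context (H : set (sec E)) (HL : H `<=` (@L2 R B n E : set (sec E))).
Context (sH : submodule H) (cH : rapidly_complete (@rip R B n E) H).
Local Notation P := (Defs.proj H).

Lemma proj_eqv s p : L2 s -> H p -> (forall h, H h -> rip (s - p) h = 0) ->
  eqv (P s) p.
Proof.
move=> Ls Hp op; have [Hq e] := projP oB HL sH Ls Hp op.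
by split; [exact: HL|exact: HL|].
Qed.

Lemma proj_mem s : L2 s -> H (P s).
Proof.
move=> Ls; have [p [Hp op]] := projection_exists SI HL sH cH Ls.
by have [] := projP oB HL sH Ls Hp op.
Qed.

Lemma proj_orth s h : L2 s -> H h -> rip (s - P s) h = 0.
Proof.
move=> Ls Hh; have [p [Hp op]] := projection_exists SI HL sH cH Ls.
have e := proj_eqv Ls Hp op; have Lh := HL Hh.
have LP := HL (proj_mem Ls); have Lp := HL Hp.
rewrite (si_Bl SI Ls LP Lh) (rip_eqv0 e Lh) -(si_Bl SI Ls Lp Lh).
exact: op.
Qed.

Lemma proj_id h : H h -> eqv (P h) h.
Proof.
move=> Hh; have Lh := HL Hh; apply: proj_eqv => // k /HL Lk.
by rewrite subrr (si_0l SI Lk).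
Qed.

(** Linearity follows from uniqueness of the projection up to [eqv]; the bound from
    [N (P s) ^ 2 = rip s (P s)] and Cauchy-Schwarz. *)
Lemma proj_bounded_op : bounded_op P 1.
Proof.
split=> [s Ls|c s t Ls Lt|s Ls]; first exact: HL (proj_mem Ls).
- have Ps := proj_mem Ls; have Pt := proj_mem Lt.
  apply: proj_eqv; [exact: LD (LZ c Ls) Lt|by apply: sH.2|move=> h Hh].
  have -> : c *: s + t - (c *: P s + P t) = c *: (s - P s) + (t - P t).
    by rewrite scalerBr opprD addrACA.
  have Lu := LB Ls (HL Ps); have Lw := LB Lt (HL Pt).
  rewrite (si_Dl SI (LZ c Lu) Lw (HL Hh)) rip_scale (proj_orth Ls) ?(proj_orth Lt)//.
    by rewrite addr0.
  exact: submoduleZ.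
- have Ps := proj_mem Ls; have LP := HL Ps; rewrite mul1r.
  have e : N (P s) ^+ 2 = rip s (P s).
    rewrite (snorm_sq SI LP); apply/eqP; rewrite eq_sym -subr_eq0 -(si_Bl SI Ls LP LP).
    by rewrite proj_orth.
  have := si_CauchySchwarz SI Ls LP; rewrite -e ger0_norm ?sqr_ge0// expr2.
  have [->|] := eqVneq (N (P s)) 0; first by rewrite snorm_ge0.
  move=> n0; rewrite ler_pM2r// lt_neqAle eq_sym n0; exact: snorm_ge0.
Qed.

End complete_submodule.
End projections.

(** * Scalar derivatives of pairings with a fixed section *)

Lemma cvg_of_bound (R : realType) (T : Type) (F : set_system T) (FF : Filter F)
    (a b : T -> R) (l K : R) :
  b @ F --> (0 : R) -> (forall x, `|a x - l| <= b x * K) -> a @ F --> l.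
Proof.
move=> b0 ab; apply/cvgrPdist_le => e e0.
have K0 : 0 < `|K| + 1 by rewrite ltr_pwDr.
have /cvgrPdist_le/(_ _ (divr_gt0 e0 K0)) := b0; apply: filterS => x.
rewrite sub0r normrN => bx; rewrite distrC; apply: (le_trans (ab x)).
apply: (le_trans (ler_norm _)); rewrite normrM.
apply: (@le_trans _ _ (`|b x| * (`|K| + 1))); first by rewrite ler_wpM2l// lerDl.
by rewrite -ler_pdivlMr.
Qed.

Lemma is_derive_of_bound (R : realType) (f : R4 R -> R) (z v : R4 R) (l : R)
    (b : R -> R) (K : R) : b @ 0^' --> (0 : R) ->
  (forall t : R, `|(f (t *: v + z) - f z) * t^-1 - l| <= b t * K) -> is_derive z v f l.
Proof.
move=> b0 ab.
have cv : (fun t : R => t^-1 *: ((f \o shift z) (t *: v) - f z)) @ 0^' --> l.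
  apply: (cvg_of_bound _ b0) => t; rewrite /= [t^-1 *: _]mulrC; exact: ab.
apply: DeriveDef; first by apply/cvg_ex; exists l.
exact: (cvg_lim (@Rhausdorff R) cv).
Qed.

Section weak_derivatives.
Context (R : realType) (B : set (R4 R)) (n : nat) (E : hermitian_bundle B n).
Context (oB : open B).
Local Notation N := (snorm (@rip R B n E)).
Implicit Types (s g h p : sec E) (f : R4 R -> sec E) (x y z w v : R4 R).

Let SI := L2_semi_inner E oB.
Let LB s (t : sec E) (Ls : L2 s) (Lt : L2 t) : L2 (s - t) := submoduleB (L2_sub E oB) Ls Lt.
Let LZ (c : R[i]) s (Ls : L2 s) : L2 (c *: s) := L2_scale oB c Ls.

Lemma is_derive_rip f z v g h : (forall z, L2 (f z)) -> L2 g -> L2 h ->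
  L2_derivative f z v g -> is_derive z v (fun y => rip (f y) h) (rip g h).
Proof.
move=> Lf Lg Lh d.
apply: (is_derive_of_bound d (K := N h)) => t.
have Lq : L2 ((t^-1)%:C *: (f (z + t *: v) - f z)) by apply: LZ; exact: LB.
rewrite [t *: v + z]addrC mulrC -(si_Bl SI (Lf _) (Lf _) Lh) -(si_Zl SI _ (LB (Lf _) (Lf _)) Lh).
by rewrite -(si_Bl SI Lq Lg Lh); exact: (si_CauchySchwarz SI (LB Lq Lg) Lh).
Qed.

Lemma continuous_rip f z h : (forall z, L2 (f z)) -> L2 h ->
  (fun w => N (f w - f z)) @ z --> (0 : R) -> {for z, continuous (fun y => rip (f y) h)}.
Proof.
move=> Lf Lh c; apply: (cvg_of_bound _ c (K := N h)) => w.
by rewrite -(si_Bl SI (Lf _) (Lf _) Lh); exact: (si_CauchySchwarz SI (LB _ _) Lh).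
Qed.

End weak_derivatives.

(** * The curvature of the Nahm connection *)

Lemma add_shuffle1 (V : zmodType) (x a b c : V) : x + a + (b + c) = x + (a + b + c).
Proof. by rewrite !addrA. Qed.

Lemma add_shuffle2 (V : zmodType) (x a b c : V) : x + b + (a + c) = x + (a + b + c).
Proof. by rewrite -add_shuffle1 -!addrA; congr (_ + _); rewrite addrCA. Qed.

(** The shape of the commutator of two covariant derivatives: [x] and [y] stand for second
    derivatives, [a] and [b] for the mixed terms common to both orders, [c] and [d] for iterated
    connection forms. *)
Lemma add_shuffle3 (V : zmodType) (x y a b c d : V) :
  x + (a + (b + c)) - (y + (b + (a + d))) = (x - y) + (c - d).
Proof.
rewrite opprD addrACA; congr (_ + _); rewrite [b + (a + d)]addrCA.
by rewrite opprD addrACA subrr add0r opprD addrACA subrr add0r.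
Qed.

Section nahm_curvature.
Context (R : realType) (B : set (R4 R)) (n : nat) (E : hermitian_bundle B n).
Context (oB : open B) (bB : bounded_set B).
Context (S : spinors R) (A : potential E) (cA : is_connection A).
Local Notation N := (snorm (@rip R B n E)).
Local Notation H := (ker_dirac S A).
Local Notation P := (Defs.proj (ker_dirac S A)).
Local Notation e_ := (basis4 R).
Implicit Types (s g h p : sec E) (f : R4 R -> sec E) (x y z w v : R4 R) (nu mu : 'I_4).

Let SI := L2_semi_inner E oB.
Let LB s (t : sec E) (Ls : L2 s) (Lt : L2 t) : L2 (s - t) := submoduleB (L2_sub E oB) Ls Lt.
Let LD s (t : sec E) (Ls : L2 s) (Lt : L2 t) : L2 (s + t) := submoduleD (L2_sub E oB) Ls Lt.
Let HL : H `<=` (@L2 R B n E : set (sec E)) := @ker_dirac_L2 R B n E S A.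
Let sH : submodule H := ker_dirac_submodule oB S cA bB.
Let cH : rapidly_complete (@rip R B n E) H := ker_dirac_complete oB cA bB.
Let bP : bounded_op P 1 := proj_bounded_op oB HL sH cH.

Let Lph z s (Ls : L2 s) : L2 (mulf (phase z) s) := L2_mulf oB (phase_multiplier oB z) Ls.
Let ephase z s (t : sec E) (st : eqv s t) : eqv (mulf (phase z) s) (mulf (phase z) t) :=
  bounded_op_congr oB (multiplier_bounded_op E oB (phase_multiplier oB z)) st.
Let refl s (Ls : L2 s) : eqv s s := eqv_refl oB Ls.

Let eqv_sub0 s (t : sec E) : eqv s t -> eqv (s - t) 0.
Proof.
move=> e; have [_ Lt _] := e; have e' := eqvB oB e (refl Lt).
by rewrite (subrr t) in e'.
Qed.

Lemma nahm_fibre_L2 z : nahm_fibre S A z `<=` (@L2 R B n E : set (sec E)).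
Proof. by move=> s []. Qed.

Lemma nahm_fibre_submodule z : submodule (nahm_fibre S A z : set (sec E)).
Proof.
split.
  apply/(nahm_fibreP oB); have -> : mulf (phase (- z)) 0 = 0 :> sec E.
    by apply/funext => i; apply/funext => x; rewrite /mulf scaler0.
  exact: sH.1.
move=> a u v /(nahm_fibreP oB) Hu /(nahm_fibreP oB) Hv; apply/(nahm_fibreP oB).
by rewrite mulfP; exact: sH.2.
Qed.

(** The conjugate of [P] by the phase is orthogonal to the fibre at [z] in the required sense by
    unitarity, and [projP] then identifies it with the chosen projection. *)
Lemma proj_nahm_fibre z s : L2 s ->
  nahm_fibre S A z (Defs.proj (nahm_fibre S A z) s) /\
  eqv (Defs.proj (nahm_fibre S A z) s) (mulf (phase z) (P (mulf (phase (- z)) s))).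
Proof.
move=> Ls; have Ls' := Lph (- z) Ls; have Hp := proj_mem oB HL sH cH Ls'.
have Fp : nahm_fibre S A z (mulf (phase z) (P (mulf (phase (- z)) s))).
  by apply/(nahm_fibreP oB); rewrite mulf_phaseNK.
have op h : nahm_fibre S A z h ->
    rip (s - mulf (phase z) (P (mulf (phase (- z)) s))) h = 0.
  move=> /(nahm_fibreP oB) Hh; rewrite -(rip_phase (- z)) mulfB mulf_phaseNK.
  exact: (proj_orth oB HL sH cH Ls' Hh).
have := projP oB (@nahm_fibre_L2 z) (nahm_fibre_submodule z) Ls Fp op.
move=> [Fq e]; split; first exact: Fq.
by split; [exact: (nahm_fibre_L2 Fq)|exact: (nahm_fibre_L2 Fp)|exact: e].
Qed.

(** Difference quotients stay in [H], which is closed. Hence [P] fixes the derivative of a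
    trivialized section, and only the term from the phase is compressed. *)
Lemma L2_derivative_mem f z v g : (forall z, H (f z)) -> L2 g ->
  L2_derivative f z v g -> H g.
Proof.
move=> Hf Lg d; apply: (ker_dirac_closed oB cA bB Lg) => e e0.
have /cvgrPdist_le/(_ e e0) dn := d.
have [t /=] := @filter_ex _ _ (Proper_dnbhs_numFieldType (0 : R)) _ dn.
rewrite sub0r normrN (ger0_norm (snorm_ge0 _ _)) => te.
exists ((t^-1)%:C *: (f (z + t *: v) - f z)); split; last exact: te.
exact: (submoduleZ _ sH (submoduleB sH (Hf _) (Hf _))).
Qed.

(* In the trivialisation [s = phase (- z) . f] of the Nahm bundle by the constant
   space [H], the connection form is the compression of [dphase (e_ nu)] to [H]. *)
Definition conn_form nu s : sec E := P (mulf (dphase (e_ nu)) s).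

Lemma conn_form_bounded nu : exists2 M : R, 0 <= M & bounded_op (conn_form nu) M.
Proof.
have [M M0 mM] := dphase_multiplier oB bB (e_ nu); exists (1 * M); first by rewrite mul1r.
exact: (bounded_op_comp oB bP (multiplier_bounded_op E oB mM) ler01).
Qed.

Let L2_conn nu s (Ls : L2 s) : L2 (conn_form nu s).
Proof. by have [M _ [TL _ _]] := conn_form_bounded nu; exact: (TL s Ls). Qed.

Let connD nu s (t : sec E) : L2 s -> L2 t ->
  eqv (conn_form nu (s + t)) (conn_form nu s + conn_form nu t).
Proof.
have [M _ [_ Tl _]] := conn_form_bounded nu => Ls Lt.
by have e := Tl 1 s t Ls Lt; rewrite (scale1r s) (scale1r (conn_form nu s)) in e.
Qed.

Let H_conn nu s : L2 s -> H (conn_form nu s).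
Proof.
move=> Ls; have [M M0 mM] := dphase_multiplier oB bB (e_ nu).
apply: (proj_mem oB HL sH cH); exact: (L2_mulf oB mM).
Qed.

(** [f] is required to match its trivialization only up to [eqv], so that the lemma applies a second
    time to [nahm_covd] itself, whose values are known only almost everywhere. *)
Lemma nahm_covdE nu f (s : R4 R -> sec E) z s' :
  (forall z, eqv (f z) (mulf (phase z) (s z))) -> (forall z, H (s z)) -> L2 s' ->
  L2_derivative s z (e_ nu) s' ->
  nahm_fibre S A z (nahm_covd S A nu f z) /\
  eqv (nahm_covd S A nu f z) (mulf (phase z) (s' + conn_form nu (s z))).
Proof.
move=> fs Hs Ls' ds; have Ls w := HL (Hs w).
have Hs' : H s' := L2_derivative_mem Hs Ls' ds.
have Lf w : L2 (f w) by have [] := fs w.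
have [M M0 mM] := dphase_multiplier oB bB (e_ nu).
have Lms := L2_mulf oB mM (Ls z).
pose g := mulf (phase z) (s' + mulf (dphase (e_ nu)) (s z)).
have Lg : L2 g := Lph z (LD Ls' Lms).
have dg : L2_derivative f z (e_ nu) g.
  have d1 := L2_derivative_phase oB bB 1 Ls Ls' ds.
  have e : (fun z => mulf (phase (1 *: z)) (s z)) = (fun z => mulf (phase z) (s z)).
    by apply/funext => w; rewrite scale1r.
  rewrite e (scale1r z) (scale1r (e_ nu)) in d1.
  apply: (L2_derivative_eqv oB _ (refl Lg) d1) => w.
  exact: (eqv_sym oB (fs w)).
(* [L2pd] is a choice with a default: exhibiting [g] makes it a genuine derivative, and uniqueness
   then compares it with [g]. *)
have pd : is_L2pd nu f z (L2pd nu f z).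
  by apply: (@xgetPex _ 0 [set g | is_L2pd nu f z g]); exists g; apply: (proj2 (is_L2pdE oB nu z _ Lf)).
have [Lpd dpd] := proj1 (is_L2pdE oB nu z _ Lf) pd.
have epd := L2_derivative_unique oB Lf Lpd Lg dpd dg.
have [Fp ep] := proj_nahm_fibre z Lpd.
split; first exact: Fp.
apply: (eqv_trans oB ep); apply: ephase.
have e1 := ephase (- z) epd; rewrite /g mulf_phaseNK in e1.
apply: (eqv_trans oB (bounded_op_congr oB bP e1)).
have [_ Pl _] := bP; have e2 := Pl 1 s' _ Ls' Lms.
rewrite (scale1r s') (scale1r (P s')) in e2.
apply: (eqv_trans oB e2); apply: (eqvD oB); first exact: (proj_id oB HL sH Hs').
exact: (refl (L2_conn nu (Ls z))).
Qed.

Section curvature.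
Context (f : R4 R -> sec E) (nf : nahm_section S A f).

Let Lf z : L2 (f z).
Proof. by have [[]] := nf.1 z. Qed.

Let pd1 : exists g : 'I_4 -> R4 R -> sec E, forall nu,
  (forall z, is_L2pd nu f z (g nu z)) /\ L2Ck 1 (g nu).
Proof.
have ex nu : exists g : R4 R -> sec E, (forall z, is_L2pd nu f z (g z)) /\ L2Ck 1 g.
  by have [_ _ h] := nf.2 2%N; exact: (h nu).
by have [g gP] := choice ex; exists g.
Qed.

Lemma nahm_section_derivatives : exists (g : 'I_4 -> R4 R -> sec E)
    (g2 : 'I_4 -> 'I_4 -> R4 R -> sec E),
  [/\ (forall nu z, L2 (g nu z)), (forall nu z, L2_derivative f z (e_ nu) (g nu z)),
      (forall mu nu z, L2 (g2 mu nu z)),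
      (forall mu nu z, L2_derivative (g nu) z (e_ mu) (g2 mu nu z)) &
      (forall mu nu z, (fun w => N (g2 mu nu w - g2 mu nu z)) @ z --> (0 : R))].
Proof.
have [g gP] := pd1.
have Lg nu z : L2 (g nu z) by have [_ [h _ _]] := gP nu; exact: h.
have /choice[g2 g2P] : forall q : 'I_4 * 'I_4, exists k : R4 R -> sec E,
    (forall z, is_L2pd q.1 (g q.2) z (k z)) /\ L2Ck 0 k.
  by move=> [mu nu]; have [_ [_ _ h]] := gP nu; exact: h.
have L2g mu nu z : L2 (g2 (mu, nu) z) by have [_ [h _ _]] := g2P (mu, nu); exact: h.
exists g, (fun mu nu => g2 (mu, nu)); split; [exact: Lg|move=> nu z|exact: L2g|move=> mu nu z|move=> mu nu z].
- by have [h _] := gP nu; have [] := proj1 (is_L2pdE oB nu z (g nu z) Lf) (h z).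
- have [h _] := g2P (mu, nu).
  by have [] := proj1 (is_L2pdE oB mu z (g2 (mu, nu) z) (Lg nu)) (h z).
- have [_ [_ h _]] := g2P (mu, nu).
  have Lq w : L2 (g2 (mu, nu) w - g2 (mu, nu) z) by exact: LB.
  exact: (proj1 (L2normsq_cvg0 oB _ Lq) (h z)).
Qed.

(** Both mixed derivatives are paired with their own difference [t]; scalar symmetry then gives
    [rip t t = 0]. *)
Lemma L2_derivatives_symmetric (g : 'I_4 -> R4 R -> sec E)
    (g2 : 'I_4 -> 'I_4 -> R4 R -> sec E) mu nu z :
  (forall nu z, L2 (g nu z)) -> (forall nu z, L2_derivative f z (e_ nu) (g nu z)) ->
  (forall mu nu z, L2 (g2 mu nu z)) ->
  (forall mu nu z, L2_derivative (g nu) z (e_ mu) (g2 mu nu z)) ->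
  (forall mu nu z, (fun w => N (g2 mu nu w - g2 mu nu z)) @ z --> (0 : R)) ->
  eqv (g2 mu nu z) (g2 nu mu z).
Proof.
move=> Lg dg Lg2 dg2 cg2; split; [exact: Lg2|exact: Lg2|].
set t := g2 mu nu z - g2 nu mu z; have Lt : L2 t by exact: LB.
have := @second_derivatives_symmetric R (fun z => rip (f z) t) (fun z => rip (g nu z) t)
  (fun z => rip (g mu z) t) (fun z => rip (g2 nu mu z) t) (fun z => rip (g2 mu nu z) t)
  (e_ nu) (e_ mu) z (fun w => is_derive_rip oB Lf (Lg nu w) Lt (dg nu w))
  (fun w => is_derive_rip oB Lf (Lg mu w) Lt (dg mu w))
  (fun w => is_derive_rip oB (Lg nu) (Lg2 mu nu w) Lt (dg2 mu nu w))
  (fun w => is_derive_rip oB (Lg mu) (Lg2 nu mu w) Lt (dg2 nu mu w))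
  (continuous_rip oB (Lg2 nu mu) Lt (cg2 nu mu z))
  (continuous_rip oB (Lg2 mu nu) Lt (cg2 mu nu z)).
move=> e; rewrite /snorm -/t {1}/t (si_Bl SI (Lg2 mu nu z) (Lg2 nu mu z) Lt).
by rewrite e subrr sqrtr0.
Qed.

Lemma nahm_curvature_conn z mu nu :
  let s := mulf (phase (- z)) (f z) in
  eqv (nahm_curvature S A f z mu nu)
    (mulf (phase z) (conn_form mu (conn_form nu s) - conn_form nu (conn_form mu s))).
Proof.
move=> s0.
have [g [g2 [Lg dg Lg2 dg2 cg2]]] := nahm_section_derivatives.
pose s z := mulf (phase (- z)) (f z).
have Hs w : H (s w) := proj1 (nahm_fibreP oB S A w (f w)) (nf.1 w).
have Ls w : L2 (s w) := HL (Hs w).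
(* [dn] is the term from differentiating [phase (- z)]. Thus [k] and [k2] are the first and second
   derivatives of [s] before the phase is applied, and [s1] and [s2] the derivatives themselves. *)
pose dn nu := @mulf R B n E (dphase (- e_ nu)).
have bdn nu' : exists2 M : R, 0 <= M & bounded_op (dn nu') M.
  have [M M0 mM] := dphase_multiplier oB bB (- e_ nu'); exists M => //.
  exact: (multiplier_bounded_op E oB mM).
have Ldn nu' (t : sec E) : L2 t -> L2 (dn nu' t).
  by move=> Lt; have [M _ [TL _ _]] := bdn nu'; exact: (TL t Lt).
pose k nu z := g nu z + dn nu (f z).
have Lk nu' w : L2 (k nu' w).
  exact: LD (Lg _ _) (Ldn _ _ (Lf _)).
pose k2 mu nu z := (g2 mu nu z + dn nu (g mu z)) + dn mu (k nu z).
have Lk2 m' nu' w : L2 (k2 m' nu' w).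
  exact: LD (LD (Lg2 _ _ _) (Ldn _ _ (Lg _ _))) (Ldn _ _ (Lk _ _)).
have neg (F : R4 R -> sec E) w v' G : (forall z, L2 (F z)) -> L2 G ->
    L2_derivative F w v' G -> L2_derivative (fun z => mulf (phase (- z)) (F z)) w v'
      (mulf (phase (- w)) (G + mulf (dphase (- v')) (F w))).
  move=> LF LG dF; have := L2_derivative_phase oB bB (-1) LF LG dF.
  have -> : (fun z => mulf (phase (-1 *: z)) (F z)) = (fun z => mulf (phase (- z)) (F z)).
    by apply/funext => y; rewrite scaleN1r.
  by rewrite (scaleN1r w) (scaleN1r v').
pose s1 nu z := mulf (phase (- z)) (k nu z).
have Ls1 nu' w : L2 (s1 nu' w) := Lph _ (Lk nu' w).
have ds nu' w : L2_derivative s w (e_ nu') (s1 nu' w) :=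
  neg f w (e_ nu') _ Lf (Lg nu' w) (dg nu' w).
have Hs1 nu' w : H (s1 nu' w) := L2_derivative_mem Hs (Ls1 nu' w) (ds nu' w).
pose s2 mu nu z := mulf (phase (- z)) (k2 mu nu z).
have Ls2 m' nu' w : L2 (s2 m' nu' w) := Lph _ (Lk2 m' nu' w).
have ds1 m' nu' w : L2_derivative (s1 nu') w (e_ m') (s2 m' nu' w).
  apply: (neg (k nu') w (e_ m') _ (Lk nu')); first exact: LD (Lg2 _ _ _) (Ldn _ _ (Lg _ _)).
  have [M M0 bM] := bdn nu'.
  have d1 := L2_derivative_bounded_op oB bM M0 Lf (Lg m' w) (dg m' w).
  have d2 := L2_derivativeP oB 1 (Lg nu') (fun w => Ldn nu' _ (Lf w)) (Lg2 m' nu' w)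
    (Ldn nu' _ (Lg m' w)) (dg2 m' nu' w) d1.
  have e : (fun z => 1 *: g nu' z + dn nu' (f z)) = k nu'.
    by apply/funext => y; rewrite (scale1r (g nu' y)).
  by rewrite e (scale1r (g2 m' nu' w)) in d2.
(* The first covariant derivative in the trivialization; it stays in [H], so a second one can be
   taken. *)
pose h nu z := s1 nu z + conn_form nu (s z).
have fs w : eqv (f w) (mulf (phase w) (s w)) by rewrite mulf_phaseK; exact: (refl (Lf w)).
have cov1 nu' w : eqv (nahm_covd S A nu' f w) (mulf (phase w) (h nu' w)).
  by have [_ e] := nahm_covdE fs Hs (Ls1 nu' w) (ds nu' w); exact: e.
have Hh nu' w : H (h nu' w) := submoduleD sH (Hs1 nu' w) (H_conn nu' (Ls w)).
have LC nu' (t : sec E) : L2 t -> L2 (conn_form nu' t) by move=> Lt; exact: (L2_conn nu' Lt).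
have cov2 m' nu' : eqv (nahm_covd S A m' (nahm_covd S A nu' f) z)
    (mulf (phase z) (s2 m' nu' z + (conn_form nu' (s1 m' z) +
      (conn_form m' (s1 nu' z) + conn_form m' (conn_form nu' (s z)))))).
  have [M M0 bM] := conn_form_bounded nu'.
  have d1 := L2_derivative_bounded_op oB bM M0 Ls (Ls1 m' z) (ds m' z).
  have d2 := L2_derivativeP oB 1 (Ls1 nu') (fun w => LC nu' _ (Ls w)) (Ls2 m' nu' z)
    (LC nu' _ (Ls1 m' z)) (ds1 m' nu' z) d1.
  have eh : (fun z => 1 *: s1 nu' z + conn_form nu' (s z)) = h nu'.
    by apply/funext => y; rewrite (scale1r (s1 nu' y)).
  rewrite eh (scale1r (s2 m' nu' z)) in d2.
  have Ld : L2 (s2 m' nu' z + conn_form nu' (s1 m' z)).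
    exact: LD (Ls2 _ _ _) (LC _ _ (Ls1 _ _)).
  have [_ e] := nahm_covdE (cov1 nu') (Hh nu') Ld d2.
  apply: (eqv_trans oB e); apply: ephase; rewrite addrA; apply: (eqvD oB).
    exact: (refl Ld).
  exact: connD (Ls1 _ _) (LC _ _ (Ls z)).
(* Symmetry is inherited from the mixed derivatives of [f]: the other terms are symmetric in the two
   indices because multiplication operators commute. *)
have e12 : eqv (s2 mu nu z) (s2 nu mu z).
  apply: ephase; have e := L2_derivatives_symmetric mu nu z Lg dg Lg2 dg2 cg2.
  have -> : k2 mu nu z = g2 mu nu z + (dn nu (g mu z) + dn mu (g nu z) + dn mu (dn nu (f z))).
    by rewrite /k2 /k /dn mulfD; exact: add_shuffle1.
  have -> : k2 nu mu z = g2 nu mu z + (dn nu (g mu z) + dn mu (g nu z) + dn mu (dn nu (f z))).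
    have -> : dn mu (dn nu (f z)) = dn nu (dn mu (f z)).
      by rewrite /dn !mulf_mulf; congr mulf; apply/funext => y; rewrite mulrC.
    by rewrite /k2 /k {2}/dn mulfD; exact: add_shuffle2.
  apply: (eqvD oB e); apply: refl.
  exact: LD (LD (Ldn _ _ (Lg _ _)) (Ldn _ _ (Lg _ _))) (Ldn _ _ (Ldn _ _ (Lf _))).
have e := eqvB oB (cov2 mu nu) (cov2 nu mu).
apply: (eqv_trans oB (e : eqv (nahm_curvature S A f z mu nu) _)).
rewrite -(mulfB (phase z)); apply: ephase.
rewrite add_shuffle3.
set c := conn_form mu (conn_form nu (s z)); set d := conn_form nu (conn_form mu (s z)).
have Lc : L2 c := LC _ _ (LC _ _ (Ls z)).
have Ld : L2 d := LC _ _ (LC _ _ (Ls z)).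
rewrite -[X in eqv _ X]add0r.
apply: (eqvD oB); last first.
  exact: (refl (LB Lc Ld)).
exact: (eqv_sub0 e12).
Qed.

End curvature.
End nahm_curvature.

(** * The Hodge star in coordinates *)

(** The sign of [b - a] in a form that reduces on numerals, so the Hodge table below follows by
    simplification. *)
Definition sgd (a b : nat) : int := if (a < b)%N then 1 else if (b < a)%N then -1 else 0.

Lemma sgdE (a b : nat) : Num.sg (b%:Z - a%:Z) = sgd a b.
Proof.
rewrite /sgd; have [ab|ba|->] := ltngtP a b; last by rewrite subrr sgr0.
  by rewrite gtr0_sg// subr_gt0 ltz_nat.
by rewrite ltr0_sg// subr_lt0 ltz_nat.
Qed.

Definition lcn (a b c d : nat) : int :=
  sgd a b * sgd a c * sgd a d * sgd b c * sgd b d * sgd c d.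

Lemma levi_civitaE (mu nu rho sigma : 'I_4) :
  levi_civita mu nu rho sigma = lcn mu nu rho sigma.
Proof.
rewrite /levi_civita; under eq_bigr do under eq_bigr do rewrite sgdE.
under eq_bigr do rewrite big_mkcond/=.
by rewrite !big_ord_recl !big_ord0 /= /lcn !mul1r !mulr1 !mulrA.
Qed.

Lemma hodgeE (V : zmodType) (F : 'I_4 -> 'I_4 -> V) (mu nu : 'I_4) :
  hodge F mu nu = F i1 i2 *~ lcn mu nu 0 1 + F i1 i3 *~ lcn mu nu 0 2 +
    F i1 i4 *~ lcn mu nu 0 3 + F i2 i3 *~ lcn mu nu 1 2 +
    F i2 i4 *~ lcn mu nu 1 3 + F i3 i4 *~ lcn mu nu 2 3.
Proof.
rewrite /hodge; under eq_bigr do rewrite big_mkcond/=.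
rewrite !big_ord_recl !big_ord0 /= !levi_civitaE.
have -> : ord0 = i1 by exact: val_inj.
have -> : lift i1 ord0 = i2 by exact: val_inj.
have -> : lift i1 (lift ord0 ord0) = i3 by exact: val_inj.
have -> : lift i1 (lift ord0 (lift ord0 ord0)) = i4 by exact: val_inj.
by rewrite !add0r !addr0 !addrA.
Qed.

Section hodge_table.
Context (V : zmodType) (F : 'I_4 -> 'I_4 -> V).

Let simp := (mulr0z, mulr1z, mulrN1z, add0r, addr0).

Lemma hodge12 : hodge F i1 i2 = F i3 i4.
Proof. by rewrite hodgeE /lcn /sgd /= !simp. Qed.

Lemma hodge_diag mu : hodge F mu mu = 0.
Proof. by rewrite hodgeE /lcn /sgd ltnn !mul0r !simp. Qed.

Lemma hodge_anti mu nu : hodge F nu mu = - hodge F mu nu.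
Proof.
have L rho sigma : lcn nu mu rho sigma = - lcn mu nu rho sigma.
  have sN a b : sgd b a = - sgd a b.
    by rewrite /sgd; case: ltngtP; rewrite ?opprK ?oppr0.
  by rewrite /lcn (sN mu nu); ring.
by rewrite !hodgeE !L !mulrNz -!opprD.
Qed.

Lemma hodge13 : hodge F i1 i3 = - F i2 i4.
Proof. by rewrite hodgeE /lcn /sgd /= !simp. Qed.
Lemma hodge14 : hodge F i1 i4 = F i2 i3.
Proof. by rewrite hodgeE /lcn /sgd /= !simp. Qed.
Lemma hodge23 : hodge F i2 i3 = F i1 i4.
Proof. by rewrite hodgeE /lcn /sgd /= !simp. Qed.
Lemma hodge24 : hodge F i2 i4 = - F i1 i3.
Proof. by rewrite hodgeE /lcn /sgd /= !simp. Qed.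
Lemma hodge34 : hodge F i3 i4 = F i1 i2.
Proof. by rewrite hodgeE /lcn /sgd /= !simp. Qed.

Lemma ordered_pairs_ind (Q : 'I_4 -> 'I_4 -> Prop) :
  (forall mu, Q mu mu) -> (forall mu nu, Q mu nu -> Q nu mu) ->
  Q i1 i2 -> Q i1 i3 -> Q i1 i4 -> Q i2 i3 -> Q i2 i4 -> Q i3 i4 ->
  forall mu nu, Q mu nu.
Proof.
move=> Qd Qs q12 q13 q14 q23 q24 q34 mu nu.
have cs (k : 'I_4) : [\/ k = i1, k = i2, k = i3 | k = i4].
  case: k => [[|[|[|[|//]]]] lt]; [apply: Or41|apply: Or42|apply: Or43|apply: Or44];
    exact: val_inj.
by case: (cs mu) => ->; case: (cs nu) => ->; try exact: Qd; try assumption;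
  apply: Qs; assumption.
Qed.

(* [Z] plays the role of equality to zero almost everywhere. *)
Lemma hodge_null (Z : V -> Prop) : Z 0 -> (forall u, Z u -> Z (- u)) ->
  (forall mu nu, F nu mu = - F mu nu) -> (forall mu, F mu mu = 0) ->
  (forall mu nu, Z (hodge F mu nu + F mu nu)) <->
  [/\ Z (F i1 i2 + F i3 i4), Z (F i1 i3 + F i4 i2) & Z (F i1 i4 + F i2 i3)].
Proof.
move=> Z0 ZN anti diag; split=> [h|[h1 h2 h3]].
  split.
  - by have := h i3 i4; rewrite hodge34.
  - have := h i1 i3; rewrite hodge13 addrC => h'.
    by rewrite (anti i2 i4).
  - by have := h i2 i3; rewrite hodge23.
rewrite (anti i2 i4) in h2.
(* The star exchanges the planes 12 and 34, 13 and 42, 14 and 23, so the six equations repeat three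
   of them up to sign. *)
apply: ordered_pairs_ind => [mu|mu nu||||||].
- by rewrite hodge_diag diag addr0.
- by move=> h; rewrite hodge_anti anti -opprD; exact: ZN.
- by rewrite hodge12 addrC.
- by rewrite hodge13 addrC.
- by rewrite hodge14 addrC.
- by rewrite hodge23.
- by rewrite hodge24 -[F i2 i4]opprK -opprD; exact: ZN.
- by rewrite hodge34.
Qed.

End hodge_table.

(** * From the connection form to the coordinate operators *)

Section coordinate_operators.
Context (R : realType) (B : set (R4 R)) (n : nat) (E : hermitian_bundle B n).
Context (oB : open B) (bB : bounded_set B).
Context (S : spinors R) (A : potential E) (cA : is_connection A).
Local Notation H := (ker_dirac S A).
Local Notation P := (Defs.proj (ker_dirac S A)).
Local Notation X := (xhat S A).
Local Notation conn := (conn_form S A).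
Implicit Types (s : sec E) (nu mu : 'I_4).

Let LB s (t : sec E) (Ls : L2 s) (Lt : L2 t) : L2 (s - t) := submoduleB (L2_sub E oB) Ls Lt.
Let LD s (t : sec E) (Ls : L2 s) (Lt : L2 t) : L2 (s + t) := submoduleD (L2_sub E oB) Ls Lt.
Let HL : H `<=` (@L2 R B n E : set (sec E)) := @ker_dirac_L2 R B n E S A.
Let sH : submodule H := ker_dirac_submodule oB S cA bB.
Let cH : rapidly_complete (@rip R B n E) H := ker_dirac_complete oB cA bB.
Let bP : bounded_op P 1 := proj_bounded_op oB HL sH cH.
Let refl s (Ls : L2 s) : eqv s s := eqv_refl oB Ls.

(* [dphase (basis4 R nu)] is multiplication by [-2 pi i x_nu]. *)
Let c0 : R[i] := 0 +i* (- (2 * pi)).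
(** The inverse of [c0]: it transfers the norm bound of [dphase] to multiplication by a coordinate,
    and shows that the curvature factor [c0 * c0] is nonzero. *)
Let c1 : R[i] := 0 +i* ((2 * pi)^-1).

Let c1c0 : c1 * c0 = 1.
Proof.
have p0 : (2 * pi : R) != 0 by rewrite mulf_neq0// gt_eqF// pi_gt0.
apply/eqP; rewrite eq_complex/=; apply/andP; split; apply/eqP; last by ring.
by rewrite mulrN opprK mulr0 add0r mulVf.
Qed.

Lemma mulf_dphase nu s : mulf (dphase (basis4 R nu)) s = c0 *: mulx nu s.
Proof.
apply/funext => i; apply/funext => x.
rewrite /mulf /dphase -[RHS]/(c0 *: ((Defs.coord nu x)%:C *: s i x)) scalerA; congr (_ *: _).
have -> : angle (basis4 R nu) x = angle x (basis4 R nu) by rewrite /angle; ring.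
rewrite angle_basis /c0; apply/eqP; rewrite eq_complex/=.
by apply/andP; split; apply/eqP; ring.
Qed.

Lemma mulx_bounded nu : exists2 M : R, 0 <= M & bounded_op (@mulx R B n E nu) M.
Proof.
have [M M0 mM] := dphase_multiplier oB bB (basis4 R nu).
exists (Num.sqrt (normc2 c1) * M); first by rewrite mulr_ge0 ?sqrtr_ge0.
have e : mulf (fun=> c1) \o mulf (dphase (basis4 R nu)) = @mulx R B n E nu.
  apply/funext => s /=; rewrite mulf_cst mulf_dphase scalerA c1c0; exact: scale1r.
rewrite -e; apply: (bounded_op_comp oB _ _ (sqrtr_ge0 _)).
  exact: (multiplier_bounded_op E oB (scale_multiplier oB c1)).
exact: (multiplier_bounded_op E oB mM).
Qed.

Lemma xhat_bounded nu : exists2 M : R, 0 <= M & bounded_op (X nu) M.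
Proof.
have [M M0 bM] := mulx_bounded nu; exists (1 * M); first by rewrite mul1r.
exact: (bounded_op_comp oB bP bM ler01).
Qed.

Lemma L2_xhat nu s : L2 s -> L2 (X nu s).
Proof. by move=> Ls; have [M _ [TL _ _]] := xhat_bounded nu; exact: (TL s Ls). Qed.

Lemma conn_form_xhat nu s : L2 s -> eqv (conn nu s) (c0 *: X nu s).
Proof.
move=> Ls; rewrite /conn_form mulf_dphase.
have [M _ [TL _ _]] := mulx_bounded nu.
exact: (bounded_opZ oB _ bP (TL s Ls)).
Qed.

Lemma conn_form_conn_form mu nu s : L2 s ->
  eqv (conn mu (conn nu s)) ((c0 * c0) *: X mu (X nu s)).
Proof.
move=> Ls; have e := conn_form_xhat nu Ls; have [Lc _ _] := e.
apply: (eqv_trans oB (conn_form_xhat mu Lc)); rewrite -scalerA; apply: (eqvZ oB).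
have [M _ bM] := xhat_bounded mu.
apply: (eqv_trans oB (bounded_op_congr oB bM e)).
exact: (bounded_opZ oB _ bM (L2_xhat nu Ls)).
Qed.

Lemma L2_opcomm mu nu s : L2 s -> L2 (opcomm (X mu) (X nu) s).
Proof. by move=> Ls; exact: LB (L2_xhat _ (L2_xhat _ Ls)) (L2_xhat _ (L2_xhat _ Ls)). Qed.

Lemma nahm_curvature_opcomm f z mu nu : nahm_section S A f ->
  eqv (nahm_curvature S A f z mu nu)
    (mulf (phase z) ((c0 * c0) *: opcomm (X mu) (X nu) (mulf (phase (- z)) (f z)))).
Proof.
move=> nf; apply: (eqv_trans oB (nahm_curvature_conn oB bB cA nf z mu nu)).
apply: (bounded_op_congr oB (multiplier_bounded_op E oB (phase_multiplier oB z))).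
have Ls := HL (proj1 (nahm_fibreP oB S A z (f z)) (nf.1 z)).
have e := eqvB oB (conn_form_conn_form mu nu Ls) (conn_form_conn_form nu mu Ls).
by rewrite -scalerBr in e; exact: e.
Qed.

Lemma nahm_section_phase s : H s -> nahm_section S A (fun z => mulf (phase z) s).
Proof.
move=> Hs; split=> [z|k]; last exact: (L2Ck_phase oB bB k (HL Hs)).
by apply: (proj2 (nahm_fibreP oB S A z _)); rewrite mulf_phaseNK.
Qed.

Local Notation null u := (eqv u 0).

Let null_scale z (c : R[i]) (u : sec E) : null u -> null (mulf (phase z) (c *: u)).
Proof.
move=> nu_; have e := bounded_op_congr oB (multiplier_bounded_op E oB (phase_multiplier oB z))
  (eqvZ oB c nu_).
have e0 : mulf (phase z) (c *: (0 : sec E)) = 0.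
  by apply/funext => i; apply/funext => x; rewrite /mulf scaler0 -[LHS]/(phase z x *: 0) scaler0.
by rewrite e0 in e.
Qed.

Let null_eqv (u v : sec E) : eqv u v -> null u <-> null v.
Proof.
by move=> e; split; [exact: (eqv_trans oB (eqv_sym oB e))|exact: (eqv_trans oB e)].
Qed.

(** The equivalence for one section at one point, which serves both implications: at [z = 0] for the
    section through a given vector of [H], and at an arbitrary [z] for a given section pulled back
    to [H]. *)
Lemma nahm_asd_at f z : nahm_section S A f ->
  (forall mu nu, aeq (hodge (nahm_curvature S A f z) mu nu)
     (- nahm_curvature S A f z mu nu)) <->
  (let s := mulf (phase (- z)) (f z) in
   [/\ null (opcomm (X i1) (X i2) s + opcomm (X i3) (X i4) s),
       null (opcomm (X i1) (X i3) s + opcomm (X i4) (X i2) s) &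
       null (opcomm (X i1) (X i4) s + opcomm (X i2) (X i3) s)]).
Proof.
move=> nf; cbv zeta; set s := mulf (phase (- z)) (f z).
set F := nahm_curvature S A f z.
have L0 := L2_0 E.
have nN (u : sec E) : null u -> null (- u).
  move=> h; have e := eqvZ oB (-1) h.
  by rewrite (scaleN1r u) (scaler0 _ (-1)) in e.
have anti mu nu : F nu mu = - F mu nu by rewrite /F /nahm_curvature opprB.
have diag mu : F mu mu = 0 by rewrite /F /nahm_curvature subrr.
have LF mu nu : L2 (F mu nu).
  by have [h _ _] := nahm_curvature_opcomm z mu nu nf.
have LNF mu nu : L2 (- F mu nu) by rewrite -anti.
have Lhodge : forall mu nu, L2 (hodge F mu nu).
  apply: ordered_pairs_ind => [mu|mu nu h||||||].
  - by rewrite hodge_diag.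
  - by rewrite hodge_anti; exact: (submoduleN (L2_sub E oB) h).
  - by rewrite hodge12.
  - by rewrite hodge13.
  - by rewrite hodge14.
  - by rewrite hodge23.
  - by rewrite hodge24.
  - by rewrite hodge34.
have step1 mu nu : aeq (hodge F mu nu) (- F mu nu) <-> null (hodge F mu nu + F mu nu).
  split=> [/(aeq_eqv oB (Lhodge mu nu) (LNF mu nu))|] [h1 h2 h3].
    split; [exact: LD (Lhodge mu nu) (LF mu nu)|exact: L0|].
    by rewrite subr0 -[F mu nu]opprK.
  apply: (eqv_aeq oB); split; [exact: Lhodge|exact: LNF|].
  by rewrite opprK -[_ + _]subr0.
have Ls : L2 s := HL (proj1 (nahm_fibreP oB S A z (f z)) (nf.1 z)).
have c0n : c0 * c0 != 0.
  by apply/eqP => e; have := congr1 (fun q => (c1 * c1) * q) e;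
    rewrite mulr0 mulrACA c1c0 mulr1; apply/eqP; exact: oner_neq0.
(* The phase and the nonzero scalar [c0 * c0] are invertible and preserve null sections, so both can
   be stripped from the curvature. *)
have step2 a b c d : null (F a b + F c d) <->
    null (opcomm (X a) (X b) s + opcomm (X c) (X d) s).
  have e := eqvD oB (nahm_curvature_opcomm z a b nf) (nahm_curvature_opcomm z c d nf).
  rewrite -/s -(mulfD (phase z)) -scalerDr in e.
  apply: (iff_trans (null_eqv e)); split=> [h|]; last exact: null_scale.
  set u := (_ + _) in h *.
  have e' := null_scale (- z) ((c0 * c0)^-1) h.
  by rewrite (mulfZ (phase (- z))) mulf_phaseNK scalerA (mulVf c0n) (scale1r u) in e'.
have key := hodge_null (Z := fun u => eqv u 0) (refl L0) nN anti diag.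
split=> [h|[h1 h2 h3]].
  have [k1 k2 k3] := proj1 key (fun mu nu => proj1 (step1 mu nu) (h mu nu)).
  by split; [exact: (proj1 (step2 _ _ _ _) k1)|exact: (proj1 (step2 _ _ _ _) k2)|
    exact: (proj1 (step2 _ _ _ _) k3)].
move=> mu nu; apply: (proj2 (step1 mu nu)); apply: (proj2 key).
by split; [exact: (proj2 (step2 _ _ _ _) h1)|exact: (proj2 (step2 _ _ _ _) h2)|
  exact: (proj2 (step2 _ _ _ _) h3)].
Qed.

End coordinate_operators.

Theorem lemma2p3 (R : realType) (S : spinors R) (B : set (R4 R)) (n : nat)
    (E : hermitian_bundle B n) (A : potential E) :
  smooth_bounded_domain B -> is_connection A -> asd_connection A ->
  let x := xhat S A in
  nahm_asd S A <->
  forall s : sec E, ker_dirac S A s ->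
    [/\ aeq (opcomm (x i1) (x i2) s + opcomm (x i3) (x i4) s) 0,
        aeq (opcomm (x i1) (x i3) s + opcomm (x i4) (x i2) s) 0 &
        aeq (opcomm (x i1) (x i4) s + opcomm (x i2) (x i3) s) 0].
Proof.
move=> [oB _ _ bB _] cA _ x; split=> [h s Hs|h f nf z].
  have nf := nahm_section_phase oB bB Hs.
  have := proj1 (nahm_asd_at oB bB cA 0 nf) (h _ nf 0).
  rewrite mulf_phaseNK => -[h1 h2 h3].
  by split; [exact: (eqv_aeq oB h1)|exact: (eqv_aeq oB h2)|exact: (eqv_aeq oB h3)].
have Hs := proj1 (nahm_fibreP oB S A z (f z)) (nf.1 z).
set s := mulf _ _ in Hs.
have Ls := ker_dirac_L2 Hs; have L0 := L2_0 E.
have L mu nu rho sigma : L2 (opcomm (x mu) (x nu) s + opcomm (x rho) (x sigma) s) :=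
  submoduleD (L2_sub E oB) (L2_opcomm oB bB S cA mu nu Ls) (L2_opcomm oB bB S cA rho sigma Ls).
have [h1 h2 h3] := h _ Hs; apply: (proj2 (nahm_asd_at oB bB cA z nf)).
by split; [exact: (aeq_eqv oB (L _ _ _ _) L0 h1)|exact: (aeq_eqv oB (L _ _ _ _) L0 h2)|
  exact: (aeq_eqv oB (L _ _ _ _) L0 h3)].
Qed.
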